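(* Suppose that $1<p<\infty$ and $p\neq2$. Let $\mu_1$ and $\mu_2$ be finite measures on $\mathbb{C}$ with compact supports, and assume that neither $\mathrm{supp}(\mu_1)$ nor $\mathrm{supp}(\mu_2)$ is a finite set. Let $\mu_1'$ and $\mu_2'$ be the purely nonatomic parts of $\mu_1$ and $\mu_2$, respectively. For $i=1,2$ let $M_{\mu_i}$ be the operator on $L^p(\mu_i)$ given by $(M_{\mu_i}f)(z)=zf(z)$. Then the following statements are equivalent. (i) There exists a compact operator $K$ on $L^p(\mu_2)$ such that $M_{\mu_1}$ is similar to $M_{\mu_2}+K$. (ii) $\mu_1'$ and $\mu_2'$ are equivalent, and the sets $\mathrm{supp}(\mu_1)$ and $\mathrm{supp}(\mu_2)$ have the same cluster points.
   Context: Measures are (positive) Borel measures; $L^p$ spaces are complex; operators are bounded and linear. Two measures are equivalent if each is absolutely continuous with respect to the other. Operators $T_1$ on a Banach space $X_1$ and $T_2$ on a Banach space $X_2$ are similar if there is an isomorphism (bounded linear bijection with bounded inverse) $W:X_1\to X_2$ with $T_2=WT_1W^{-1}$. *)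

(* Defs.v *)
(* The reals are an arbitrary [R : realType] and the complex numbers are [R[i]],
   with the topology of the modulus; [normc] is the modulus as an element of R. *)
From HB Require Import structures.
From mathcomp Require Import all_boot all_order all_algebra.
From mathcomp Require Import ring_quotient complex.
From mathcomp Require Import all_classical all_reals all_analysis.
From mathcomp Require Import measurable_realfun lra.

Set Implicit Arguments.
Unset Strict Implicit.
Unset Printing Implicit Defensive.
Import Order.TTheory GRing.Theory Num.Theory.
Import numFieldNormedType.Exports.
Import Normc.

Local Open Scope classical_set_scope.
Local Open Scope ring_scope.
Local Open Scope quotient_scope.

HB.instance Definition _ (R : realType) := NormedModule.copy R[i] R[i]^o.

(* The complex numbers with their Borel sigma-algebra. *)
Definition borelC (R : realType) := g_sigma_algebraType (@open R[i]).
HB.instance Definition _ (R : realType) := Measurable.on (borelC R).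

Section measurable_complex.
Context {R : realType}.
Implicit Types z w : R[i].
Local Notation Re := (@complex.Re R).
Local Notation Im := (@complex.Im R).

Lemma normr_normc z : `|z| = (normc z)%:C%C. Proof. by []. Qed.

Lemma normc_ge0 z : 0 <= normc z.
Proof. by case: z => a b; exact: sqrtr_ge0. Qed.

Lemma ler_normcD z w : normc (z + w) <= normc z + normc w.
Proof. exact: (@le_normcD R z w). Qed.

Lemma normc_opp z : normc (- z) = normc z.
Proof. exact: (@complex.normcN R z). Qed.

Lemma ler_norm_Re z : `|Re z| <= normc z.
Proof. by case: z => a b /=; rewrite -sqrtr_sqr ler_wsqrtr// lerDl sqr_ge0. Qed.

Lemma ler_norm_Im z : `|Im z| <= normc z.
Proof. by case: z => a b /=; rewrite -sqrtr_sqr ler_wsqrtr// lerDr sqr_ge0. Qed.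

Lemma normc_le_ReIm z : normc z <= `|Re z| + `|Im z|.
Proof.
case: z => a b /=.
rewrite -[leRHS]ger0_norm ?addr_ge0// -sqrtr_sqr ler_wsqrtr//.
by rewrite sqrrD !real_normK ?num_real// lerD2r lerDl mulrn_wge0// mulr_ge0.
Qed.

Lemma open_normcP (U : set R[i]) :
  open U <-> forall z, U z -> exists2 e : R, 0 < e &
    forall w, normc (z - w) < e -> U w.
Proof.
split=> [oU z Uz|h].
  have /nbhs_ballP[e /= e0 eU] := open_nbhs_nbhs (conj oU Uz).
  move: (e0); rewrite ltcE/= => /andP[/eqP eI eR].
  exists (Re e) => // w zw; apply: eU; rewrite -ball_normE /ball_/=.
  by rewrite ltcE normr_normc/= -eI eqxx.
rewrite openE => z /h[e e0 eU]; apply/nbhs_ballP; exists (e%:C)%C => /=.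
  by rewrite ltcR.
by move=> w; rewrite -ball_normE /ball_/= normr_normc ltcR; exact: eU.
Qed.

Lemma open_measurableC (U : set (borelC R)) :
  open (U : set R[i]) -> measurable U.
Proof. by move=> oU; exact: sub_sigma_algebra. Qed.

Lemma normc_lipschitz_continuous (f : R[i] -> R) :
  (forall z w, `|f z - f w| <= normc (z - w)) -> continuous f.
Proof.
move=> fL; apply/continuousP => U oU; apply/open_normcP => z /= Uz.
have /nbhs_ballP[e/= e0 eU] := open_nbhs_nbhs (conj oU Uz).
by exists e => // w zw; apply: eU; exact: le_lt_trans (fL z w) zw.
Qed.

Lemma continuous_measurable_funC (f : R[i] -> R) : continuous f ->
  measurable_fun [set: borelC R] (f : borelC R -> R).
Proof.
move=> /continuousP cf.
apply: (measurability _ (@RGenOpens.measurableE R)) => /=.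
move=> _ [_ [a [b ->] <-]]; rewrite setTI; apply: open_measurableC.
by apply: cf; exact: interval_open.
Qed.

Lemma continuous_Re : continuous Re.
Proof.
apply: normc_lipschitz_continuous => -[a b] [c d].
exact: (ler_norm_Re (Complex a b - Complex c d)).
Qed.

Lemma continuous_Im : continuous Im.
Proof.
apply: normc_lipschitz_continuous => -[a b] [c d].
exact: (ler_norm_Im (Complex a b - Complex c d)).
Qed.

Lemma continuous_normc : continuous (@normc R).
Proof.
apply: normc_lipschitz_continuous => z w.
have zw : normc z <= normc (z - w) + normc w.
  by rewrite -{1}(subrK w z) ler_normcD.
have wz : normc w <= normc (z - w) + normc z.
  by rewrite -[normc (z - w)]normc_opp opprB -{1}(subrK z w) ler_normcD.
by rewrite ler_norml lerBlDr zw andbT lerNl opprB lerBlDr.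
Qed.

Lemma measurable_Re : measurable_fun [set: borelC R] (Re : borelC R -> R).
Proof. exact: continuous_measurable_funC continuous_Re. Qed.

Lemma measurable_Im : measurable_fun [set: borelC R] (Im : borelC R -> R).
Proof. exact: continuous_measurable_funC continuous_Im. Qed.

Lemma measurable_normc :
  measurable_fun [set: borelC R] (@normc R : borelC R -> R).
Proof. exact: continuous_measurable_funC continuous_normc. Qed.

Definition square (q : rat * rat * rat) : set R[i] :=
  [set z | `|Re z - ratr q.1.1| < ratr q.2] `&`
  [set z | `|Im z - ratr q.1.2| < ratr q.2].

Lemma square_basis (U : set R[i]) z : open U -> U z ->
  exists2 q, square q z & square q `<=` U.
Proof.
move=> oU Uz; have [e e0 eU] := (open_normcP U).1 oU _ Uz.
have [c /[!in_itv]/= /andP[c1 c2]] : exists q : rat, ratr q \in `]e / 8, e / 4[.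
  by apply: rat_in_itvoo; rewrite ltr_pM2l// ltf_pV2// ?posrE// ltr_nat.
have c0 : 0 < ratr c :> R by rewrite (lt_trans _ c1)// divr_gt0.
have [a /[!in_itv]/= /andP[a1 a2]] :
    exists q : rat, ratr q \in `]Re z - ratr c, Re z + ratr c[.
  by apply: rat_in_itvoo; rewrite ltrD2l gtrN.
have [b /[!in_itv]/= /andP[b1 b2]] :
    exists q : rat, ratr q \in `]Im z - ratr c, Im z + ratr c[.
  by apply: rat_in_itvoo; rewrite ltrD2l gtrN.
have Ra : `|Re z - ratr a| < ratr c by rewrite distrC ltr_distl a1 a2.
have Ib : `|Im z - ratr b| < ratr c by rewrite distrC ltr_distl b1 b2.
exists (a, b, c) => //= w [/= wR wI]; apply: eU.
apply: le_lt_trans (normc_le_ReIm _) _.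
have -> : Re (z - w) = Re z - Re w by case: (z) => ? ?; case: (w).
have -> : Im (z - w) = Im z - Im w by case: (z) => ? ?; case: (w).
move: Ra Ib wR wI c2; rewrite !ltr_norml.
move=> /andP[? ?] /andP[? ?] /andP[? ?] /andP[? ?] ?.
have h1 : `|Re z - Re w| < 2 * ratr c.
  by rewrite ltr_norml; apply/andP; split; lra.
have h2 : `|Im z - Im w| < 2 * ratr c.
  by rewrite ltr_norml; apply/andP; split; lra.
by lra.
Qed.

Context d {T : measurableType d}.

Lemma measurable_funC (f : T -> R[i]) :
  measurable_fun setT (f : T -> borelC R) <->
  measurable_fun setT (Re \o f) /\ measurable_fun setT (Im \o f).
Proof.
split=> [mf|[mR mI]].
  split; first exact: measurableT_comp measurable_Re mf.
  exact: measurableT_comp measurable_Im mf.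
have mS q : measurable (f @^-1` square q).
  apply: measurableI.
  - rewrite [X in measurable X](_ : _ = (Re \o f) @^-1`
      `]ratr q.1.1 - ratr q.2, ratr q.1.1 + ratr q.2[%classic).
      by rewrite -[X in measurable X]setTI; exact: mR.
    by apply/seteqP; split => t /=; rewrite in_itv/= -ltr_distl distrC.
  - rewrite [X in measurable X](_ : _ = (Im \o f) @^-1`
      `]ratr q.1.2 - ratr q.2, ratr q.1.2 + ratr q.2[%classic).
      by rewrite -[X in measurable X]setTI; exact: mI.
    by apply/seteqP; split => t /=; rewrite in_itv/= -ltr_distl distrC.
apply: (@measurability _ _ _ (borelC R) _ f (@open R[i])) => //.
move=> _ [U oU <-]; rewrite setTI.
have -> : f @^-1` U = \bigcup_(q in [set q | square q `<=` U]) f @^-1` square q.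
  apply/seteqP; split => [t Uft|t [q qU] ?]; last exact: qU.
  by have [q ? ?] := square_basis oU Uft; exists q.
rewrite bigcup_mkcond; apply: countable_bigcupT_measurable => [|q].
  exact: countableP.
by case: ifPn => _ //; exact: mS.
Qed.

End measurable_complex.

Definition LnormC d (T : measurableType d) (R : realType)
    (mu : {measure set T -> \bar R}) (p : R) (f : T -> R[i]) : \bar R :=
  Lnorm mu p%:E (EFin \o (fun x => normc (f x))).

Section Lp_functions.
Context d {T : measurableType d} {R : realType}.
Variables (mu : {measure set T -> \bar R}) (p : R).
Implicit Types (f g : T -> R[i]) (a : R[i]).

Lemma measurable_normcE f : measurable_fun setT (f : T -> borelC R) ->
  measurable_fun setT (fun x => normc (f x)).
Proof. exact: measurableT_comp measurable_normc. Qed.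

Lemma measurable_linC a f g : measurable_fun setT (f : T -> borelC R) ->
  measurable_fun setT (g : T -> borelC R) ->
  measurable_fun setT (a *: f + g : T -> borelC R).
Proof.
move=> /measurable_funC[fR fI] /measurable_funC[gR gI]; apply/measurable_funC.
case: a => a b; split.
  rewrite (_ : _ \o _ = fun x =>
      a * complex.Re (f x) - b * complex.Im (f x) + complex.Re (g x)).
    apply: measurable_funD => //.
    by apply: measurable_funB; exact: measurable_funM.
  by apply/funext => x /=; rewrite !fctE; case: (f x) => ? ?; case: (g x).
rewrite (_ : _ \o _ = fun x =>
    a * complex.Im (f x) + b * complex.Re (f x) + complex.Im (g x)).
  apply: measurable_funD => //.
  by apply: measurable_funD; exact: measurable_funM.
by apply/funext => x /=; rewrite !fctE; case: (f x) => ? ?; case: (g x).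
Qed.

Lemma LnormC_ge0 f : (0 <= LnormC mu p f)%E. Proof. exact: Lnorm_ge0. Qed.

Lemma LnormCE f :
  (LnormC mu p f = (\int[mu]_x (normc (f x) `^ p)%:E) `^ p^-1)%E.
Proof.
rewrite /LnormC unlock; congr (_ `^ _)%E; apply: eq_integral => x _ /=.
by rewrite ger0_norm ?normc_ge0.
Qed.

Lemma measurable_normc_powR f : measurable_fun setT (f : T -> borelC R) ->
  measurable_fun setT (fun x => (normc (f x) `^ p)%:E).
Proof.
move=> mf; apply/measurable_EFinP.
apply: (@measurableT_comp _ _ _ _ _ _ (@powR R ^~ p)) => //.
exact: measurable_normcE.
Qed.

Lemma LnormC_le f g : 0 < p -> measurable_fun setT (f : T -> borelC R) ->
  measurable_fun setT (g : T -> borelC R) ->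
  {ae mu, forall x, normc (f x) <= normc (g x)} ->
  (LnormC mu p f <= LnormC mu p g)%E.
Proof.
move=> p0 mf mg fg; rewrite !LnormCE gt0_ler_poweR ?invr_ge0 ?(ltW p0)//.
- by rewrite in_itv/= leey integral_ge0// => x _; rewrite lee_fin powR_ge0.
- by rewrite in_itv/= leey integral_ge0// => x _; rewrite lee_fin powR_ge0.
apply: ae_ge0_le_integral => //.
- by move=> x _; rewrite lee_fin powR_ge0.
- exact: measurable_normc_powR.
- by move=> x _; rewrite lee_fin powR_ge0.
- exact: measurable_normc_powR.
apply: filterS fg => x h _; rewrite lee_fin.
by rewrite ge0_ler_powR ?(ltW p0)// nnegrE normc_ge0.
Qed.

Lemma LnormC_ae_eq f g : 0 < p -> measurable_fun setT (f : T -> borelC R) ->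
  measurable_fun setT (g : T -> borelC R) ->
  {ae mu, forall x, f x = g x} -> LnormC mu p f = LnormC mu p g.
Proof.
move=> p0 mf mg fg; apply/eqP; rewrite eq_le !LnormC_le//.
  by apply: filterS fg => x ->.
by apply: filterS fg => x ->.
Qed.

Lemma LnormCZ a f : 0 < p -> measurable_fun setT (f : T -> borelC R) ->
  (LnormC mu p (a *: f) = (normc a)%:E * LnormC mu p f)%E.
Proof.
move=> p0 mf; rewrite !LnormCE.
under eq_integral do rewrite normcM powRM ?normc_ge0// EFinM.
rewrite ge0_integralZl//; last 3 first.
- exact: measurable_normc_powR.
- by move=> x _; rewrite lee_fin powR_ge0.
- by rewrite lee_fin powR_ge0.
rewrite poweRM ?lee_fin ?powR_ge0//; last first.
  by apply: integral_ge0 => x _; rewrite lee_fin powR_ge0.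
by rewrite poweR_EFin -powRrM mulfV ?gt_eqF// powRr1 ?normc_ge0.
Qed.

Lemma LnormCD f g : 1 <= p -> measurable_fun setT (f : T -> borelC R) ->
  measurable_fun setT (g : T -> borelC R) ->
  (LnormC mu p (f + g)%R <= LnormC mu p f + LnormC mu p g)%E.
Proof.
move=> p1 mf mg; have p0 : 0 < p by rewrite (lt_le_trans ltr01).
apply: (le_trans _
  (minkowski_EFin mu (measurable_normcE mf) (measurable_normcE mg) p1)).
have -> : Lnorm mu p%:E
      (EFin \o ((fun x => normc (f x)) \+ (fun x => normc (g x)))) =
    LnormC mu p (fun x => (normc (f x) + normc (g x))%:C%C).
  congr (Lnorm _ _ _); apply/funext => x /=.
  by rewrite expr0n/= addr0 sqrtr_sqr ger0_norm// addr_ge0 ?normc_ge0.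
apply: LnormC_le => //.
- by have := measurable_linC 1 mf mg; rewrite scale1r.
- apply/measurable_funC; split => /=; last exact: measurable_cst.
  by apply: measurable_funD; exact: measurable_normcE.
apply: aeW => x /=.
rewrite expr0n/= addr0 sqrtr_sqr ger0_norm ?addr_ge0 ?normc_ge0//.
exact: ler_normcD.
Qed.

Lemma LnormC_eq0 f : 0 < p -> measurable_fun setT (f : T -> borelC R) ->
  LnormC mu p f = 0 -> {ae mu, forall x, f x = 0}.
Proof.
move=> p0 mf /Lnorm_eq0_eq0 h.
have /h/(_ p0) : measurable_fun setT (EFin \o (fun x => normc (f x))).
  by apply/measurable_EFinP; exact: measurable_normcE.
by apply: filterS => x /(_ I) [/eq0_normc].
Qed.

End Lp_functions.

Section Lfun_pred.
Context d (T : measurableType d) (R : realType).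
Variables (mu : {measure set T -> \bar R}) (p : R).

(* Borel functions f with finite \int |f|^p. The unused argument [1 <= p] lets
   the vector space structure be inferred from the type [LfunC]. *)
Definition LfunC_pred of 1 <= p : {pred T -> R[i]} := mem
  [set f | measurable_fun setT (f : T -> borelC R) /\ (LnormC mu p f < +oo)%E].

Variable p1 : 1 <= p.

Let p_gt0 : 0 < p. Proof. exact: lt_le_trans p1. Qed.

Lemma LfunC_submod_closed : submod_closed (LfunC_pred p1).
Proof.
have m0 : measurable_fun [set: T] ((0 : T -> R[i]) : T -> borelC R).
  exact: measurable_cst.
split; first rewrite inE; first split => //.
  by rewrite -(scale0r (0 : T -> R[i])) LnormCZ// normc0 mul0e.
move=> a f g; rewrite !inE => -[mf lf] [mg lg]; split.
  exact: measurable_linC.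
have maf : measurable_fun [set: T] ((a *: f) : T -> borelC R).
  by rewrite -(addr0 (a *: f)); exact: measurable_linC.
apply: le_lt_trans (LnormCD mu p1 maf mg) _.
by rewrite lte_add_pinfty// LnormCZ// lte_mul_pinfty// lee_fin normc_ge0.
Qed.

HB.instance Definition _ := GRing.isSubmodClosed.Build _ _ (LfunC_pred p1)
  LfunC_submod_closed.

Definition LfunC := {f : T -> R[i] | f \in LfunC_pred p1}.

HB.instance Definition _ := SubType.on LfunC.
HB.instance Definition _ := [Choice of LfunC by <:].
HB.instance Definition _ := [SubChoice_isSubLmodule of LfunC by <:].

Definition LfunC_fun (f : LfunC) : T -> R[i] := val f.
Coercion LfunC_fun : LfunC >-> Funclass.

Lemma LfunC_subE (f g : LfunC) x : LfunC_fun (f - g) x = f x - g x.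
Proof. by []. Qed.

Lemma LfunC_scaleE a (f : LfunC) x : LfunC_fun (a *: f) x = a * f x.
Proof. by []. Qed.

Lemma LfunC_measurable (f : LfunC) :
  measurable_fun setT (f : T -> borelC R).
Proof. by have := valP f; rewrite inE => -[]. Qed.

Lemma LfunC_lty (f : LfunC) : (LnormC mu p f < +oo)%E.
Proof. by have := valP f; rewrite inE => -[]. Qed.

Definition ae_null : {pred LfunC} :=
  mem [set f : LfunC | {ae mu, forall x, f x = 0}].

Lemma ae_null_zmod_closed : zmod_closed ae_null.
Proof.
split=> [|f g]; rewrite !inE /=.
  by apply: aeW => x; rewrite /LfunC_fun raddf0.
by apply: filterS2 => x fx gx; rewrite LfunC_subE fx gx subrr.
Qed.

HB.instance Definition _ := GRing.isZmodClosed.Build _ ae_null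
  ae_null_zmod_closed.

(* The complex space L^p(mu): p-integrable functions modulo a.e. equality, with
   norm (\int |f|^p)^(1/p), cast to R[i]. *)
Definition Lp : Type := Quotient.quot ae_null.

HB.instance Definition _ := Choice.on Lp.
HB.instance Definition _ := GRing.Zmodule.on Lp.
HB.instance Definition _ := EqQuotient.on Lp.
HB.instance Definition _ := ZmodQuotient.on Lp.

Definition Lp_class (f : LfunC) : Lp := \pi f.

Definition Lp_fun (F : Lp) : LfunC := repr F.
Coercion Lp_fun : Lp >-> LfunC.

Lemma Lp_classP (f g : LfunC) :
  Lp_class f = Lp_class g <-> {ae mu, forall x, f x = g x}.
Proof.
rewrite /Lp_class; split.
  move/eqP; rewrite -Quotient.idealrBE inE/=.
  by apply: filterS => x; rewrite LfunC_subE => /subr0_eq.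
move=> fg; apply/eqP; rewrite -Quotient.idealrBE inE/=.
by apply: filterS fg => x; rewrite LfunC_subE => ->; rewrite subrr.
Qed.

Lemma Lp_funK (F : Lp) : Lp_class F = F. Proof. exact: reprK. Qed.

Lemma Lp_classK (f : LfunC) : {ae mu, forall x, Lp_class f x = f x}.
Proof. by apply/Lp_classP; rewrite Lp_funK. Qed.

Lemma Lp_classD : {morph Lp_class : f g / f + g}.
Proof. by move=> f g; rewrite /Lp_class raddfD. Qed.

Definition Lp_scale (a : R[i]) (F : Lp) : Lp := Lp_class (a *: (F : LfunC)).

Lemma Lp_scale_class a f : Lp_scale a (Lp_class f) = Lp_class (a *: f).
Proof.
apply/Lp_classP; apply: filterS (Lp_classK f) => x.
by rewrite !LfunC_scaleE => ->.
Qed.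

Let scalerA a b (F : Lp) : Lp_scale a (Lp_scale b F) = Lp_scale (a * b) F.
Proof. by rewrite -[F]Lp_funK !Lp_scale_class scalerA. Qed.

Let scale1r : left_id 1 Lp_scale.
Proof. by move=> F; rewrite -[F]Lp_funK Lp_scale_class scale1r. Qed.

Let scalerDr : right_distributive Lp_scale +%R.
Proof.
move=> a F G; rewrite -[F]Lp_funK -[G]Lp_funK -Lp_classD !Lp_scale_class.
by rewrite scalerDr Lp_classD.
Qed.

Let scalerDl F : {morph Lp_scale^~ F : a b / a + b}.
Proof.
by move=> a b /=; rewrite -[F]Lp_funK !Lp_scale_class scalerDl Lp_classD.
Qed.

HB.instance Definition _ := GRing.Zmodule_isLmodule.Build R[i] Lp
  scalerA scale1r scalerDr scalerDl.

Lemma Lp_class_is_linear : linear Lp_class.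
Proof. by move=> a f g; rewrite Lp_classD -Lp_scale_class. Qed.

HB.instance Definition _ := GRing.isLinear.Build R[i] LfunC Lp *:%R Lp_class
  Lp_class_is_linear.

Definition Lp_norm (F : Lp) : R := fine (LnormC mu p F).

Lemma Lp_norm_class f : Lp_norm (Lp_class f) = fine (LnormC mu p f).
Proof.
congr fine; apply: LnormC_ae_eq (Lp_classK f) => //;
  exact: LfunC_measurable.
Qed.

Lemma LnormC_fine (f : LfunC) : (fine (LnormC mu p f))%:E = LnormC mu p f.
Proof. by rewrite fineK// ge0_fin_numE ?LnormC_ge0// LfunC_lty. Qed.

Let ler_normD F G :
  ((Lp_norm (F + G))%:C <= (Lp_norm F)%:C + (Lp_norm G)%:C)%C.
Proof.
rewrite -rmorphD lecR -[F]Lp_funK -[G]Lp_funK -Lp_classD !Lp_norm_class.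
rewrite -lee_fin EFinD !LnormC_fine.
by apply: LnormCD => //; exact: LfunC_measurable.
Qed.

Let normrZ a F : ((Lp_norm (a *: F))%:C = `|a| * (Lp_norm F)%:C)%C.
Proof.
rewrite normr_normc -rmorphM -[F]Lp_funK -linearZ !Lp_norm_class.
congr (_%:C)%C.
apply: EFin_inj; rewrite EFinM !LnormC_fine.
by rewrite -LnormCZ//; exact: LfunC_measurable.
Qed.

Let normr0_eq0 F : ((Lp_norm F)%:C = 0)%C -> F = 0.
Proof.
case; rewrite -[F]Lp_funK Lp_norm_class => F0.
rewrite -(raddf0 Lp_class); apply/Lp_classP.
apply: (LnormC_eq0 p_gt0); first exact: LfunC_measurable.
by rewrite -LnormC_fine F0.
Qed.

HB.instance Definition _ := Lmodule_isNormed.Build R[i] Lp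
  ler_normD normrZ normr0_eq0.

End Lfun_pred.

Section Borel_measures.
Context {R : realType}.
Implicit Types mu nu : {finite_measure set borelC R -> \bar R}.

Definition supp mu : set R[i] :=
  [set z | forall U : set R[i], open U -> U z -> (0 < mu U)%E].

Lemma open_square q : open (@square R q).
Proof.
apply/open_normcP => z [/= zR zI].
have R0 : 0 < ratr q.2 - `|complex.Re z - ratr q.1.1| by rewrite subr_gt0.
have I0 : 0 < ratr q.2 - `|complex.Im z - ratr q.1.2| by rewrite subr_gt0.
exists (Num.min (ratr q.2 - `|complex.Re z - ratr q.1.1|)
  (ratr q.2 - `|complex.Im z - ratr q.1.2|)).
  by rewrite lt_min R0.
move=> w; rewrite lt_min => /andP[wR wI]; split => /=.
- rewrite (le_lt_trans (ler_distD (complex.Re z) _ _))// -ltrBrDr distrC.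
  have -> : complex.Re z - complex.Re w = complex.Re (z - w).
    by case: (z) => ? ?; case: (w).
  exact: le_lt_trans (ler_norm_Re _) wR.
- rewrite (le_lt_trans (ler_distD (complex.Im z) _ _))// -ltrBrDr distrC.
  have -> : complex.Im z - complex.Im w = complex.Im (z - w).
    by case: (z) => ? ?; case: (w).
  exact: le_lt_trans (ler_norm_Im _) wI.
Qed.

Lemma measurable_square q : measurable (@square R q : set (borelC R)).
Proof. by apply: open_measurableC; exact: open_square. Qed.

Lemma negligible_squares mu (A : set (borelC R)) (D : set (rat * rat * rat)) :
  (forall q, D q -> mu.-negligible (A `&` square q)) ->
  mu.-negligible (A `&` \bigcup_(q in D) square q).
Proof.
move=> D0; pose F n : set (borelC R) :=
  if unpickle n is Some q
  then if q \in D then A `&` square q else set0 else set0.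
apply: (@negligibleS _ _ _ _ (\bigcup_n F n)).
  move=> z [Az [q Dq qz]]; exists (pickle q); first exact: I.
  by rewrite /F pickleK mem_set.
apply: negligible_bigcup => n; rewrite /F.
case: unpickle => [q|]; last exact: negligible_set0.
by case: ifPn => [/set_mem/D0//|_]; exact: negligible_set0.
Qed.

Lemma supp_ae mu : {ae mu, forall z, supp mu z}.
Proof.
have : mu.-negligible ([set: borelC R] `&`
    \bigcup_(q in [set q | mu (square q) = 0%E]) square q).
  apply: negligible_squares => q /= q0; exists (square q).
  by split; [exact: measurable_square|exact: q0|move=> z []].
rewrite setTI => h.
apply: negligibleS h => z /= /existsNP[U] /not_implyP[oU] /not_implyP[Uz] U0.
have [q qz qU] := square_basis oU Uz; exists q => //=.
apply/eqP; rewrite eq_le measure_ge0 andbT leNgt; apply/negP => q0; apply: U0.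
rewrite (lt_le_trans q0)// le_measure// inE; first exact: measurable_square.
exact: open_measurableC.
Qed.

Lemma measurable_set1C (z : R[i]) : measurable ([set z] : set (borelC R)).
Proof.
rewrite -[X in measurable X]setCK; apply: measurableC; apply: open_measurableC.
apply/open_normcP => w /= /eqP wz; exists (normc (w - z)).
  rewrite lt_neqAle normc_ge0 andbT eq_sym; apply/eqP.
  by move=> /eq0_normc/subr0_eq/eqP; apply/negP.
by move=> v; rewrite ltNge => /negP vw /= vz; apply: vw; rewrite vz.
Qed.

Definition point_masses mu : set (borelC R) := [set z | (0 < mu [set z])%E].

Lemma countable_point_masses mu : countable (point_masses mu).
Proof.
have -> : point_masses mu = \bigcup_n [set z | (n.+1%:R^-1%:E <= mu [set z])%E].
  apply/seteqP; split => [z /= z0|z [n _] /=]; last first.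
    by apply: lt_le_trans; rewrite lte_fin invr_gt0.
  have fz : mu [set z] \is a fin_num.
    by apply: fin_num_measure; exact: measurable_set1C.
  move: z0; rewrite /point_masses/= -(fineK fz) lte_fin => z0.
  have [n nz] := ltr_add_invr z0.
  by exists n => //=; rewrite -(fineK fz) lee_fin -[leLHS]add0r ltW.
apply: bigcup_countable => // n _; apply: finite_set_countable.
rewrite -[finite_set _]asboolE; apply: contrapT => /negP/asboolP inf.
have ft : mu setT \is a fin_num by exact: fin_num_measure.
pose N := Num.bound (fine (mu setT) * n.+1%:R).
have muN : (mu setT < (N%:R * n.+1%:R^-1)%:E)%E.
  rewrite -(fineK ft) lte_fin ltr_pdivlMr// archi_boundP//.
  by rewrite mulr_ge0// fine_ge0.
have [B BA cB] := infinite_set_fset N inf.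
have mB : measurable
    (\big[setU/set0]_(z <- finmap.enum_fset B) [set z] : set (borelC R)).
  by apply: bigsetU_measurable => z _; exact: measurable_set1C.
have : (mu (\big[setU/set0]_(z <- finmap.enum_fset B) [set z]) <
    (N%:R * n.+1%:R^-1)%:E)%E.
  by apply: le_lt_trans muN; rewrite le_measure ?inE.
apply/negP; rewrite -leNgt measure_fbigsetU; last 2 first.
- by move=> z _; exact: measurable_set1C.
- by move=> z w _ _ [v [/= <- <-]].
have -> : ((N%:R * n.+1%:R^-1)%:E =
    \sum_(0 <= k < N) (n.+1%:R^-1)%:E :> \bar R)%E.
  by rewrite sumEFin big_const_nat subn0 iter_addr_0 mulr_natl.
apply: (@le_trans _ _ (\sum_(z <- finmap.enum_fset B) (n.+1%:R^-1)%:E)%E).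
  rewrite !sumEFin lee_fin big_const_nat subn0 big_const_seq count_predT.
  by rewrite !iter_addr_0 ler_wpMn2l.
by rewrite big_seq [leRHS]big_seq; apply: lee_sum => z zB; exact: BA.
Qed.

Lemma measurable_point_masses mu : measurable (point_masses mu).
Proof.
apply: countable_measurable; first exact: measurable_set1C.
exact: countable_point_masses.
Qed.

(* The lemmas [nonatomic_partD], [nonatomic_partP] and [atomic_partP] below show
   that this splits mu into a nonatomic and a purely atomic measure, atoms being
   understood in the general measure-theoretic sense. *)
Definition nonatomic_part mu : {finite_measure set borelC R -> \bar R} :=
  mrestr mu (measurableC (measurable_point_masses mu)).

Definition atomic_part mu : {finite_measure set borelC R -> \bar R} :=
  mrestr mu (measurable_point_masses mu).

Definition atom mu (A : set (borelC R)) := [/\ measurable A, (0 < mu A)%E &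
  forall B, measurable B -> B `<=` A -> mu B = 0%E \/ mu (A `\` B) = 0%E].

Definition nonatomic mu := forall A, ~ atom mu A.

Definition purely_atomic mu := forall A : set (borelC R),
  measurable A -> (0 < mu A)%E -> exists2 B, B `<=` A & atom mu B.

Lemma nonatomic_partD mu A : measurable A ->
  mu A = (nonatomic_part mu A + atomic_part mu A)%E.
Proof.
move=> mA; rewrite (measureDI mu mA (measurable_point_masses mu)).
by rewrite setDE.
Qed.

Lemma nonatomic_partP mu : nonatomic (nonatomic_part mu).
Proof.
set nu := nonatomic_part mu; move=> A [mA A0 atomA].
pose D := [set q | nu (A `&` square q) = 0%E].
have mAq q : measurable (A `&` square q).
  by apply: measurableI => //; exact: measurable_square.
have negN : nu.-negligible (A `&` \bigcup_(q in D) square q).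
  apply: negligible_squares => q q0; exists (A `&` square q).
  by split; [exact: mAq|exact: q0|].
have nu1 x : nu.-negligible [set x].
  exists [set x]; split => //; first exact: measurable_set1C.
  have [Px|nPx] := pselect (point_masses mu x).
    rewrite /nu/= /mrestr (_ : _ `&` _ = set0) ?measure0//.
    by apply/seteqP; split => z // [/= ->].
  apply/eqP; rewrite eq_le measure_ge0 andbT leNgt; apply/negP => nu0.
  apply: nPx; apply: (lt_le_trans nu0).
  apply: (@le_measure _ _ _ mu); rewrite ?inE//.
  - apply: measurableI; first exact: measurable_set1C.
    by apply: measurableC; exact: measurable_point_masses.
  - exact: measurable_set1C.
have negA : ~ nu.-negligible A.
  move=> /(measure_negligible mA) nuA.
  by have := A0; rewrite nuA ltxx.
have [x [Ax Nx]] : exists x, A x /\ ~ (\bigcup_(q in D) square q) x.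
  apply: contrapT => h; apply: negA; apply: negligibleS negN => x Ax.
  by split=> //; apply: contrapT => Nx; apply: h; exists x.
apply: negA; apply: (@negligibleS _ _ _ _
    ((A `&` \bigcup_(q in D) square q) `|` [set x])); last exact: negligibleU.
move=> y Ay; have [->|yx] := eqVneq y x; [by right|left; split=> //].
have xy : (x : R[i]) != y by rewrite eq_sym.
have := @norm_hausdorff R[i] R[i]; rewrite open_hausdorff => /(_ x y xy).
move=> [[U V] /= [/set_mem Ux /set_mem Vy] [oU oV UV]].
have [q qx qU] := square_basis oU Ux; have [r ry rV] := square_basis oV Vy.
exists r => //=.
have [qA|qA] := atomA _ (mAq q) (@subIsetl _ _ _).
  by exfalso; apply: Nx; exists q.
apply/eqP; rewrite eq_le measure_ge0 andbT -qA le_measure ?inE//.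
  by apply: measurableD.
move=> z [Az rz]; split=> // -[_ qz].
suff : (U `&` V) z by rewrite (eqP UV).
by split; [exact: qU|exact: rV].
Qed.

Lemma atomic_partP mu : purely_atomic (atomic_part mu).
Proof.
move=> A mA A0.
have [x [Ax Px]] : A `&` point_masses mu !=set0.
  apply/set0P/eqP => AP; have := A0; rewrite /= /mrestr AP measure0.
  by rewrite ltxx.
exists [set x]; first by move=> z ->.
split; first exact: measurable_set1C.
  rewrite /= /mrestr (_ : _ `&` _ = [set x]); first exact: Px.
  by apply/seteqP; split => z [] // ->.
move=> B mB Bx; have [xB|xB] := pselect (B x); [right|left].
  rewrite (_ : _ `\` _ = set0) ?measure0//.
  by apply/seteqP; split => z // [/= ->].
rewrite (_ : B = set0) ?measure0//.
apply/seteqP; split => z // Bz; have := Bx z Bz => /= zx.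
by apply: xB; rewrite -zx.
Qed.

End Borel_measures.

Section operators.
Context {K : numFieldType}.

Definition compact_operator (X Y : normedModType K) (T : X -> Y) :=
  [/\ linear T, continuous T &
    compact (closure (T @` [set x | `|x| <= 1]))].

Definition similar_operators (X1 X2 : normedModType K)
    (T1 : X1 -> X1) (T2 : X2 -> X2) :=
  exists (W : {linear X1 -> X2}) (V : {linear X2 -> X1}),
    [/\ continuous W, continuous V, cancel W V, cancel V W &
        T2 = W \o T1 \o V].

End operators.

Definition equivalent_measures d (T : measurableType d) (R : realType)
  (mu nu : {measure set T -> \bar R}) := mu `<< nu /\ nu `<< mu.

Section multiplication_operator.
Context {R : realType}.
Variables (mu : {finite_measure set borelC R -> \bar R}) (p : R) (p1 : 1 <= p).
#[local] Instance ae_filter_mu : Filter (nbhs (almost_everywhere mu)) :=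
  ae_filter_ringOfSetsType mu.

Variable cmu : compact (supp mu).

Lemma compact_supp_bound :
  exists2 B : R, 0 < B & {ae mu, forall z, normc z <= B}.
Proof.
have /compact_bounded[M [_ MB]] : compact ((@normc R) @` supp mu).
  apply: continuous_compact => //; apply: continuous_subspaceT.
  exact: continuous_normc.
exists (`|M| + 1); first by rewrite ltr_wpDl.
apply: filterS (supp_ae mu) => z sz.
apply: le_trans (ler_norm _) _; apply: MB; last by exists z.
by rewrite (le_lt_trans (ler_norm _))// ltrDl.
Qed.

Lemma measurable_mulz (f : R[i] -> R[i]) :
  measurable_fun [set: borelC R] (f : borelC R -> borelC R) ->
  measurable_fun [set: borelC R] ((fun z => z * f z) : borelC R -> borelC R).
Proof.
move=> /measurable_funC[fR fI]; apply/measurable_funC; split.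
  rewrite (_ : _ \o _ = fun z => complex.Re z * complex.Re (f z) -
      complex.Im z * complex.Im (f z)).
    apply: measurable_funB; apply: measurable_funM => //.
      exact: measurable_Re.
    exact: measurable_Im.
  by apply/funext => z /=; case: (f z) => ? ?; case: z.
rewrite (_ : _ \o _ = fun z => complex.Re z * complex.Im (f z) +
    complex.Im z * complex.Re (f z)).
  apply: measurable_funD; apply: measurable_funM => //.
    exact: measurable_Re.
  exact: measurable_Im.
by apply/funext => z /=; case: (f z) => ? ?; case: z.
Qed.

Lemma LnormC_mulz (B : R) (f : R[i] -> R[i]) :
  0 < B -> {ae mu, forall z, normc z <= B} ->
  measurable_fun [set: borelC R] (f : borelC R -> borelC R) ->
  (LnormC mu p (fun z => z * f z)%R <= B%:E * LnormC mu p f)%E.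
Proof.
move=> B0 zB mf; have p0 : 0 < p by rewrite (lt_le_trans ltr01).
have nB : normc (B%:C)%C = B by rewrite /= expr0n/= addr0 sqrtr_sqr gtr0_norm.
rewrite -[in leRHS]nB -LnormCZ//; apply: LnormC_le => //.
- exact: measurable_mulz.
- have m0 : measurable_fun [set: borelC R]
      ((0 : R[i] -> R[i]) : borelC R -> borelC R).
    exact: measurable_cst.
  by have := measurable_linC (B%:C)%C mf m0; rewrite addr0.
by apply: filterS zB => z zB; rewrite !normcM nB ler_wpM2r// normc_ge0.
Qed.

Lemma mulz_subproof (f : LfunC mu p1) :
  (fun z : borelC R => (z : R[i]) * f z) \in LfunC_pred mu p1.
Proof.
rewrite inE; split; first exact: (measurable_mulz (LfunC_measurable f)).
have [B B0 zB] := compact_supp_bound.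
apply: le_lt_trans (LnormC_mulz B0 zB (LfunC_measurable f)) _.
by rewrite lte_mul_pinfty ?lee_fin ?(ltW B0)// LfunC_lty.
Qed.

(* Compactness of the support makes z |-> z * f z again p-integrable. *)
Definition mulz (f : LfunC mu p1) : LfunC mu p1 :=
  exist _ (fun z : borelC R => (z : R[i]) * f z) (mulz_subproof f).

Lemma mulzE f z : mulz f z = (z : R[i]) * f z. Proof. by []. Qed.

Definition mult_op (F : Lp mu p1) : Lp mu p1 := Lp_class (mulz F).

Lemma mult_op_class f : mult_op (Lp_class f) = Lp_class (mulz f).
Proof.
by apply/Lp_classP; apply: filterS (Lp_classK f) => z; rewrite !mulzE => ->.
Qed.

Lemma mult_op_is_linear : linear mult_op.
Proof.
move=> a F G; rewrite -[F]Lp_funK -[G]Lp_funK -linearP !mult_op_class -linearP.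
congr Lp_class; apply/val_inj/funext => z.
by rewrite /= !fctE mulrDr mulrCA.
Qed.

HB.instance Definition _ := GRing.isLinear.Build R[i] (Lp mu p1) (Lp mu p1) *:%R
  mult_op mult_op_is_linear.

Lemma mult_op_continuous : continuous mult_op.
Proof.
have [B B0 zB] := compact_supp_bound.
apply: bounded_linear_continuous; apply/linear_boundedP.
have Br : ((B%:C)%C : R[i]) \is Num.real by rewrite ger0_real// lecR ltW.
exists (B%:C)%C; split => // r Br' F.
apply: (@le_trans _ _ ((B%:C)%C * `|F|)); last first.
  by rewrite ler_wpM2r// ltW.
rewrite -[F]Lp_funK /= mult_op_class.
have nE G : `|G : Lp mu p1| = ((Lp_norm G)%:C)%C by [].
rewrite !nE -rmorphM lecR !Lp_norm_class -lee_fin EFinM !LnormC_fine.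
by apply: LnormC_mulz => //; exact: LfunC_measurable.
Qed.

End multiplication_operator.
Arguments mult_op {R mu p} p1 cmu F.

(* Main.v *)
(* Call T and S similar modulo compacts if W T W^-1 - S is compact for some
   isomorphism W.

   Necessity.  Let W and V be mutually inverse and W M_1 - M_2 W compact.  A
   compact operator sends to 0 in norm every bounded sequence whose averages over
   large finite sets of indices are uniformly small.
   - Normalized indicators of disjoint sets shrinking to a cluster point l of
     supp mu_1 form such a sequence, and they are almost eigenvectors of M_1; so
     their images are almost eigenvectors of M_2, which would force them to 0 if
     l were not a cluster point of supp mu_2.
   - If the nonatomic part of mu_1 charges a mu_2-null set, it charges a compact
     mu_2-null set A without atoms.  Rademacher functions r_n on A form such a
     sequence, and W r_n concentrates near A.  As mu_2 A = 0, a subsequence of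
     W r_n is almost disjoint, so that sums of N of its terms have L^p norm of
     order N^(1/p).  But sums of N Rademacher functions have L^p norm of order
     N^(1/2), whence p = 2.

   Sufficiency.  If w_n are cluster points of supp mu, then mu has disjoint sets
   E_n of positive measure shrinking to w_n, and normalized indicators of the E_n
   split off a copy of the diagonal operator diag(w) from M_mu modulo compacts;
   repeating each w_n infinitely often, M_mu absorbs diag(w).  The atoms of
   mu_2 approach cluster points, so the atomic part of M_{mu_2} is such a diagonal
   operator up to a compact one, and M_{mu_1} absorbs it.  Likewise M_{mu_2}
   absorbs the atomic part of M_{mu_1}.  The two sums are similar by a
   Radon-Nikodym density on the nonatomic parts. *)
Require Import Defs.
From HB Require Import structures.
From mathcomp Require Import all_boot all_order all_algebra complex.
From mathcomp Require Import all_classical all_reals all_analysis.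
From mathcomp Require Import measurable_realfun ring lra zify.
Import Order.TTheory GRing.Theory Num.Theory.
Import numFieldNormedType.Exports.
Import Normc.
Set Implicit Arguments.
Unset Strict Implicit.
Unset Printing Implicit Defensive.
Local Open Scope classical_set_scope.
Local Open Scope ring_scope.


(** * Bounded operators and similarity modulo compact operators *)

(** Why [W] keeps the Rademacher functions near [A]: about a point a, the operator M_1 - a has norm
    at most rho on functions carried by the disc of radius rho, while M_2 - a is bounded below by 2
    rho outside the disc of radius 2 rho. Moving k factors across [W] costs errors that tend to 0
    along the sequence, and leaves outside the larger disc at most 2^-k times a constant. Finitely
    many such discs cover a compact set.

    The condition on averages stands in for weak convergence to 0, so that no dual space is
    involved. Unit vectors of l^p satisfy it because N^(1/p) / N tends to 0, which is where p > 1
    enters.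

    In the other direction, splitting off diag(w) would by itself only embed one operator in the
    other as a direct summand. Once every entry is repeated infinitely often, the diagonal operator
    coincides, up to a relabelling of its entries, with its sum with one more copy of diag(w); this
    is what produces an isomorphism. Infinite supports ensure that there are cluster points for the
    atoms to approach. *)

Section opers.
Context {K : numFieldType}.
Implicit Types X Y Z : normedModType K.

(** A predicate on plain functions: operators are written as lambda terms and identified by
    [funext], which bundled maps would make awkward. *)
Definition oper X Y (T : X -> Y) := linear T /\ continuous T.

Section oper_theory.
Context {X Y : normedModType K} {T : X -> Y}.
Hypothesis oT : oper T.

Definition operL : {linear X -> Y} :=
  HB.pack T (GRing.isLinear.Build K X Y *:%R T oT.1).

Lemma operD : {morph T : x y / x + y}. Proof. exact: (linearD operL). Qed.
Lemma operB : {morph T : x y / x - y}. Proof. exact: (linearB operL). Qed.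
Lemma oper0 : T 0 = 0. Proof. exact: (linear0 operL). Qed.
Lemma operZ a : {morph T : x / a *: x}.
Proof. by move=> x; rewrite -[a *: x]addr0 oT.1 oper0 addr0. Qed.
Lemma oper_sum (I : Type) (r : seq I) (P : pred I) (F : I -> X) :
  T (\sum_(i <- r | P i) F i) = \sum_(i <- r | P i) T (F i).
Proof. exact: (linear_sum operL). Qed.

Lemma oper_bounded : exists2 M : K, 0 < M & forall x, `|T x| <= M * `|x|.
Proof.
have : bounded_near operL (nbhs (0 : X)).
  by apply/linear_bounded_continuous; exact: oT.2.
move=> /linear_boundedP[M [Mr MP]].
exists (`|M| + 1); first by rewrite ltr_wpDl.
move=> x; apply: MP; rewrite (le_lt_trans (real_ler_norm Mr))// ltrDl//.
Qed.

End oper_theory.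

Lemma linear_bound_oper X Y (T : X -> Y) (M : K) : linear T ->
  (forall x, `|T x| <= M * `|x|) -> oper T.
Proof.
move=> lT MT; split=> //.
pose L : {linear X -> Y} := HB.pack T (GRing.isLinear.Build K X Y *:%R T lT).
apply: (@bounded_linear_continuous _ _ _ L); apply/linear_boundedP.
(* On the zero space nothing forces [M] to be nonnegative, so this case is separate. *)
have [x0|x0] := pselect (forall x : X, x = 0).
  exists 0; split=> // r _ x; rewrite (x0 x) /= (_ : T 0 = 0) ?normr0 ?mulr0//.
  exact: (linear0 L).
have [x /eqP xn0] : exists x : X, x <> 0.
  by apply: contrapT => h; apply: x0 => x; apply: contrapT => hx; apply: h; exists x.
have M0 : 0 <= M.
  have := le_trans (normr_ge0 _) (MT x).
  by rewrite pmulr_lge0// normr_gt0.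
exists M; split; first by rewrite ger0_real.
move=> r Mr y; apply: le_trans (MT y) _; rewrite ler_wpM2r//; exact: ltW.
Qed.

Lemma oper_id X : oper (@id X).
Proof. by split=> // x; exact: cvg_id. Qed.

Lemma oper_comp X Y Z (S : Y -> Z) (T : X -> Y) :
  oper S -> oper T -> oper (fun x => S (T x)).
Proof.
move=> oS oT; split; first by move=> a x y; rewrite (oT.1 a) (oS.1 a).
by move=> x; apply: continuous_comp; [exact: oT.2|exact: oS.2].
Qed.

Lemma oper_add X Y (S T : X -> Y) :
  oper S -> oper T -> oper (fun x => S x + T x).
Proof.
move=> oS oT; split; first by move=> a x y; rewrite oT.1 oS.1 scalerDr addrACA.
by move=> x; apply: cvgD; [exact: oS.2|exact: oT.2].
Qed.

Lemma oper_scale X Y (a : K) (T : X -> Y) : oper T -> oper (fun x => a *: T x).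
Proof.
move=> oT; split; first by move=> b x y; rewrite oT.1 scalerDr !scalerA mulrC.
by move=> x; apply: cvgZr; exact: oT.2.
Qed.

Lemma oper_opp X Y (T : X -> Y) : oper T -> oper (fun x => - T x).
Proof.
move=> /(oper_scale (-1)); congr oper; apply/funext => x.
by rewrite scaleN1r.
Qed.

Lemma oper_sub X Y (S T : X -> Y) :
  oper S -> oper T -> oper (fun x => S x - T x).
Proof. by move=> oS /oper_opp; exact: oper_add. Qed.

Lemma oper_fst X Y : oper (@fst X Y).
Proof. by split=> // x; exact: cvg_fst. Qed.

Lemma oper_snd X Y : oper (@snd X Y).
Proof. by split=> // x; exact: cvg_snd. Qed.

Lemma oper_pair X Y Z (S : X -> Y) (T : X -> Z) :
  oper S -> oper T -> oper (fun x => (S x, T x) : Y * Z).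
Proof.
move=> oS oT; split; first by move=> a x y; rewrite oT.1 oS.1.
by move=> x; apply: cvg_pair; [exact: oS.2|exact: oT.2].
Qed.

Lemma compact_oper X Y (T : X -> Y) : compact_operator T -> oper T.
Proof. by case. Qed.

(** Compact sets are closed here, so any compact superset of the image of the unit ball also
    contains its closure. *)
Lemma compact_operatorS X Y (T : X -> Y) (C : set Y) : oper T -> compact C ->
  (forall x, `|x| <= 1 -> C (T x)) -> compact_operator T.
Proof.
move=> oT cC TC; split; [exact: oT.1|exact: oT.2|].
have clC : closed C by apply: compact_closed cC; exact: norm_hausdorff.
apply: (subclosed_compact _ cC); first exact: closed_closure.
rewrite ((closure_id _).1 clC); apply: closureS => _ [x /= x1 <-]; exact: TC.
Qed.

Lemma compact_operator_image X Y (T : X -> Y) : compact_operator T ->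
  exists2 C, compact C & forall x, `|x| <= 1 -> C (T x).
Proof.
case=> _ _ cT; exists (closure (T @` [set x | `|x| <= 1])) => // x x1.
by apply: subset_closure; exists x.
Qed.

Lemma compact_operator_compl X Y Z (S : Y -> Z) (T : X -> Y) :
  oper S -> compact_operator T -> compact_operator (fun x => S (T x)).
Proof.
move=> oS cT; have [C cC CT] := compact_operator_image cT.
apply: (@compact_operatorS _ _ _ (S @` C)).
- exact: oper_comp (compact_oper cT).
- apply: continuous_compact => //; apply: continuous_subspaceT; exact: oS.2.
- by move=> x x1; exists (T x) => //; exact: CT.
Qed.

Lemma compact_operator_compr X Y Z (S : Y -> Z) (T : X -> Y) :
  compact_operator S -> oper T -> compact_operator (fun x => S (T x)).
Proof.
move=> cS oT; have [C cC CS] := compact_operator_image cS.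
have [M M0 TM] := oper_bounded oT.
apply: (@compact_operatorS _ _ _ ((fun y => M *: y) @` C)).
- exact: oper_comp (compact_oper cS) _.
- apply: continuous_compact => //; apply: continuous_subspaceT.
  exact: (oper_scale M (oper_id Z)).2.
(* [T] maps the unit ball into the ball of radius [M]; dividing by [M] before [S] and multiplying
   afterwards brings it back to the unit ball. *)
move=> x x1; exists (S (M^-1 *: T x)); last first.
  by rewrite (operZ (compact_oper cS)) scalerA divff ?scale1r// gt_eqF.
apply: CS; rewrite normrZ gtr0_norm ?invr_gt0// ler_pdivrMl// mulr1.
by apply: le_trans (TM x) _; rewrite ler_piMr// ltW.
Qed.

Lemma compact_operator_add X Y (S T : X -> Y) :
  compact_operator S -> compact_operator T ->
  compact_operator (fun x => S x + T x).
Proof.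
move=> cS cT; have [C cC CS] := compact_operator_image cS.
have [D cD DT] := compact_operator_image cT.
apply: (@compact_operatorS _ _ _ ((fun y => y.1 + y.2) @` (C `*` D))).
- by apply: oper_add; exact: compact_oper.
- apply: continuous_compact; last exact: compact_setX.
  apply: continuous_subspaceT.
  exact: (oper_add (oper_fst Y Y) (oper_snd Y Y)).2.
by move=> x x1; exists (S x, T x) => //; split; [exact: CS|exact: DT].
Qed.

Lemma compact_operator_opp X Y (T : X -> Y) :
  compact_operator T -> compact_operator (fun x => - T x).
Proof. exact: (compact_operator_compl (oper_opp (oper_id Y))). Qed.

Lemma compact_operator_sub X Y (S T : X -> Y) :
  compact_operator S -> compact_operator T ->
  compact_operator (fun x => S x - T x).
Proof. by move=> cS /compact_operator_opp; exact: compact_operator_add. Qed.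

Lemma compact_operator_pair X Y Z (S : X -> Y) (T : X -> Z) :
  compact_operator S -> compact_operator T ->
  compact_operator (fun x => (S x, T x) : Y * Z).
Proof.
move=> cS cT; have [C cC CS] := compact_operator_image cS.
have [D cD DT] := compact_operator_image cT.
apply: (@compact_operatorS _ _ _ (C `*` D)).
- by apply: oper_pair; exact: compact_oper.
- exact: compact_setX.
by move=> x x1; split; [exact: CS|exact: DT].
Qed.

Lemma compact_operator0 X Y : compact_operator (fun _ : X => 0 : Y).
Proof.
apply: (@compact_operatorS _ _ _ [set 0]) => //; last exact: compact_set1.
apply: (@linear_bound_oper _ _ _ 0); last by move=> x; rewrite normr0 mul0r.
by move=> a x y; rewrite scaler0 addr0.
Qed.

(* Similarity modulo compact operators. *)
Definition csim X Y (T : X -> X) (S : Y -> Y) :=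
  exists W V, [/\ oper W, oper V, cancel W V, cancel V W &
    compact_operator (fun y => S y - W (T (V y)))].

Lemma csim_intertwine X Y (T : X -> X) (S : Y -> Y) W V :
  oper W -> oper V -> cancel W V -> cancel V W ->
  compact_operator (fun x => S (W x) - W (T x)) -> csim T S.
Proof.
move=> oW oV WV VW c; exists W, V; split => //.
have := compact_operator_compr c oV; congr compact_operator.
by apply/funext => y; rewrite VW.
Qed.

Lemma csim_exact X Y (T : X -> X) (S : Y -> Y) W V :
  oper W -> oper V -> cancel W V -> cancel V W ->
  (forall x, S (W x) = W (T x)) -> csim T S.
Proof.
move=> oW oV WV VW c; apply: (csim_intertwine oW oV) => //.
rewrite (_ : (fun x => _) = fun=> 0); first exact: compact_operator0.
by apply/funext => x; rewrite c subrr.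
Qed.

Lemma csim_sym X Y (T : X -> X) (S : Y -> Y) : csim T S -> csim S T.
Proof.
move=> [W [V [oW oV WV VW c]]]; apply: (csim_intertwine oV oW) => //.
have := compact_operator_opp (compact_operator_compl oV c).
congr compact_operator; apply/funext => y.
by rewrite (operB oV) WV opprB.
Qed.

(** The defects add up: U - W' W T V V' = (U - W' S V') + W' (S - W T V) V'. *)
Lemma csim_trans X Y Z (T : X -> X) (S : Y -> Y) (U : Z -> Z) :
  csim T S -> csim S U -> csim T U.
Proof.
move=> [W [V [oW oV WV VW c]]] [W' [V' [oW' oV' WV' VW' c']]].
exists (fun x => W' (W x)), (fun z => V (V' z)); split.
- exact: oper_comp.
- exact: oper_comp.
- by move=> x; rewrite WV' WV.
- by move=> x; rewrite VW VW'.
have := compact_operator_add c'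
  (compact_operator_compl oW' (compact_operator_compr c oV')).
congr compact_operator; apply/funext => z.
by rewrite (operB oW') addrA subrK.
Qed.

Lemma csim_compact X (T S : X -> X) :
  compact_operator (fun x => S x - T x) -> csim T S.
Proof. exact: (csim_intertwine (oper_id X) (oper_id X)). Qed.

Lemma csim_prod X Y Z (T : X -> X) (S : Y -> Y) (U : Z -> Z) : csim S U ->
  csim (fun x : X * Y => (T x.1, S x.2)) (fun x : X * Z => (T x.1, U x.2)).
Proof.
move=> [W [V [oW oV WV VW c]]].
pose f (x : X * Y) := (x.1, W x.2); pose g (x : X * Z) := (x.1, V x.2).
exists f, g; split.
- exact: oper_pair (oper_fst X Y) (oper_comp oW (oper_snd X Y)).
- exact: oper_pair (oper_fst X Z) (oper_comp oV (oper_snd X Z)).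
- by case=> x y; rewrite /f /g/= WV.
- by case=> x y; rewrite /f /g/= VW.
have := compact_operator_pair (compact_operator0 (X * Z)%type X)
  (compact_operator_compr c (oper_snd X Z)).
congr compact_operator; apply/funext => -[x z] /=.
by apply: injective_projections; rewrite /= ?subrr.
Qed.

(* [S] and [Q] exhibit [D] as a direct summand of [T] modulo compact operators,
   and [sigma], [iota], [sigma'], [pi] identify [D] with [D (+) E]; the shift
   makes room for one more copy of [E]. *)
Lemma csim_absorb X Y Z (T : X -> X) (D : Z -> Z) (E : Y -> Y)
    (S : Z -> X) (Q : X -> Z) (sigma sigma' : Z -> Z) (iota : Y -> Z)
    (pi : Z -> Y) :
  oper S -> oper Q -> oper sigma -> oper sigma' -> oper iota -> oper pi ->
  cancel S Q -> cancel sigma sigma' -> cancel iota pi ->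
  (forall z, sigma (sigma' z) + iota (pi z) = z) ->
  (forall z, pi (sigma z) = 0) -> (forall y, sigma' (iota y) = 0) ->
  (forall z, D (sigma' z) = sigma' (D z)) ->
  (forall z, E (pi z) = pi (D z)) ->
  compact_operator (fun z => T (S z) - S (D z)) ->
  compact_operator (fun x => Q (T x) - D (Q x)) ->
  oper T ->
  csim T (fun x : X * Y => (T x.1, E x.2)).
Proof.
move=> oS oQ os os' oi op SQ ss ip si ps is' Ds Ep k1 k2 oT.
(* [X] is the kernel of [Q] plus a copy [S Z] of [Z]. [W] fixes the kernel and splits that copy
   along the identification of [Z] with [Z (+) Y]; [V] glues the two pieces back together. *)
pose W x : X * Y := (x - S (Q x) + S (sigma' (Q x)), pi (Q x)).
pose V (x : X * Y) := x.1 - S (Q x.1) + S (sigma (Q x.1)) + S (iota x.2).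
have QV x : Q (V x) = sigma (Q x.1) + iota x.2.
  by rewrite /V !(operB oQ, operD oQ) !SQ subrr add0r.
apply: (@csim_intertwine _ _ _ _ W V).
- apply: oper_pair; last exact: oper_comp op oQ.
  apply: oper_add; first exact: oper_sub (oper_id X) (oper_comp oS oQ).
  exact: oper_comp oS (oper_comp os' oQ).
- apply: oper_add; last exact: oper_comp oS (oper_comp oi (oper_snd X Y)).
  have oQ1 := oper_comp oQ (oper_fst X Y).
  apply: oper_add; last exact: oper_comp oS (oper_comp os oQ1).
  exact: oper_sub (oper_fst X Y) (oper_comp oS oQ1).
- move=> x; rewrite /V /W/= !(operB oQ, operD oQ) !SQ subrr add0r.
  by rewrite -addrA -(operD oS) si addrK subrK//.
- case=> x y; rewrite /W QV/= (operD op) ps ip add0r; congr pair.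
  by rewrite (operD os') ss is' addr0 (operD oS) /V/= -[_ + _ + S (iota y)]addrA addrK subrK.
(* The commutator of [W] with the two operators, componentwise, in terms of the compact defects T S
   - S D and Q T - D Q; the exact relations of [sigma'] and [pi] with [D] cancel the rest. *)
have c1 := compact_operator_add
  (compact_operator_sub (compact_operator_compl oS k2) (compact_operator_compr k1 oQ))
  (compact_operator_sub (compact_operator_compr k1 (oper_comp os' oQ))
     (compact_operator_compl oS (compact_operator_compl os' k2))).
have c2 := compact_operator_opp (compact_operator_compl op k2).
have := compact_operator_pair c1 c2; congr compact_operator.
apply/funext => x; rewrite /W/=.
rewrite !(operB oT, operD oT, operB oS, operB os', operB op) Ds Ep.
apply: injective_projections; rewrite /=; last by rewrite opprB.
set a := S (Q (T x)); set b := S (D (Q x)); set c := T (S (Q x)).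
set d := T (S _); set e := S (sigma' (D _)); set f := S (sigma' (Q (T x))).
have subKB (x1 x2 x3 : X) : x1 - x2 - (x3 - x2) = x1 - x3.
  by rewrite opprB addrA subrK.
rewrite !subKB.
rewrite [LHS]addrA opprD opprB [RHS]addrA; congr (_ - f).
by rewrite [RHS]addrC !addrA subrK.
Qed.

End opers.

(** * Weighted composition operators *)

Section complex_measurability.
Context {R : realType} d {T : measurableType d}.
Implicit Types f g : T -> R[i].

Lemma measurable_mulC f g : measurable_fun setT (f : T -> borelC R) ->
  measurable_fun setT (g : T -> borelC R) ->
  measurable_fun setT ((fun x => f x * g x) : T -> borelC R).
Proof.
move=> /measurable_funC[fR fI] /measurable_funC[gR gI]; apply/measurable_funC.
split.
  rewrite (_ : _ \o _ = fun x => complex.Re (f x) * complex.Re (g x) -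
      complex.Im (f x) * complex.Im (g x)).
    by apply: measurable_funB; apply: measurable_funM.
  by apply/funext => x /=; case: (f x) => ? ?; case: (g x).
rewrite (_ : _ \o _ = fun x => complex.Re (f x) * complex.Im (g x) +
    complex.Im (f x) * complex.Re (g x)).
  by apply: measurable_funD; apply: measurable_funM.
by apply/funext => x /=; case: (f x) => ? ?; case: (g x).
Qed.

Lemma measurable_real_complex (f : T -> R) : measurable_fun setT f ->
  measurable_fun setT ((fun x => (f x)%:C%C) : T -> borelC R).
Proof. by move=> mf; apply/measurable_funC; split => //=; exact: measurable_cst. Qed.

Lemma normc_real (a : R) : normc (a%:C)%C = `|a|.
Proof. by rewrite /= expr0n/= addr0 sqrtr_sqr. Qed.

End complex_measurability.

Section Lp_toolkit.
Context {R : realType} {p : R} (p1 : 1 <= p).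
Let p_gt0 : 0 < p. Proof. exact: lt_le_trans p1. Qed.
Local Open Scope ereal_scope.

Section pint.
Context d {T : measurableType d} (m : {measure set T -> \bar R}).
Implicit Types f g : T -> R[i].

Definition pint f := \int[m]_x ((normc (f x)) `^ p)%:E.

Lemma pint_ge0 f : 0 <= pint f.
Proof. by apply: integral_ge0 => x _; rewrite lee_fin powR_ge0. Qed.

Lemma LnormC_pint f : LnormC m p f `^ p = pint f.
Proof.
by rewrite LnormCE -poweRrM mulVf ?gt_eqF// poweRe1// pint_ge0.
Qed.

Lemma LfunCP f : f \in LfunC_pred m p1 <->
  measurable_fun setT (f : T -> borelC R) /\ pint f < +oo.
Proof.
rewrite inE; split => -[mf h]; split => //.
  by rewrite -LnormC_pint poweR_lty.
by rewrite LnormCE poweR_lty.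
Qed.

Lemma LfunC_pint (f : LfunC m p1) : pint f < +oo.
Proof. by have /LfunCP[] := valP f. Qed.

Lemma pint_ae_eq f g : measurable_fun setT (f : T -> borelC R) ->
  measurable_fun setT (g : T -> borelC R) ->
  {ae m, forall x, f x = g x} -> pint f = pint g.
Proof. by move=> mf mg fg; rewrite -!LnormC_pint (LnormC_ae_eq p_gt0 mf mg fg). Qed.

Lemma le_pint f g : measurable_fun setT (f : T -> borelC R) ->
  measurable_fun setT (g : T -> borelC R) ->
  {ae m, forall x, (normc (f x) <= normc (g x))%R} -> pint f <= pint g.
Proof.
move=> mf mg fg; rewrite -!LnormC_pint gt0_ler_poweR ?(ltW p_gt0)//.
- by rewrite in_itv/= LnormC_ge0 leey.
- by rewrite in_itv/= LnormC_ge0 leey.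
exact: LnormC_le.
Qed.

Lemma pint_eq0 f : measurable_fun setT (f : T -> borelC R) ->
  pint f = 0 -> {ae m, forall x, f x = 0%R}.
Proof.
move=> mf f0; apply: (LnormC_eq0 p_gt0 mf).
by rewrite LnormCE -/(pint f) f0 poweR0r// invr_eq0 gt_eqF.
Qed.

Lemma Lp_norm_ge0 (F : Lp m p1) : (0 <= Lp_norm F)%R.
Proof. by rewrite fine_ge0// LnormC_ge0. Qed.

Lemma Lp_norm_pint (F : Lp m p1) : (Lp_norm F `^ p)%:E = pint F.
Proof. by rewrite -poweR_EFin /Lp_norm LnormC_fine LnormC_pint. Qed.

Lemma Lp_normE (F : Lp m p1) : `|F|%R = ((Lp_norm F)%:C)%C.
Proof. by []. Qed.

Lemma Lp_norm_le (c : R) (F : Lp m p1) : (0 <= c)%R ->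
  pint F <= (c `^ p)%:E -> (Lp_norm F <= c)%R.
Proof.
move=> c0; rewrite -Lp_norm_pint lee_fin leNgt => h; rewrite leNgt.
by apply: contra h; apply: gt0_ltr_powR; rewrite ?nnegrE// Lp_norm_ge0.
Qed.

(** The value 0 for functions outside L^p lets an operator be written down before its integrability
    is proved; [mkLE] then recovers [f]. *)
Definition mkL f : LfunC m p1 := insubd 0%R f.

Lemma mkLE f : f \in LfunC_pred m p1 -> mkL f = f :> (T -> R[i]).
Proof. exact: insubdK. Qed.

Lemma Lp_eqP (F G : Lp m p1) : F = G <-> {ae m, forall x, F x = G x}.
Proof. by rewrite -{1}(Lp_funK F) -{1}(Lp_funK G); exact: Lp_classP. Qed.

Lemma Lp_addE (F G : Lp m p1) :
  {ae m, forall x, Lp_fun (F + G)%R x = (F x + G x)%R}.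
Proof.
have e : (F + G)%R = Lp_class ((F : LfunC m p1) + (G : LfunC m p1))%R.
  by rewrite Lp_classD !Lp_funK.
apply: filterS (Lp_classK ((F : LfunC m p1) + (G : LfunC m p1))%R) => x.
by rewrite -e.
Qed.

Lemma Lp_scaleE a (F : Lp m p1) :
  {ae m, forall x, Lp_fun (a *: F)%R x = (a * F x)%R}.
Proof. by apply: filterS (Lp_classK (a *: (F : LfunC m p1))%R) => x ->. Qed.

Lemma Lp_zeroE : {ae m, forall x, Lp_fun (0%R : Lp m p1) x = 0%R}.
Proof.
have e : 0%R = Lp_class (0%R : LfunC m p1) by rewrite raddf0.
by apply: filterS (Lp_classK (0%R : LfunC m p1)) => x; rewrite -e.
Qed.

End pint.

(** The integral estimate makes [F] send null functions to null functions. With linearity up to a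
    null set, [F] then respects a.e. equality and descends to classes. *)
Lemma lift_oper d {T : measurableType d} d' {T' : measurableType d'}
    (m : {measure set T -> \bar R}) (m' : {measure set T' -> \bar R})
    (F : LfunC m p1 -> LfunC m' p1) (c : R) :
  (0 <= c)%R ->
  (forall a f g, {ae m', forall x, F (a *: f + g)%R x = (a * F f x + F g x)%R}) ->
  (forall f, pint m' (F f) <= c%:E * pint m f) ->
  oper (fun X : Lp m p1 => Lp_class (F X)) /\
  (forall f, Lp_class (F (Lp_class f)) = Lp_class (F f)).
Proof.
move=> c0 lF bF.
have F0 (f : LfunC m p1) : {ae m, forall x, f x = 0%R} -> {ae m', forall x, F f x = 0%R}.
  move=> f0; apply: pint_eq0; first exact: LfunC_measurable.
  apply/eqP; rewrite eq_le pint_ge0 andbT (le_trans (bF f))//.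
  rewrite (_ : pint m f = 0) ?mule0//.
  rewrite (@pint_ae_eq _ _ _ f (fun=> 0%R)) //.
  - by rewrite /pint; under eq_integral do rewrite normc0 powR0 ?gt_eqF//; rewrite integral0.
  - exact: LfunC_measurable.
have FK (f : LfunC m p1) : Lp_class (F (Lp_class f)) = Lp_class (F f).
  apply/Lp_classP.
  have /F0 h0 : {ae m, forall x, LfunC_fun ((-1) *: f + Lp_fun (Lp_class f))%R x = 0%R}.
    apply: filterS (Lp_classK f) => x fx.
    have -> : (LfunC_fun ((-1) *: f + Lp_fun (Lp_class f)) x = -1 * f x + Lp_fun (Lp_class f) x)%R.
      by [].
    by rewrite fx mulN1r addNr.
  apply: filterS2 h0 (lF (-1)%R f (Lp_fun (Lp_class f))) => x h1 h2.
  by move: h2; rewrite h1 mulN1r => /eqP; rewrite eq_sym addrC subr_eq0 => /eqP.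
split=> //; apply: (@linear_bound_oper _ _ _ _ ((c `^ p^-1)%:C)%C).
  move=> a X Y; rewrite -linearP; apply/Lp_classP.
  pose h := (a *: Lp_fun X + Lp_fun Y)%R.
  have -> : (a *: X + Y)%R = Lp_class h.
    by rewrite /h Lp_classD -Lp_scale_class !Lp_funK.
  by apply: filterS2 ((Lp_classP _ _).1 (FK h)) (lF a (Lp_fun X) (Lp_fun Y)) => x -> ->.
move=> X; rewrite !Lp_normE -rmorphM lecR.
rewrite Lp_norm_class /Lp_norm -lee_fin EFinM !LnormC_fine !LnormCE.
rewrite -poweR_EFin -poweRM ?lee_fin//; last exact: (pint_ge0 m).
by rewrite gt0_ler_poweR ?invr_ge0 ?(ltW p_gt0)// ?in_itv/= ?leey ?andbT;
  [exact: pint_ge0|rewrite mule_ge0 ?lee_fin// pint_ge0|exact: bF].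
Qed.

End Lp_toolkit.

Section weighted_composition.
Context {R : realType} {p : R} (p1 : 1 <= p).
Let p_gt0 : 0 < p. Proof. exact: lt_le_trans p1. Qed.
Local Open Scope ereal_scope.

Section wc.
Context d {T : measurableType d} d' {T' : measurableType d'}.
Context {m : {measure set T -> \bar R}} {m' : {measure set T' -> \bar R}}.
Implicit Types (v : T -> R[i]) (phi : T -> T').

(* Exactly what makes f |-> v * (f \o phi) bounded from L^p(m') to L^p(m), and well
   defined on classes. *)
Definition wdom v phi := [/\ measurable_fun setT (v : T -> borelC R),
  measurable_fun setT phi & exists2 C : R, (0 <= C)%R &
    forall g : T' -> \bar R, measurable_fun setT g -> (forall x, 0 <= g x) ->
    \int[m]_x ((normc (v x) `^ p)%:E * g (phi x)) <= C%:E * \int[m']_x g x].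

Definition wc v phi (X : Lp m' p1) : Lp m p1 :=
  Lp_class (mkL p1 m (fun x => (v x * X (phi x))%R)).

Variables (v : T -> R[i]) (phi : T -> T').
Hypothesis vphi : wdom v phi.

Let mv : measurable_fun setT (v : T -> borelC R). Proof. by case: vphi. Qed.
Let mphi : measurable_fun setT phi. Proof. by case: vphi. Qed.

Lemma measurable_wc (f : T' -> R[i]) :
  measurable_fun setT (f : T' -> borelC R) ->
  measurable_fun setT ((fun x => (v x * f (phi x))%R) : T -> borelC R).
Proof. by move=> mf; apply: measurable_mulC => //; exact: measurableT_comp mf _. Qed.

Lemma pint_wc : exists2 C : R, (0 <= C)%R & forall f : T' -> R[i],
  measurable_fun setT (f : T' -> borelC R) ->
  @pint R p _ _ m (fun x => (v x * f (phi x))%R) <= C%:E * @pint R p _ _ m' f.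
Proof.
case: vphi => _ _ [C C0 h]; exists C => // f mf.
rewrite /pint; under eq_integral do rewrite normcM powRM ?normc_ge0// EFinM.
apply: (h (fun x => ((normc (f x)) `^ p)%:E)) => [|x].
  exact: measurable_normc_powR.
by rewrite lee_fin powR_ge0.
Qed.

Lemma wc_LfunC (f : LfunC m' p1) :
  (fun x => (v x * f (phi x))%R) \in LfunC_pred m p1.
Proof.
apply/LfunCP; split; first exact: measurable_wc (LfunC_measurable f).
have [C C0 h] := pint_wc; apply: le_lt_trans (h _ (LfunC_measurable f)) _.
by rewrite lte_mul_pinfty ?lee_fin// LfunC_pint.
Qed.

Lemma wc_oper_class : oper (wc v phi) /\
  forall f : LfunC m' p1, {ae m, forall x, wc v phi (Lp_class f) x = (v x * f (phi x))%R}.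
Proof.
have [C C0 h] := pint_wc.
have [|f|oF FE] := @lift_oper R p p1 _ _ _ _ m' m
  (fun f : LfunC m' p1 => mkL p1 m (fun x => (v x * f (phi x))%R)) C C0.
- move=> a f g; apply: aeW => x.
  by rewrite !mkLE ?wc_LfunC//= mulrDr mulrCA.
- rewrite mkLE; last exact: wc_LfunC. by apply: h; exact: LfunC_measurable.
split=> // f.
apply: filterS (Lp_classK (mkL p1 m (fun x => (v x * f (phi x))%R))) => x.
by rewrite /wc FE => ->; rewrite mkLE// wc_LfunC.
Qed.

Lemma wc_oper : oper (wc v phi). Proof. by case: wc_oper_class. Qed.

Lemma wc_class (f : LfunC m' p1) :
  {ae m, forall x, wc v phi (Lp_class f) x = (v x * f (phi x))%R}.
Proof. by case: wc_oper_class. Qed.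

Lemma wc_ae (X : Lp m' p1) :
  {ae m, forall x, wc v phi X x = (v x * X (phi x))%R}.
Proof. by have := wc_class X; rewrite Lp_funK. Qed.

(** [phi] alone may pull a null set back to a set of positive measure. The bound in [wdom], applied
    to the indicator of the exceptional set, forces the weight to vanish a.e. on that preimage. *)
Lemma wdom_ae (P : T' -> Prop) : {ae m', forall x, P x} ->
  {ae m, forall x, v x = 0%R \/ P (phi x)}.
Proof.
case=> N [mN N0 PN]; case: vphi => _ _ [C C0 h].
have mi : measurable_fun setT (fun x => (\1_N x)%:E : \bar R).
  by apply/measurable_EFinP; exact: measurable_indic.
have := h (fun x => (\1_N x)%:E) mi.
rewrite integral_indic// setIT [X in _ * X]N0 mule0 => {}h.
pose g x := ((normc (v x) `^ p)%:E * (\1_N (phi x))%:E) : \bar R.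
have g0 x : 0 <= g x by rewrite mule_ge0// lee_fin ?powR_ge0.
have mg : measurable_fun setT g.
  apply: emeasurable_funM; first exact: measurable_normc_powR.
  exact: (measurableT_comp mi).
have : \int[m]_x `|g x| = 0.
  apply/eqP; rewrite eq_le integral_ge0 ?andbT; last by move=> x _; exact: abse_ge0.
  under eq_integral do rewrite gee0_abs//.
  by apply: h => x; rewrite lee_fin.
move=> /(ae_eq_integral_abs _ measurableT mg); apply: filterS => x /(_ I).
rewrite /g/= => /eqP; rewrite mule_eq0 !eqe powR_eq0 => /orP[/andP[/eqP/eq0_normc]|].
  by left.
rewrite indicE pnatr_eq0 eqb0 => /negP xN; right; apply: contrapT => Px.
by apply: xN; rewrite inE; exact: PN.
Qed.

End wc.
Arguments wdom {d T d' T'} m m' v phi.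
Arguments wc {d T d' T'} m m' v phi X.

Lemma wc_wc d {T : measurableType d} d' {T' : measurableType d'}
    d'' {T'' : measurableType d''} (m : {measure set T -> \bar R})
    (m' : {measure set T' -> \bar R}) (m'' : {measure set T'' -> \bar R})
    (v : T -> R[i]) (phi : T -> T') (v' : T' -> R[i]) (phi' : T' -> T'')
    (X : Lp m'' p1) :
  wdom m m' v phi -> wdom m' m'' v' phi' ->
  {ae m, forall x, wc m m' v phi (wc m' m'' v' phi' X) x =
    (v x * (v' (phi x) * X (phi' (phi x))))%R}.
Proof.
move=> h h'; apply: filterS2 (wc_ae h (wc m' m'' v' phi' X))
  (wdom_ae h (wc_ae h' X)) => x ->.
by case=> [->|-> //]; rewrite !mul0r.
Qed.

Lemma wdom_mul d {T : measurableType d} (m : {measure set T -> \bar R})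
    (v : T -> R[i]) (B : R) : measurable_fun setT (v : T -> borelC R) ->
  {ae m, forall x, (normc (v x) <= B)%R} -> wdom m m v id.
Proof.
move=> mv vB; split=> //; exists (`|B| `^ p)%R; first exact: powR_ge0.
move=> g mg g0; rewrite -[leRHS](ge0_integralZl m measurableT mg); last 2 first.
- by move=> x _; exact: g0.
- by rewrite lee_fin powR_ge0.
apply: ae_ge0_le_integral => //.
- by move=> x _; rewrite mule_ge0// lee_fin powR_ge0.
- by apply: emeasurable_funM => //; exact: measurable_normc_powR.
- by move=> x _; rewrite mule_ge0// lee_fin powR_ge0.
- exact: emeasurable_funM.
apply: filterS vB => x vB _; rewrite lee_wpmul2r// lee_fin.
apply: ge0_ler_powR; rewrite ?nnegrE ?normc_ge0 ?(ltW p_gt0)//.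
exact: le_trans vB (ler_norm _).
Qed.

Lemma mult_op_ae (m : {finite_measure set borelC R -> \bar R})
    (cm : compact (supp m)) (X : Lp m p1) :
  {ae m, forall z : borelC R, mult_op p1 cm X z = ((z : R[i]) * X z)%R}.
Proof. by apply: filterS (Lp_classK (mulz cm X)) => z ->; rewrite mulzE. Qed.

Lemma mult_op_oper (m : {finite_measure set borelC R -> \bar R})
    (cm : compact (supp m)) : oper (mult_op p1 cm : Lp m p1 -> Lp m p1).
Proof. by split; [exact: mult_op_is_linear|exact: mult_op_continuous]. Qed.

Lemma pint_wc_mul d {T : measurableType d} (m : {measure set T -> \bar R})
    (v : T -> R[i]) (B : R) (X : Lp m p1) : wdom m m v id ->
  (0 <= B)%R -> {ae m, forall x, (normc (v x) <= B)%R} ->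
  (Lp_norm (wc m m v id X) <= B * Lp_norm X)%R.
Proof.
move=> h B0 vB; apply: Lp_norm_le; first by rewrite mulr_ge0// Lp_norm_ge0.
rewrite powRM ?Lp_norm_ge0// EFinM Lp_norm_pint.
rewrite -ge0_integralZl//; last 3 first.
- by apply: measurable_normc_powR; exact: LfunC_measurable.
- by move=> x _; rewrite lee_fin powR_ge0.
- by rewrite lee_fin powR_ge0.
apply: ae_ge0_le_integral => //.
- by move=> x _; rewrite lee_fin powR_ge0.
- by apply: measurable_normc_powR; exact: LfunC_measurable.
- by move=> x _; rewrite mule_ge0// lee_fin powR_ge0.
- by apply: emeasurable_funM => //; apply: measurable_normc_powR; exact: LfunC_measurable.
apply: filterS2 vB (wc_ae h X) => x vB -> _; rewrite normcM -EFinM lee_fin.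
rewrite powRM ?normc_ge0// ler_wpM2r ?powR_ge0//.
by apply: ge0_ler_powR; rewrite ?nnegrE ?normc_ge0 ?(ltW p_gt0).
Qed.

End weighted_composition.
Arguments wdom {R p d T d' T'} m m' v phi.
Arguments wc {R p} p1 {d T d' T'} m m' v phi X.

Section integral_restriction.
Context {R : realType} d {T : measurableType d}.
Variable m : {measure set T -> \bar R}.
Local Open Scope ereal_scope.

Lemma ge0_integral_mrestr (D : set T) (mD : measurable D) (f : T -> \bar R) :
  measurable_fun setT f -> (forall x, 0 <= f x) ->
  \int[mrestr m mD]_x f x = \int[m]_(x in D) f x.
Proof.
move=> mf f0; have mDc := measurableC mD.
rewrite [RHS]integral_mkcond.
have mfD : measurable_fun setT (f \_ D).
  by apply/(measurable_restrictT _ mD); exact: measurable_funTS.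
have fD0 x : 0 <= (f \_ D) x by rewrite patchE; case: ifP.
(* [m] is the sum of its restrictions to [D] and to the complement, and the integrand vanishes on
   the complement. *)
have -> : \int[m]_x (f \_ D) x =
    \int[measure_add (mrestr m mD) (mrestr m mDc)]_x (f \_ D) x.
  apply: eq_measure_integral => A mA _; rewrite /= /msum/= !big_ord_recl big_ord0/=.
  by rewrite /mrestr adde0 (measureDI m mA mD) setDE addeC.
rewrite ge0_integral_measure_add//.
rewrite (@ae_eq_integral _ _ _ (mrestr m mDc) _ (cst 0)) //; last first.
  exists D; split => //; first by rewrite /= /mrestr setICr measure0.
  move=> x /= h; apply: contrapT => Dx; apply: h => _.
  by rewrite patchE memNset.
rewrite integral_cst// mul0e adde0.
apply: ae_eq_integral => //.
exists (~` D); split => //; first by rewrite /= /mrestr setICl measure0.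
move=> x /= h Dx; apply: h => _.
by rewrite patchE mem_set.
Qed.

Lemma integral_setE1 (x : T) (g : T -> \bar R) : measurable [set x] ->
  \int[m]_(y in [set x]) g y = g x * m [set x].
Proof.
move=> mx; rewrite -integral_cst//; apply: eq_integral => y.
by rewrite inE => ->.
Qed.

Lemma ge0_integral_fibers (idx : T -> nat) (f : T -> \bar R) :
  measurable_fun setT idx -> measurable_fun setT f -> (forall x, 0 <= f x) ->
  \int[m]_x f x = \esum_(n in [set: nat]) \int[m]_(x in idx @^-1` [set n]) f x.
Proof.
move=> mi mf f0.
have mF n : measurable (idx @^-1` [set n]) by rewrite -[X in measurable X]setTI; exact: mi.
have -> : [set: T] = \bigcup_n (idx @^-1` [set n]).
  by apply/seteqP; split => x // _; exists (idx x).
rewrite ge0_integral_bigcup//.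
- by rewrite nneseries_esumT// => n; exact: integral_ge0.
- exact: measurable_funTS.
- by move=> i j _ _ [x [/= <- <-]].
Qed.

End integral_restriction.

(** * Sequence spaces as L^p spaces of counting measures *)

Section counting_spaces.
Context {R : realType} {p : R} (p1 : 1 <= p).
Let p_gt0 : 0 < p. Proof. exact: lt_le_trans p1. Qed.
Local Open Scope ereal_scope.

(** [Lp (cnt D)] is l^p over the index set [D], realized on all of [nat]; a finite or empty [D]
    covers measures with few or no atoms. *)
Definition cnt (D : set nat) : {measure set nat -> \bar R} :=
  mrestr counting (I : measurable D).

Lemma integral_cnt (D : set nat) (g : nat -> \bar R) : (forall n, 0 <= g n) ->
  \int[cnt D]_n g n = \esum_(n in D) g n.
Proof.
move=> g0; rewrite ge0_integral_mrestr// integral_mkcond ge0_integral_count.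
  rewrite nneseries_esumT; last by move=> n; rewrite patchE; case: ifP.
  by rewrite [RHS]esum_mkcond; apply: eq_esum => n _; rewrite patchE.
by move=> n; rewrite patchE; case: ifP.
Qed.

Lemma cntE (D A : set nat) : cnt D A = \esum_(n in D) (\1_A n)%:E.
Proof. by rewrite -integral_cnt// integral_indic// setIT. Qed.

Lemma cnt_ae (D : set nat) (P : nat -> Prop) :
  {ae cnt D, forall n, P n} <-> forall n, D n -> P n.
Proof.
split=> [[N [mN N0 PN]] n Dn|DP].
  apply: contrapT => nP; have Nn := PN n nP.
  have : 1 <= cnt D N.
    rewrite cntE; apply: esum_ge; exists [set n].
      by split; [exact: finite_set1|move=> _ ->].
    by rewrite fsbig_set1 indicE mem_set.
  by rewrite [cnt D N]N0 leNgt lte01.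
exists (~` D); split => //; first by rewrite /cnt/= /mrestr setICl measure0.
by move=> n /= nP Dn; apply: nP; exact: DP.
Qed.

Lemma le_esum_inj (D1 D2 : set nat) (phi : nat -> nat) (g : nat -> \bar R) :
  (forall n, 0 <= g n) -> {in D1 &, injective phi} ->
  (forall n, D1 n -> D2 (phi n)) ->
  \esum_(n in D1) g (phi n) <= \esum_(n in D2) g n.
Proof.
move=> g0 iphi phiD; rewrite -esum_image//.
rewrite esum_mkcond [leRHS]esum_mkcond; apply: le_esum => n _.
case: ifPn => [/set_mem[k Dk <-]|_]; last by case: ifP.
by rewrite mem_set//; exact: phiD.
Qed.

Lemma wdom_cnt (D1 D2 : set nat) (v : nat -> R[i]) (phi : nat -> nat) (B : R) :
  {in D1 &, forall m n, v m != 0%R -> v n != 0%R -> phi m = phi n -> m = n} ->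
  (forall n, D1 n -> v n != 0%R -> D2 (phi n)) ->
  (forall n, D1 n -> (normc (v n) <= B)%R) ->
  wdom (p := p) (cnt D1) (cnt D2) v phi.
Proof.
move=> iphi phiD vB; split => //.
exists (`|B| `^ p)%R; first exact: powR_ge0.
move=> g mg g0; rewrite integral_cnt; last first.
  by move=> n; rewrite mule_ge0// lee_fin powR_ge0.
rewrite integral_cnt//.
pose D' := D1 `&` [set n | v n != 0%R].
apply: (@le_trans _ _ (\esum_(n in D') ((`|B| `^ p)%:E * g (phi n)))).
  rewrite esum_mkcond [leRHS]esum_mkcond; apply: le_esum => n _.
  case: ifPn => [/set_mem D1n|_]; last first.
    by case: ifPn => // _; rewrite mule_ge0// lee_fin powR_ge0.
  case: (eqVneq (v n) 0%R) => [->|vn].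
    rewrite normc0 powR0 ?gt_eqF// mul0e; case: ifPn => // _.
    by rewrite mule_ge0// lee_fin powR_ge0.
  have D'n : D' n by split.
  rewrite (mem_set D'n); apply: lee_wpmul2r; first exact: g0.
  rewrite lee_fin; apply: ge0_ler_powR; rewrite ?nnegrE ?normc_ge0 ?(ltW p_gt0)//.
  by rewrite (le_trans (vB n D1n))// ler_norm.
rewrite -!integral_cnt//; last 1 first.
  by move=> n; rewrite mule_ge0// lee_fin powR_ge0.
rewrite ge0_integralZl// ?lee_fin ?powR_ge0//.
rewrite lee_wpmul2l ?lee_fin ?powR_ge0// !integral_cnt//.
apply: le_esum_inj => //; last by move=> n [D1n vn]; exact: phiD.
by move=> i j /set_mem[Di vi] /set_mem[Dj vj]; apply: iphi => //; rewrite inE.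
Qed.

(** A sequence is spread over the fibres of [idx]. When the weight has p-mass at most 1 on each
    fibre, this does not increase norms. *)
Lemma wdom_fibers d {T : measurableType d} (m : {measure set T -> \bar R})
    (D : set nat) (v : T -> R[i]) (idx : T -> nat) :
  measurable_fun setT (v : T -> borelC R) -> measurable_fun setT idx ->
  (forall n, \int[m]_(x in idx @^-1` [set n]) (normc (v x) `^ p)%:E <=
     (\1_D n)%:E) ->
  wdom (p := p) m (cnt D) v idx.
Proof.
move=> mv mi vD; split=> //; exists 1%R => // g mg g0.
rewrite mul1e integral_cnt//.
have mF n : measurable (idx @^-1` [set n]) by rewrite -[X in measurable X]setTI; exact: mi.
rewrite (ge0_integral_fibers m mi); last 2 first.
- apply: emeasurable_funM; first exact: measurable_normc_powR.
  exact: measurableT_comp mg mi.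
- by move=> x; rewrite mule_ge0// lee_fin powR_ge0.
rewrite [leRHS]esum_mkcond; apply: le_esum => n _.
under eq_integral => x /set_mem /= -> do rewrite muleC.
rewrite ge0_integralZl//; last 2 first.
- by apply: measurable_funTS; exact: measurable_normc_powR.
- by move=> x _; rewrite lee_fin powR_ge0.
apply: (le_trans (lee_wpmul2l (g0 n) (vD n))).
by rewrite indicE; case: ifPn => _; rewrite ?mule1 ?mule0.
Qed.

Lemma wdom_points d {T : measurableType d} (m : {measure set T -> \bar R})
    (D : set nat) (v : nat -> R[i]) (a : nat -> T) (B : R) :
  (forall n, measurable [set a n]) -> {in D &, injective a} -> (0 <= B)%R ->
  (forall n, D n -> (normc (v n) `^ p)%:E <= B%:E * m [set a n]) ->
  wdom (p := p) (cnt D) m v a.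
Proof.
move=> ma ia B0 vB; split => //; exists B => // g mg g0.
rewrite integral_cnt; last by move=> n; rewrite mule_ge0// lee_fin powR_ge0.
(* Outside [D] the points [a n] may coincide; emptying [F n] there keeps the family disjoint. *)
pose F n := if n \in D then [set a n] else set0.
have mF n : measurable (F n) by rewrite /F; case: ifP.
have tF : trivIset setT F.
  move=> i j _ _ [x [Fi Fj]]; move: Fi Fj; rewrite /F.
  case: ifPn => // iD -> ; case: ifPn => // jD; exact: ia.
have mBg : measurable_fun setT (fun x => B%:E * g x) by exact: emeasurable_funM.
have Bg0 x : 0 <= B%:E * g x by rewrite mule_ge0.
rewrite -ge0_integralZl//.
apply: (@le_trans _ _ (\int[m]_(x in \bigcup_n F n) (B%:E * g x))); last first.
  by apply: ge0_subset_integral => //; exact: bigcup_measurable.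
rewrite ge0_integral_bigcup//; last exact: measurable_funTS.
rewrite nneseries_esumT; last by move=> n; exact: integral_ge0.
rewrite esum_mkcond; apply: le_esum => n _; rewrite /F.
case: ifPn => [/set_mem Dn|_]; last exact: integral_ge0.
rewrite integral_setE1// muleAC.
by apply: lee_wpmul2r; [exact: g0|exact: vB].
Qed.

End counting_spaces.

(** * Diagonal operators *)

Section compact_diagonal.
Context {R : realType}.

Lemma compact_disc (B : R) : compact [set z : R[i] | normc z <= B].
Proof.
pose f (x : R * R) : R[i] := (x.1 +i* x.2)%C.
have cf : continuous f.
  move=> [x y]; apply/cvgrPdist_lt => e; rewrite ltcE/= => /andP[/eqP eI eR].
  have e2 : 0 < complex.Re e / 2 by rewrite divr_gt0.
  near=> z.
  rewrite normr_normc ltcE; apply/andP; split; first by rewrite /= -eI.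
  apply: (le_lt_trans (normc_le_ReIm (f (x, y) - f z))).
  rewrite [ltRHS]splitr ltrD//.
    near: z; apply: (@cvgr_dist_lt _ _ _ _ _ (@fst R R) x) => //; exact: cvg_fst.
  near: z; apply: (@cvgr_dist_lt _ _ _ _ _ (@snd R R) y) => //; exact: cvg_snd.
have c2 : compact (f @` (`[- B, B]%classic `*` `[- B, B]%classic)).
  apply: continuous_compact; first exact: continuous_subspaceT.
  by apply: compact_setX; exact: segment_compact.
apply: (subclosed_compact _ c2).
  have -> : [set z : R[i] | normc z <= B] = (@normc R) @^-1` [set x | x <= B] by [].
  apply: closed_comp => [z _|]; first exact: continuous_normc.
  exact: closed_le.
move=> z /= zB; exists (complex.Re z, complex.Im z); last by rewrite /f; case: (z).
split; rewrite /= in_itv/= -ler_norml.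
- exact: le_trans (ler_norm_Re _) zB.
- exact: le_trans (ler_norm_Im _) zB.
Unshelve. all: by end_near.
Qed.

Lemma continuous_finite_combination (T : topologicalType)
    (V : normedModType R[i]) (e : nat -> V) (c : nat -> T -> R[i]) N :
  (forall n, continuous (c n)) ->
  continuous (fun t => \sum_(n < N) c n t *: e n).
Proof.
move=> cc; elim: N => [|N IH].
  have -> : (fun t => \sum_(n < 0) c n t *: e n) = fun=> 0.
    by apply/funext => t; rewrite big_ord0.
  exact: cst_continuous.
have -> : (fun t => \sum_(n < N.+1) c n t *: e n) =
    (fun t => \sum_(n < N) c n t *: e n + c N t *: e N).
  by apply/funext => t; rewrite big_ord_recr.
by move=> t; apply: cvgD; [exact: IH|apply: cvgZr_tmp; exact: cc].
Qed.

Lemma continuous_scaled_proj (a : R[i]) n :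
  continuous (fun b : prod_topology (fun _ : nat => R[i]) => a * b n).
Proof.
pose PT := prod_topology (fun _ : nat => R[i]).
have cm : continuous (fun z : R[i] => a * z).
  exact: mulrl_continuous.
move=> b; apply: (@continuous_comp PT _ _ (fun b : PT => b n) (fun z : R[i] => a * z)).
  exact: (@proj_continuous nat (fun _ : nat => R[i]) n).
exact: cm.
Qed.

Context {p : R} (p1 : 1 <= p).
Let p_gt0 : 0 < p. Proof. exact: lt_le_trans p1. Qed.
Let pow1p : 1 `^ p = 1. Proof. by rewrite powR1. Qed.
Variable D : set nat.
Notation lD := (Lp (cnt (R := R) D) p1).

Lemma lDP (f : nat -> R[i]) : f \in LfunC_pred (cnt D) p1 <->
  (pint (p := p) (cnt D) f < +oo)%E.
Proof. by split=> [/LfunCP[]//|h]; apply/LfunCP. Qed.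

Lemma lD_eqP (F G : lD) : F = G <-> forall n, D n -> F n = G n.
Proof. by rewrite Lp_eqP cnt_ae. Qed.

Definition unit_vec (n : nat) : lD :=
  Lp_class (mkL p1 (cnt D) (fun k => if k == n then 1 else 0)).

Lemma unit_vecE n k : D k -> unit_vec n k = if k == n then 1 else 0.
Proof.
move: k; apply/cnt_ae.
apply: filterS (Lp_classK (mkL p1 (cnt D) (fun k => if k == n then 1 else 0))) => k ->.
rewrite mkLE//; apply/lDP; rewrite /pint.
rewrite integral_cnt; last by move=> j; rewrite lee_fin powR_ge0.
rewrite (_ : (\esum_(j in D) _)%E = (\esum_(j in D `&` [set n]) 1)%E); last first.
  rewrite esum_mkcondr; apply: eq_esum => j _.
  case: eqVneq => [->|jn]; first by rewrite mem_set// normc1 powR1.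
  by rewrite memNset ?normc0 ?powR0 ?gt_eqF//; apply/eqP.
rewrite esum_fset//; last exact: finite_setIr.
by rewrite fsbig_finite//= ?sumEFin ?ltry//; exact: finite_setIr.
Qed.

Definition trunc (b : nat -> R[i]) (N : nat) : lD := \sum_(n < N) b n *: unit_vec n.

Lemma lD_addE (F G : lD) k : D k -> Lp_fun (F + G) k = F k + G k.
Proof. by move: k; apply/cnt_ae; exact: Lp_addE. Qed.

Lemma lD_scaleE a (F : lD) k : D k -> Lp_fun (a *: F) k = a * F k.
Proof. by move: k; apply/cnt_ae; exact: Lp_scaleE. Qed.

Lemma lD_zeroE k : D k -> Lp_fun (0 : lD) k = 0.
Proof. by move: k; apply/cnt_ae; exact: Lp_zeroE. Qed.

Lemma lD_subE (F G : lD) k : D k -> Lp_fun (F - G) k = F k - G k.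
Proof. by move=> Dk; rewrite lD_addE// -scaleN1r lD_scaleE// mulN1r. Qed.

Lemma truncE b N k : D k -> trunc b N k = if (k < N)%N then b k else 0.
Proof.
rewrite /trunc => Dk; elim: N => [|N IH]; first by rewrite big_ord0 lD_zeroE.
rewrite big_ord_recr/= lD_addE// IH lD_scaleE// unit_vecE// ltnS.
by case: (ltngtP k N) => [_|_|->]; rewrite ?mulr1 ?mulr0 ?addr0 ?add0r.
Qed.

(** The unit ball of l^p in the topology of coordinates. Bounding truncations instead of the whole
    sequence makes every condition closed; the discs, imposed also outside [D], give compactness by
    Tychonoff. *)
Definition sball : set (prod_topology (fun _ : nat => R[i])) :=
  [set b | forall n, normc (b n) <= 1] `&`
  \bigcap_N [set b | Lp_norm (trunc b N) <= 1].

Lemma continuous_trunc (a : nat -> R[i]) N :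
  continuous (fun b : prod_topology (fun _ : nat => R[i]) =>
    trunc (fun n => a n * b n) N : lD).
Proof. 
exact: (@continuous_finite_combination
  (prod_topology (fun _ : nat => R[i])) lD unit_vec (fun n b => a n * b n) N
  (fun n => @continuous_scaled_proj (a n) n)).
Qed.

Lemma continuous_Lp_norm : continuous (fun F : lD => Lp_norm F).
Proof.
move=> F.
have := continuous_comp (@norm_continuous _ lD F) (@continuous_Re R _).
by apply.
Qed.

Lemma compact_sball : compact sball.
Proof.
apply: compact_closedI.
  exact: (@tychonoff nat (fun _ => R[i]) (fun _ => [set z | normc z <= 1])
    (fun _ => @compact_disc 1)).
apply: closed_bigI => N _.
pose g (b : prod_topology (fun _ : nat => R[i])) := Lp_norm (trunc (fun n => 1 * b n) N).
have cg : continuous g.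
  move=> b; apply: (@continuous_comp _ _ _ (fun b : prod_topology (fun _ : nat => R[i]) =>
    trunc (fun n => 1 * b n) N : lD) (fun F : lD => Lp_norm F)).
    exact: continuous_trunc.
  exact: continuous_Lp_norm.
have -> : [set b : prod_topology (fun _ : nat => R[i]) | Lp_norm (trunc b N) <= 1] =
    g @^-1` [set x | x <= 1].
  apply/seteqP; split => b /=; rewrite /g.
    by under [X in _ -> Lp_norm (trunc X N) <= 1]funext do rewrite mul1r.
  by under [X in Lp_norm (trunc X N) <= 1 -> _]funext do rewrite mul1r.
by apply: closed_comp => [b _|]; [exact: cg|exact: closed_le].
Qed.

Lemma sball_pint (b : nat -> R[i]) : sball b -> (pint (p := p) (cnt D) b <= 1)%E.
Proof.
case=> _ bN; rewrite /pint ge0_integral_mrestr//; last by move=> ?; rewrite lee_fin powR_ge0.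
have fD0 k : (0 <= ((fun x => (normc (b x) `^ p)%:E) \_ D) k)%E.
  by rewrite patchE; case: ifP => // _; rewrite lee_fin powR_ge0.
rewrite integral_mkcond ge0_integral_count//.
apply: lime_le; first exact: is_cvg_nneseries.
apply: nearW => N; have := bN N Logic.I => /= tN.
apply: (@le_trans _ _ (pint (p := p) (cnt D) (trunc b N))); last first.
  rewrite -Lp_norm_pint lee_fin -pow1p; apply: ge0_ler_powR => //.
  - exact: ltW.
  - by rewrite nnegrE Lp_norm_ge0.
  - by rewrite nnegrE.
rewrite /pint ge0_integral_mrestr//; last by move=> ?; rewrite lee_fin powR_ge0.
have gD0 k : (0 <= ((fun x => (normc (trunc b N x) `^ p)%:E) \_ D) k)%E.
  by rewrite patchE; case: ifP => // _; rewrite lee_fin powR_ge0.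
rewrite integral_mkcond ge0_integral_count//.
apply: le_trans (nneseries_lim_ge N _); last by move=> ? _ _; exact: gD0.
rewrite big_nat [leRHS]big_nat; apply: lee_sum => k /andP[_ kN]; rewrite !patchE.
by case: ifPn => // /set_mem Dk; rewrite truncE// kN.
Qed.

Variables (eta : nat -> R[i]).
Hypothesis eta0 : forall e, 0 < e ->
  exists N, forall n, (N <= n)%N -> D n -> normc (eta n) <= e.

Lemma eta_bounded : exists2 B : R, 0 <= B & forall n, D n -> normc (eta n) <= B.
Proof.
have [N hN] := eta0 ltr01.
exists (1 + \sum_(i < N) normc (eta i)).
  by rewrite addr_ge0// sumr_ge0// => i _; exact: normc_ge0.
move=> n Dn; case: (leqP N n) => [Nn|nN].
  rewrite (le_trans (hN _ Nn Dn))// lerDl sumr_ge0// => i _; exact: normc_ge0.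
rewrite (bigD1 (Ordinal nN))//= addrCA lerDl addr_ge0// sumr_ge0// => i _.
exact: normc_ge0.
Qed.

Lemma wdom_diag : wdom (p := p) (cnt D) (cnt D) eta id.
Proof.
have [B B0 hB] := eta_bounded.
by apply: (wdom_mul p1 (B := B)) => //; apply/cnt_ae.
Qed.

Definition sball_class (b : nat -> R[i]) : lD := Lp_class (mkL p1 (cnt D) b).

Lemma sball_classE b : sball b -> forall k, D k -> sball_class b k = b k.
Proof.
move=> sb; have bL : b \in LfunC_pred (cnt D) p1.
  by apply/lDP; apply: le_lt_trans (sball_pint sb) _; rewrite ltry.
by apply/cnt_ae; apply: filterS (Lp_classK (mkL p1 (cnt D) b)) => k ->; rewrite mkLE.
Qed.

Lemma sball_class_norm b : sball b -> Lp_norm (sball_class b) <= 1.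
Proof.
move=> sb; apply: Lp_norm_le => //; rewrite powR1.
rewrite (@pint_ae_eq _ _ p1 _ _ _ _ b)//; first exact: sball_pint.
by apply/cnt_ae; exact: sball_classE.
Qed.

Definition sball_map (b : nat -> R[i]) : lD :=
  wc p1 (cnt D) (cnt D) eta id (sball_class b).

(** Coordinatewise convergence becomes norm convergence because [eta] makes tails uniformly small on
    the ball. Beyond [N] two images differ by at most (r / 4) * 2, and the first [N] coordinates
    vary continuously. *)
Lemma sball_map_continuous : {within sball, continuous
  (sball_map : prod_topology (fun _ : nat => R[i]) -> lD)}.
Proof.
apply/subspace_continuousP => b0 sb0; apply/cvgrPdist_lt => e e0.
have [r r0 ->] : exists2 r : R, 0 < r & e = (r%:C)%C.
  move: e0; rewrite ltcE/= => /andP[/eqP eI eR].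
  by exists (complex.Re e) => //; case: (e) eI => ? ? /= ->.
have r4 : 0 < r / 4 by rewrite divr_gt0.
have [N hN] := eta0 r4.
pose eta' n := if (n < N)%N then 0 else eta n.
have eta'le n : D n -> normc (eta' n) <= r / 4.
  move=> Dn; rewrite /eta'; case: ltnP => [_|Nn]; first by rewrite normc0 ltW.
  exact: hN.
have de' : wdom (p := p) (cnt D) (cnt D) eta' id.
  by apply: (wdom_mul p1 (B := r / 4)) => //; apply/cnt_ae.
have split b : sball b -> sball_map b =
    trunc (fun n => eta n * b n) N + wc p1 (cnt D) (cnt D) eta' id (sball_class b).
  move=> sb; apply/lD_eqP => k Dk; rewrite lD_addE// truncE//.
  have /cnt_ae -> // := wc_ae wdom_diag (sball_class b).
  have /cnt_ae -> // := wc_ae de' (sball_class b).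
  rewrite sball_classE// /eta'.
  by case: ltnP => _; rewrite ?mul0r ?addr0 ?add0r.
have /cvgrPdist_lt/(_ (((r / 4)%:C)%C)) := @continuous_trunc eta N b0.
rewrite ltcR => /(_ r4) h.
rewrite near_withinE; near=> b => sb.
rewrite /from_subspace !split// opprD addrACA.
apply: le_lt_trans (ler_normD _ _) _.
have -> : ((r%:C)%C = ((r / 4)%:C + (3 / 4 * r)%:C)%C :> R[i])%C.
  by rewrite -rmorphD/=; congr (_%:C)%C; field.
apply: ltr_leD; first by near: b; exact: h.
rewrite -(operB (wc_oper p1 de')) Lp_normE lecR.
apply: (le_trans (pint_wc_mul (B := r / 4) _ de' _ _)).
- exact: ltW.
- by apply/cnt_ae => n; exact: eta'le.
apply: (@le_trans _ _ (r / 4 * 2)); last first.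
  by lra.
rewrite ler_wpM2l ?(ltW r4)// -lecR -Lp_normE.
apply: le_trans (ler_normB _ _) _.
rewrite !Lp_normE -rmorphD lecR.
by apply: lerD; exact: sball_class_norm.
Unshelve. all: by end_near.
Qed.

Lemma compact_diag : compact_operator (wc p1 (cnt D) (cnt D) eta id).
Proof.
apply: (@compact_operatorS _ _ _ _ (sball_map @` sball)).
- exact: wc_oper wdom_diag.
- apply: continuous_compact compact_sball; exact: sball_map_continuous.
(* A representative is arbitrary outside [D], whereas [sball] constrains all coordinates; hence the
   value 0 there. *)
move=> F F1; pose b n : R[i] := if n \in D then Lp_fun F n else 0.
have bF k : D k -> b k = Lp_fun F k by move=> Dk; rewrite /b mem_set.
have nF : Lp_norm (F : lD) <= 1 by move: F1; rewrite Lp_normE lecR.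
have pF : (pint (p := p) (cnt D) (Lp_fun F) <= 1)%E.
  rewrite -Lp_norm_pint lee_fin -pow1p; apply: ge0_ler_powR => //.
  - exact: ltW.
  - by rewrite nnegrE Lp_norm_ge0.
  - by rewrite nnegrE.
have sb : sball b.
  split=> [n|N _ /=].
    rewrite /b; case: ifPn => [/set_mem Dn|_]; last by rewrite normc0.
    rewrite leNgt; apply/negP => n1.
    have : (1 < (normc (Lp_fun F n) `^ p)%:E)%E.
      rewrite lte_fin -pow1p; apply: gt0_ltr_powR => //; rewrite nnegrE//.
      exact: normc_ge0.
    apply/negP; rewrite -leNgt; apply: le_trans pF.
    rewrite /pint integral_cnt; last by move=> ?; rewrite lee_fin powR_ge0.
    apply: esum_ge; exists [set n]; last by rewrite fsbig_set1.
    by split; [exact: finite_set1|move=> _ ->].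
  apply: Lp_norm_le => //; rewrite powR1; apply: le_trans pF.
  apply: (le_pint p1) => //.
  apply/cnt_ae => k Dk; rewrite truncE//.
  by case: ifP => _; rewrite ?bF// normc0 normc_ge0.
exists b => //; rewrite /sball_map; congr (wc _ _ _ _ _ _).
by apply/lD_eqP => k Dk; rewrite sball_classE// bF.
Qed.

End compact_diagonal.

(** * Absorption of diagonal operators *)

Section punctured_discs.
Context {R : realType}.
Implicit Types mu : {finite_measure set borelC R -> \bar R}.

Lemma normc_gt0 (z : R[i]) : (0 < normc z) = (z != 0).
Proof.
rewrite lt_neqAle normc_ge0 andbT eq_sym; apply/idP/idP => /eqP h; apply/eqP.
  by move=> z0; apply: h; rewrite z0 normc0.
by move=> /eq0_normc.
Qed.

Definition pdisc (w : R[i]) (r : R) : set (borelC R) :=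
  [set z : R[i] | 0 < normc (z - w) < r].

Lemma open_pdisc w r : open (pdisc w r : set R[i]).
Proof.
apply/open_normcP => z /= /andP[z0 zr].
exists (Num.min (normc (z - w)) (r - normc (z - w))).
  by rewrite lt_min z0 subr_gt0.
move=> y; rewrite lt_min => /andP[h1 h2]; rewrite /pdisc/=.
have e1 : normc (z - w) <= normc (z - y) + normc (y - w).
  by rewrite -[z - w](subrKA y) ler_normcD.
have e2 : normc (y - w) <= normc (z - y) + normc (z - w).
  by rewrite -[y - w](subrKA z) -(normc_opp (z - y)) opprB ler_normcD.
by apply/andP; split; lra.
Qed.

Lemma measurable_pdisc w r : measurable (pdisc w r).
Proof. by apply: open_measurableC; exact: open_pdisc. Qed.

Lemma open_disc (w : R[i]) (r : R) : open [set z : R[i] | normc (z - w) < r].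
Proof.
apply/open_normcP => z /= zr; exists (r - normc (z - w)); first by rewrite subr_gt0.
move=> y zy; have := ler_normcD (y - z) (z - w); rewrite subrKA => h.
by rewrite (le_lt_trans h)// -ltrBrDr -normc_opp opprB.
Qed.

Lemma compact_normc_bounded (A : set R[i]) : compact A ->
  exists2 B, 0 <= B & forall z, A z -> normc z <= B.
Proof.
move=> cA; have /compact_bounded[M [_ MB]] : compact ((@normc R) @` A).
  by apply: continuous_compact => //; apply: continuous_subspaceT; exact: continuous_normc.
exists (`|M| + 1) => [|z Az]; first by rewrite addr_ge0.
apply: le_trans (ler_norm _) _; apply: MB; last by exists z.
by rewrite (le_lt_trans (ler_norm _))// ltrDl.
Qed.

Lemma inv_exp2_small (e : R) : 0 < e ->
  exists N, forall n, (N <= n)%N -> (2 ^+ n)^-1 <= e.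
Proof.
move=> e0; have [N hN] := ltr_add_invr (y := 0) e0.
exists N => n Nn; apply: le_trans (ltW hN); rewrite add0r lef_pV2 ?posrE ?exprn_gt0//.
apply: (@le_trans _ _ (2 ^ n)%:R); last by rewrite natrX.
by rewrite ler_nat (leq_trans _ (ltn_expl n (ltnSn 1)))// ltnS.
Qed.

Lemma nbhs_normcP (w : R[i]) (U : set R[i]) : nbhs w U <->
  exists2 r : R, 0 < r & forall z, normc (z - w) < r -> U z.
Proof.
split=> [/nbhs_ballP[e /= e0 eU]|[r r0 rU]].
  move: (e0); rewrite ltcE/= => /andP[/eqP eI eR].
  exists (complex.Re e) => // z zw; apply: eU; rewrite -ball_normE /ball_/=.
  by rewrite -normrN opprB ltcE normr_normc/= -eI eqxx.
apply/nbhs_ballP; exists (r%:C)%C => /=; first by rewrite ltcR.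
move=> z; rewrite -ball_normE /ball_/= -normrN opprB normr_normc ltcR; exact: rU.
Qed.

Lemma pdisc_gt0 mu w r : limit_point (supp mu) w -> 0 < r ->
  (0 < mu (pdisc w r))%E.
Proof.
move=> wL r0; have [|y [yw sy yr]] := wL [set z | normc (z - w) < r].
  by apply/nbhs_normcP; exists r.
apply: (sy (pdisc w r : set R[i])); first exact: open_pdisc.
by rewrite /pdisc/= normc_gt0 subr_eq0 yw.
Qed.

(** Puncturing is essential: punctured discs decrease to the empty set even when the centre is an
    atom. *)
Lemma pdisc_small mu w r c : limit_point (supp mu) w -> 0 < r -> 0 < c ->
  exists s, [/\ 0 < s, s <= r & fine (mu (pdisc w s)) < c].
Proof.
move=> wL r0 c0; pose F n := pdisc w (r / n.+1%:R).
have mF n : measurable (F n) by exact: measurable_pdisc.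
have F0 : \bigcap_n F n = set0.
  apply/seteqP; split => // z h; have := h 0%N Logic.I; rewrite /F /pdisc/= => /andP[z0 _].
  have [n] := ltr_add_invr (y := 0) (x := r^-1 * normc (z - w))
    (mulr_gt0 (etrans (invr_gt0 r) r0) z0).
  rewrite add0r => nz; have := h n Logic.I; rewrite /F /pdisc/= => /andP[_].
  by rewrite ltNge => /negP; apply; rewrite ltW// -ltr_pdivlMl.
have cF : (mu \o F) x @[x --> \oo] --> 0%E.
  rewrite -(measure0 mu) -F0; apply: nonincreasing_cvg_mu => //.
  - by rewrite ltey_eq fin_num_measure.
  - by rewrite F0.
  - move=> m n mn; apply/subsetPset => z; rewrite /F /pdisc/= => /andP[-> zn] /=.
    apply: (lt_le_trans zn); rewrite ler_wpM2l ?(ltW r0)// lef_pV2 ?posrE//.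
    by rewrite ler_nat.
have /fine_cvg/cvgr0_norm_lt/(_ _ c0)[N _ /(_ N (leqnn N)) /= hN] := cF.
exists (r / N.+1%:R); split; first by rewrite divr_gt0.
  by rewrite ler_pdivrMr// ler_peMr ?(ltW r0)// ler1n.
by rewrite (le_lt_trans (ler_norm _)).
Qed.

(** Each disc is chosen with measure below a quarter of that of its predecessor. All later discs
    together then take at most half of the measure of the n-th one, and removing them leaves
    disjoint sets of positive measure. *)
Lemma disjoint_pdiscs mu (w : nat -> R[i]) (e : nat -> R) :
  (forall n, limit_point (supp mu) (w n)) -> (forall n, 0 < e n) ->
  exists E : nat -> set (borelC R), [/\ forall n, measurable (E n),
    forall n, (0 < mu (E n))%E, trivIset setT E &
    forall n, E n `<=` pdisc (w n) (e n)].
Proof.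
move=> wL e0.
have mfin A : measurable A -> mu A \is a fin_num by exact: fin_num_measure.
have muE (A : set (borelC R)) : measurable A -> mu A = (fine (mu A))%:E.
  by move=> mA; rewrite fineK// mfin.
have ex (nc : nat * R) : exists s, 0 < nc.2 ->
    [/\ 0 < s, s <= e nc.1 & fine (mu (pdisc (w nc.1) s)) < nc.2].
  have [c0|] := pselect (0 < nc.2); last by exists 0.
  by have [s hs] := pdisc_small (wL nc.1) (e0 nc.1) c0; exists s.
have [f fP] := choice ex.
pose fix r n := if n is n'.+1
  then f (n, fine (mu (pdisc (w n') (r n'))) / 4) else f (0%N, 1).
pose G n := pdisc (w n) (r n).
have mG n : measurable (G n) by exact: measurable_pdisc.
have rP n : 0 < r n /\ r n <= e n.
  elim: n => [|n [r0 _]]; first by have [] := fP (0%N, 1) ltr01.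
  have [] // := fP (n.+1, fine (mu (G n)) / 4).
  rewrite /= divr_gt0// fine_gt0// pdisc_gt0//=.
  by rewrite ltey_eq mfin//; exact: measurable_pdisc.
have G0 n : 0 < fine (mu (G n)).
  by rewrite fine_gt0// pdisc_gt0 ?(rP n).1//= ltey_eq mfin.
have G4 n : fine (mu (G n.+1)) < fine (mu (G n)) / 4.
  have [] // := fP (n.+1, fine (mu (G n)) / 4).
  by rewrite /= divr_gt0// G0.
have G4k n k : fine (mu (G (n + k.+1)%N)) <= fine (mu (G n)) / 2 / (2 ^ k.+1)%:R.
  elim: k => [|k IH]; first by rewrite addn1 expn1 (le_trans (ltW (G4 n)))//; lra.
  rewrite addnS (le_trans (ltW (G4 _)))//.
  apply: (@le_trans _ _ (fine (mu (G n)) / 2 / (2 ^ k.+1)%:R / 4)).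
    by rewrite ler_wpM2r.
  rewrite [(2 ^ k.+2)%N]expnS natrM invfM.
  have : 0 <= (fine (mu (G n)) / 2 / (2 ^ k.+1)%:R).
    by rewrite !divr_ge0// ltW.
  lra.
pose U n := \bigcup_k G (n + k.+1)%N.
have mU n : measurable (U n) by exact: bigcup_measurable.
have Usmall n : (mu (U n) <= (fine (mu (G n)) / 2)%:E)%E.
  apply: le_trans (measure_sigma_subadditive _ _ _ _) _.
  - by move=> k; exact: mG (n + k.+1)%N.
  - exact: mU.
  - by [].
  have e2 : 0 <= fine (mu (G n)) / 2 by rewrite divr_ge0// ltW.
  apply: le_trans (epsilon_trick0 xpredT e2).
  apply: lee_nneseries => [k _ _|k _]; first exact: measure_ge0.
  apply: (@le_trans _ _ (fine (mu (G (n + k.+1)%N)))%:E).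
    by rewrite -(muE (G (n + k.+1)%N) (mG _)).
  by rewrite lee_fin; exact: G4k.
exists (fun n => G n `\` U n); split.
- by move=> n; exact: measurableD.
- move=> n; have mD : measurable (G n `\` U n) by exact: measurableD.
  have mI : measurable (G n `&` U n) by exact: measurableI.
  have hD : fine (mu (G n)) = fine (mu (G n `\` U n)) + fine (mu (G n `&` U n)).
    by rewrite -fineD ?mfin//; congr fine; exact: measureDI.
  have hI : fine (mu (G n `&` U n)) <= fine (mu (G n)) / 2.
    rewrite -lee_fin -(muE _ mI); apply: le_trans (Usmall n).
    by rewrite le_measure ?inE.
  by rewrite (muE _ mD) lte_fin; have := G0 n; lra.
- apply: ltn_trivIset => n m mn; rewrite -subset0 => x [[_ Um] [Gn _]].
  apply: Um; exists (n - m).-1 => //.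
  by rewrite prednK ?subn_gt0// subnKC// ltnW.
- move=> n x [+ _]; rewrite /G /pdisc/= => /andP[-> xr] /=.
  exact: lt_le_trans xr (rP n).2.
Qed.

(** A measurable block number turns synthesis over the blocks into a weighted composition. Its value
    0 outside the blocks is harmless, as the weights used with it carry an indicator. *)
Lemma disjoint_index d (T : measurableType d) (E : nat -> set T) :
  (forall n, measurable (E n)) -> trivIset setT E ->
  exists2 idx : T -> nat, measurable_fun setT idx &
    forall n x, E n x -> idx x = n.
Proof.
move=> mE tE.
have ex (x : T) : exists n, (exists m, E m x) -> E n x.
  have [[m Em]|h] := pselect (exists m, E m x); first by exists m.
  by exists 0%N.
have [f fP] := choice ex.
pose idx x := if pselect (exists m, E m x) is left _ then f x else 0%N.
have idxE n x : E n x -> idx x = n.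
  move=> En; rewrite /idx; case: pselect => [h|h]; last by exfalso; apply: h; exists n.
  by apply: (tE (f x) n) => //; exists x; split => //; exact: fP.
exists idx => // _ B mB; rewrite setTI.
have -> : idx @^-1` B = (\bigcup_(n in B) E n) `|`
    (if 0%N \in B then ~` (\bigcup_n E n) else set0).
  apply/seteqP; split => x /=.
    have [[m Em]|h] := pselect (exists m, E m x).
      by rewrite (idxE m x Em) => Bm; left; exists m.
    have -> : idx x = 0%N by rewrite /idx; case: pselect.
    by move=> B0; right; rewrite mem_set// => -[m _ Em]; apply: h; exists m.
  case=> [[n Bn En]|]; first by rewrite (idxE n x En).
  case: ifPn => // /set_mem B0 h.
  have -> : idx x = 0%N; last by [].
  by rewrite /idx; case: pselect => // -[m Em]; exfalso; apply: h; exists m.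
apply: measurableU; first exact: bigcup_measurable.
by case: ifP => // _; apply: measurableC; exact: bigcup_measurable.
Qed.

End punctured_discs.

Section complex_integral.
Context {R : realType} {p : R} (p_gt1 : 1 < p).
Let p1 : 1 <= p := ltW p_gt1.
Let p_gt0 : 0 < p. Proof. exact: lt_le_trans p1. Qed.
Context d {T : measurableType d} (mu : {finite_measure set T -> \bar R}).
Local Notation Re := (@complex.Re R).
Local Notation Im := (@complex.Im R).

Definition cint (E : set T) (f : T -> R[i]) : R[i] :=
  ((\int[mu]_(x in E) Re (f x)) +i* (\int[mu]_(x in E) Im (f x)))%C.

Definition cintegrable (E : set T) (f : T -> R[i]) :=
  mu.-integrable E (EFin \o (Re \o f)) /\ mu.-integrable E (EFin \o (Im \o f)).

Lemma Re_addC (x y : R[i]) : Re (x + y) = Re x + Re y.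
Proof. by case: x => ? ?; case: y. Qed.
Lemma Im_addC (x y : R[i]) : Im (x + y) = Im x + Im y.
Proof. by case: x => ? ?; case: y. Qed.
Lemma Re_mulC (x y : R[i]) : Re (x * y) = Re x * Re y - Im x * Im y.
Proof. by case: x => ? ?; case: y. Qed.
Lemma Im_mulC (x y : R[i]) : Im (x * y) = Re x * Im y + Im x * Re y.
Proof. by case: x => ? ?; case: y. Qed.

Lemma integrable_lin (E : set T) (a b : R) (f g : T -> R) : measurable E ->
  mu.-integrable E (EFin \o f) -> mu.-integrable E (EFin \o g) ->
  mu.-integrable E (EFin \o (fun x => a * f x + b * g x)) /\
  \int[mu]_(x in E) (a * f x + b * g x) =
    a * \int[mu]_(x in E) f x + b * \int[mu]_(x in E) g x.
Proof.
move=> mE fi gi.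
have afi : mu.-integrable E (EFin \o (fun x => a * f x)) by exact: (integrableZl mE a fi).
have bgi : mu.-integrable E (EFin \o (fun x => b * g x)) by exact: (integrableZl mE b gi).
split; first exact: (integrableD mE afi bgi).
by rewrite RintegralD// !RintegralZl.
Qed.

Lemma cint_lin (E : set T) (a : R[i]) (f g : T -> R[i]) : measurable E ->
  cintegrable E f -> cintegrable E g ->
  cintegrable E (fun x => a * f x + g x) /\
  cint E (fun x => a * f x + g x) = a * cint E f + cint E g.
Proof.
move=> mE [fR fI] [gR gI].
have [i1 e1] := integrable_lin (Re a) (- Im a) mE fR fI.
have [i2 e2] := integrable_lin 1 1 mE i1 gR.
have [i3 e3] := integrable_lin (Re a) (Im a) mE fI fR.
have [i4 e4] := integrable_lin 1 1 mE i3 gI.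
have ER : (fun x => Re (a * f x + g x)) =
    fun x => 1 * (Re a * Re (f x) + - Im a * Im (f x)) + 1 * Re (g x).
  by apply/funext => x; rewrite Re_addC Re_mulC !mul1r mulNr.
have EI : (fun x => Im (a * f x + g x)) =
    fun x => 1 * (Re a * Im (f x) + Im a * Re (f x)) + 1 * Im (g x).
  by apply/funext => x; rewrite Im_addC Im_mulC !mul1r.
split; first by split; [move: i2; rewrite -ER|move: i4; rewrite -EI].
rewrite /cint ER EI e2 e4 e1 e3 !mul1r.
by apply/eqP; rewrite eq_complex; rewrite Re_addC Im_addC Re_mulC Im_mulC /= mulNr !eqxx.
Qed.


Lemma powR_ge_id (u : R) : 0 <= u -> u <= 1 + u `^ p.
Proof.
move=> u0; have [u1|u1] := leP u 1; first by rewrite (le_trans u1)// lerDl powR_ge0.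
by rewrite (le_trans (le1r_powR (ltW u1) p1))// lerDr.
Qed.

Lemma normc_integrable (E : set T) (f : T -> R[i]) : measurable E ->
  f \in LfunC_pred mu p1 -> mu.-integrable E (EFin \o ((@normc R) \o f)).
Proof.
move=> mE /LfunCP[mf fp].
apply: (@integrableS _ _ _ _ setT) => //.
have i1 : mu.-integrable setT (EFin \o (fun x => normc (f x) `^ p)).
  apply/integrableP; split; first exact: measurable_normc_powR.
  by under eq_integral do rewrite gee0_abs ?lee_fin ?powR_ge0//.
have i2 : mu.-integrable setT (EFin \o cst (1 : R)).
  exact: finite_measure_integrable_cst.
apply: le_integrable (integrableD _ i2 i1) => //.
  by apply/measurable_EFinP; exact: measurable_normcE.
move=> x _ /=; rewrite lee_fin ger0_norm ?normc_ge0//.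
rewrite ger0_norm ?addr_ge0 ?powR_ge0//; apply: powR_ge_id; exact: normc_ge0.
Qed.

Lemma LfunC_cintegrable (E : set T) (f : T -> R[i]) : measurable E ->
  f \in LfunC_pred mu p1 -> cintegrable E f.
Proof.
move=> mE fL; have [mf fp] := (LfunCP _ _ _).1 fL.
have ni := normc_integrable mE fL.
split; apply: le_integrable ni => //.
- apply/measurable_EFinP; apply: measurable_funTS.
  by have /measurable_funC[] := mf.
- move=> x _ /=; rewrite lee_fin [leRHS]ger0_norm ?normc_ge0//; exact: ler_norm_Re.
- apply/measurable_EFinP; apply: measurable_funTS.
  by have /measurable_funC[] := mf.
- move=> x _ /=; rewrite lee_fin [leRHS]ger0_norm ?normc_ge0//; exact: ler_norm_Im.
Qed.

(** The factor 2 comes from bounding real and imaginary parts separately; only boundedness of the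
    averages matters later. *)
Lemma cint_le (E : set T) (f : T -> R[i]) : measurable E ->
  f \in LfunC_pred mu p1 ->
  normc (cint E f) <= 2 * \int[mu]_(x in E) normc (f x).
Proof.
move=> mE fL; have [fR fI] := LfunC_cintegrable mE fL.
have ni := normc_integrable mE fL.
rewrite (le_trans (normc_le_ReIm _))//= mulr_natl mulr2n lerD//.
  apply: (le_trans (le_normr_Rintegral mE fR)); apply: le_Rintegral => //.
    exact: (integrable_norm fR).
  by move=> x _; exact: ler_norm_Re.
apply: (le_trans (le_normr_Rintegral mE fI)); apply: le_Rintegral => //.
  exact: (integrable_norm fI).
by move=> x _; exact: ler_norm_Im.
Qed.

Let q := (1 - p^-1)^-1.
Let q_gt0 : 0 < q. Proof. by rewrite invr_gt0 subr_gt0 invf_lt1. Qed.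

Lemma hoelder_set (E : set T) (f : T -> R[i]) : measurable E ->
  f \in LfunC_pred mu p1 ->
  \int[mu]_(x in E) normc (f x) <=
  (fine (\int[mu]_(x in E) (normc (f x) `^ p)%:E)) `^ p^-1 *
    (fine (mu E)) `^ (1 - p^-1).
Proof.
move=> mE fL; have [mf fp] := (LfunCP _ _ _).1 fL.
pose F x := normc (f x) * \1_E x; pose G := (\1_E : T -> R).
have mG : measurable_fun setT G by exact: measurable_indic.
have mF : measurable_fun setT F by apply: measurable_funM => //; exact: measurable_normcE.
have pq : p^-1 + q^-1 = 1 by rewrite /q invrK addrC subrK.
have := hoelder mu mF mG p_gt0 q_gt0 pq.
have -> : ('N[mu]_1[EFin \o (F \* G)%R] = \int[mu]_(x in E) (normc (f x))%:E)%E.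
  rewrite Lnorm1 [RHS]integral_mkcond; apply: eq_integral => x _.
  rewrite /F /G /= patchE indicE; case: ifPn => _.
    by rewrite !mulr1 ger0_norm// normc_ge0.
  by rewrite !mulr0 normr0.
have -> : ('N[mu]_p%:E[EFin \o F] =
    (\int[mu]_(x in E) (normc (f x) `^ p)%:E) `^ p^-1)%E.
  rewrite unlock; congr (_ `^ _)%E; rewrite [RHS]integral_mkcond.
  apply: eq_integral => x _ /=; rewrite /F patchE indicE; case: ifPn => _.
    by rewrite mulr1 ger0_norm// normc_ge0.
  by rewrite mulr0 normr0 powR0// gt_eqF.
have -> : ('N[mu]_q%:E[EFin \o G] = (mu E) `^ (1 - p^-1))%E.
  rewrite unlock {1}/q invrK; congr (_ `^ _)%E.
  rewrite -[RHS]mul1e -integral_cst// [RHS]integral_mkcond.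
  apply: eq_integral => x _ /=; rewrite /G patchE indicE; case: ifPn => _.
    by rewrite normr1 powR1.
  by rewrite normr0 powR0// gt_eqF.
have fin1 : (\int[mu]_(x in E) (normc (f x) `^ p)%:E \is a fin_num)%E.
  rewrite ge0_fin_numE; last by apply: integral_ge0 => x _; rewrite lee_fin powR_ge0.
  apply: le_lt_trans fp; apply: ge0_subset_integral => //.
    exact: measurable_normc_powR.
  by move=> x _; rewrite lee_fin powR_ge0.
rewrite -{1}(fineK fin1) -(fineK (fin_num_measure mu E mE)) !poweR_EFin -EFinM.
move=> h; rewrite /Rintegral -lee_fin; apply: le_trans h.
by rewrite fineK//; exact: (integrable_fin_num mE (normc_integrable mE fL)).
Qed.

End complex_integral.

Lemma integral_normc_powRZl (R : realType) (p : R) d (T : measurableType d)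
    (m : {measure set T -> \bar R}) (D : set T) (f : T -> R[i]) (k : R) :
  measurable D -> measurable_fun setT (f : T -> borelC R) -> 0 <= k ->
  (\int[m]_(x in D) (k%:E * (normc (f x) `^ p)%:E) =
   k%:E * \int[m]_(x in D) (normc (f x) `^ p)%:E)%E.
Proof.
move=> mD mf k0; apply: ge0_integralZl => //.
- by apply: measurable_funTS; exact: measurable_normc_powR.
- by move=> x _; rewrite lee_fin powR_ge0.
Qed.

(** * Normalized indicators of disjoint blocks, and averages over them *)

Section block_operators.
Context {R : realType} {p : R} (p_gt1 : 1 < p).
Let p1 : 1 <= p := ltW p_gt1.
Let p_gt0 : 0 < p. Proof. exact: lt_le_trans p1. Qed.
Context d {T : measurableType d} (mu : {finite_measure set T -> \bar R}).
Variables (E : nat -> set T) (idx : T -> nat) (Z : set nat).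
Hypothesis mE : forall n, measurable (E n).
Hypothesis E0 : forall n, (0 < mu (E n))%E.
Hypothesis midx : measurable_fun setT idx.
Hypothesis idxE : forall n x, E n x -> idx x = n.

Let M n := fine (mu (E n)).

Let M_gt0 n : 0 < M n.
Proof. by rewrite fine_gt0// E0/= ltey_eq fin_num_measure. Qed.

Let muEn n : mu (E n) = (M n)%:E.
Proof. by rewrite /M fineK// fin_num_measure. Qed.

Let EZ := \bigcup_(n in Z) E n.

Let mEZ : measurable EZ. Proof. exact: bigcup_measurable. Qed.

Lemma measurable_comp_nat (g : nat -> R) : measurable_fun setT (g \o idx).
Proof. by apply: measurableT_comp midx. Qed.

Definition block_weight (x : T) : R[i] := (\1_EZ x * M (idx x) `^ (- p^-1))%:C%C.

Lemma measurable_block_weight :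
  measurable_fun setT (block_weight : T -> borelC R).
Proof.
apply: measurable_real_complex; apply: measurable_funM.
  exact: measurable_indic.
exact: (measurable_comp_nat (fun n => M n `^ (- p^-1))).
Qed.

Lemma block_weightE n x : E n x -> Z n -> block_weight x = (M n `^ (- p^-1))%:C%C.
Proof.
move=> Enx Zn; rewrite /block_weight (idxE Enx) indicE mem_set ?mul1r//.
by exists n.
Qed.

Lemma normc_block_weight x : normc (block_weight x) `^ p = \1_EZ x / M (idx x).
Proof.
rewrite normc_real ger0_norm ?mulr_ge0 ?powR_ge0// powRM ?powR_ge0//.
rewrite -powRrM mulNr mulVf ?gt_eqF// powR_inv1 ?(ltW (M_gt0 _))//.
congr (_ * _); rewrite indicE; case: (_ \in _); first by rewrite powR1.
by rewrite powR0// gt_eqF.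
Qed.

Lemma wdom_block (u : T -> R[i]) : measurable_fun setT (u : T -> borelC R) ->
  (forall x, normc (u x) <= normc (block_weight x)) ->
  wdom (p := p) mu (cnt Z) u idx.
Proof.
move=> mu_ uv; apply: wdom_fibers => // n.
have mF : measurable (idx @^-1` [set n]) by rewrite -[X in measurable X]setTI; exact: midx.
apply: (@le_trans _ _ (\int[mu]_(x in E n) ((\1_Z n / M n))%:E)%E); last first.
  rewrite integral_cst// [X in (_ * X)%E](_ : _ = (M n)%:E); last exact: muEn.
  by rewrite -EFinM divfK ?gt_eqF// lee_fin.
rewrite integral_mkcond [leRHS]integral_mkcond.
apply: ge0_le_integral => //.
- by move=> x _; rewrite patchE; case: ifP => // _; rewrite lee_fin powR_ge0.
- apply/(measurable_restrictT _ mF); apply: measurable_funTS.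
  exact: measurable_normc_powR.
- apply/(measurable_restrictT _ (mE n)); exact: measurable_cst.
move=> x _; rewrite !patchE; case: ifPn => [/set_mem /= xn|_]; last first.
  by case: ifP => // _; rewrite lee_fin divr_ge0// ltW// M_gt0.
have h : normc (u x) `^ p <= \1_EZ x / M n.
  rewrite -xn -normc_block_weight; apply: ge0_ler_powR; rewrite ?nnegrE ?normc_ge0//.
  exact: ltW.
case: ifPn => [xE|/negP xE]; rewrite lee_fin; apply: (le_trans h).
  rewrite ler_wpM2r ?invr_ge0 ?(ltW (M_gt0 _))// !indicE ler_nat.
  case: (boolP (x \in EZ)) => // /set_mem[k Zk Ek].
  by rewrite mem_set// -xn (idxE Ek).
rewrite indicE memNset ?mul0r// => -[k Zk Ek]; apply: xE.
by rewrite inE -xn (idxE Ek).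
Qed.

Lemma wdom_block_weight : wdom (p := p) mu (cnt Z) block_weight idx.
Proof. by apply: wdom_block => //; exact: measurable_block_weight. Qed.

(* [bsyn] maps the n-th unit vector to the normalized indicator of [E n]; its left
   inverse [bana] takes the corresponding averages. *)
Definition bsyn : Lp (cnt Z) p1 -> Lp mu p1 := wc p1 mu (cnt Z) block_weight idx.

Lemma bsyn_oper : oper bsyn. Proof. exact: wc_oper wdom_block_weight. Qed.

(** The exponent cancels twice: against M^(1 - 1/p) from Hoelder, which bounds the average, and
    against M^(-1/p) * M from integrating the normalized indicator, which makes [bana] a left
    inverse of [bsyn]. *)
Definition block_avg (f : T -> R[i]) (n : nat) : R[i] :=
  (M n `^ (p^-1 - 1))%:C%C * cint mu (E n) f.

Lemma block_avg_bound (f : T -> R[i]) n : f \in LfunC_pred mu p1 ->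
  ((normc (block_avg f n) `^ p)%:E <=
   (2 `^ p)%:E * \int[mu]_(x in E n) (normc (f x) `^ p)%:E)%E.
Proof.
move=> fL; set I := (\int[mu]_(x in E n) (normc (f x) `^ p)%:E)%E.
have I0 : (0 <= I)%E by apply: integral_ge0 => x _; rewrite lee_fin powR_ge0.
have Ifin : (I \is a fin_num)%E.
  rewrite ge0_fin_numE//; have /LfunCP[mf fp] := fL.
  apply: le_lt_trans fp; apply: ge0_subset_integral => //.
    exact: measurable_normc_powR.
  by move=> x _; rewrite lee_fin powR_ge0.
rewrite -(fineK Ifin) -EFinM lee_fin.
have h : normc (block_avg f n) <= 2 * (fine I) `^ p^-1.
  rewrite normcM normc_real ger0_norm ?powR_ge0//.
  apply: (@le_trans _ _ (M n `^ (p^-1 - 1) *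
      (2 * ((fine I) `^ p^-1 * M n `^ (1 - p^-1))))).
    rewrite ler_wpM2l ?powR_ge0//.
    apply: (le_trans (cint_le (mE n) fL)).
    by rewrite ler_wpM2l//; exact: hoelder_set.
  rewrite mulrCA ler_wpM2l// mulrCA ler_piMr ?powR_ge0//.
  rewrite -powRD; last by rewrite (gt_eqF (M_gt0 n)) implybT.
  by rewrite (_ : p^-1 - 1 + _ = 0) ?powRr0//; ring.
apply: (@le_trans _ _ ((2 * (fine I) `^ p^-1) `^ p)).
  apply: ge0_ler_powR => //; rewrite ?nnegrE ?normc_ge0 ?mulr_ge0 ?powR_ge0//.
  exact: ltW.
by rewrite powRM ?powR_ge0// -powRrM mulVf ?gt_eqF// powRr1// fine_ge0.
Qed.


Lemma block_trivIset : trivIset setT E.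
Proof. by move=> i j _ _ [x [Ei Ej]]; rewrite -(idxE Ei) -(idxE Ej). Qed.

Lemma pint_block_avg (f : T -> R[i]) : f \in LfunC_pred mu p1 ->
  (pint (p := p) (cnt Z) (block_avg f) <= (2 `^ p)%:E * pint (p := p) mu f)%E.
Proof.
move=> fL; have /LfunCP[mf fp] := fL.
have mg : measurable_fun setT (fun x => (2 `^ p)%:E * (normc (f x) `^ p)%:E)%E.
  by apply: emeasurable_funM => //; exact: measurable_normc_powR.
have g0 x : (0 <= (2 `^ p)%:E * (normc (f x) `^ p)%:E)%E.
  by rewrite mule_ge0// lee_fin powR_ge0.
rewrite /pint integral_cnt; last by move=> n; rewrite lee_fin powR_ge0.
rewrite -(integral_normc_powRZl p mu measurableT mf (powR_ge0 _ _)).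
apply: (@le_trans _ _ (\int[mu]_(x in \bigcup_n E n)
    ((2 `^ p)%:E * (normc (f x) `^ p)%:E))%E); last first.
  by apply: ge0_subset_integral => //; exact: bigcup_measurable.
rewrite ge0_integral_bigcup//; last 2 first.
- exact: measurable_funTS.
- exact: block_trivIset.
rewrite nneseries_esumT; last by move=> n; exact: integral_ge0.
rewrite esum_mkcond; apply: le_esum => n _; case: ifPn => _; last exact: integral_ge0.
by rewrite (integral_normc_powRZl p mu (mE n) mf (powR_ge0 _ _)); exact: block_avg_bound.
Qed.

Lemma block_avg_LfunC (f : T -> R[i]) : f \in LfunC_pred mu p1 ->
  block_avg f \in LfunC_pred (cnt Z) p1.
Proof.
move=> fL; apply/lDP; apply: le_lt_trans (pint_block_avg fL) _.
have /LfunCP[_ fp] := fL.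
by rewrite lte_mul_pinfty ?lee_fin ?powR_ge0.
Qed.

Lemma block_avg_lin (a : R[i]) (f g : T -> R[i]) n :
  f \in LfunC_pred mu p1 -> g \in LfunC_pred mu p1 ->
  block_avg (fun x => a * f x + g x) n = a * block_avg f n + block_avg g n.
Proof.
move=> fL gL; rewrite /block_avg.
have [_ ->] := cint_lin a (mE n) (LfunC_cintegrable (mE n) fL)
  (LfunC_cintegrable (mE n) gL).
by rewrite mulrDr mulrCA.
Qed.

Definition bana (X : Lp mu p1) : Lp (cnt Z) p1 :=
  Lp_class (mkL p1 (cnt Z) (block_avg X)).

Lemma LfunC_mem (f : LfunC mu p1) : (f : T -> R[i]) \in LfunC_pred mu p1.
Proof. exact: valP. Qed.

Lemma bana_oper : oper bana.
Proof.
have [|a f g|f|oF _] := @lift_oper R p p1 _ _ _ _ mu (cnt Z)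
  (fun f : LfunC mu p1 => mkL p1 (cnt Z) (block_avg f)) (2 `^ p).
- exact: powR_ge0.
- apply: aeW => n; rewrite !mkLE ?block_avg_LfunC ?LfunC_mem//.
  exact: (block_avg_lin a n (LfunC_mem f) (LfunC_mem g)).
- rewrite mkLE ?block_avg_LfunC ?LfunC_mem//; apply: pint_block_avg.
  exact: LfunC_mem.
exact: oF.
Qed.

Lemma banaE (X : Lp mu p1) n : Z n -> bana X n = block_avg X n.
Proof.
move: n; apply/cnt_ae.
apply: filterS (Lp_classK (mkL p1 (cnt Z) (block_avg X))) => n ->.
by rewrite mkLE ?block_avg_LfunC ?LfunC_mem.
Qed.

Lemma cint_ae_eq (f g : T -> R[i]) n :
  measurable_fun setT (f : T -> borelC R) ->
  measurable_fun setT (g : T -> borelC R) ->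
  {ae mu, forall x, E n x -> f x = g x} -> cint mu (E n) f = cint mu (E n) g.
Proof.
move=> /measurable_funC[fR fI] /measurable_funC[gR gI] fg.
rewrite /cint; congr (_ +i* _)%C; rewrite /Rintegral; congr fine.
  apply: ae_eq_integral => //.
  - by apply/measurable_EFinP; exact: measurable_funTS.
  - by apply/measurable_EFinP; exact: measurable_funTS.
  by apply: filterS fg => x h Ex; rewrite h.
apply: ae_eq_integral => //.
- by apply/measurable_EFinP; exact: measurable_funTS.
- by apply/measurable_EFinP; exact: measurable_funTS.
by apply: filterS fg => x h Ex; rewrite h.
Qed.

Lemma cint_cst (c : R[i]) n : cint mu (E n) (fun=> c) = c * (M n)%:C%C.
Proof.
rewrite /cint !Rintegral_cst// -/(M n).
by apply/eqP; rewrite eq_complex Re_mulC Im_mulC /= !mulr0 subr0 add0r !eqxx.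
Qed.

Lemma bana_bsyn : cancel bsyn bana.
Proof.
move=> a; apply/lD_eqP => n Zn; rewrite banaE// /block_avg.
rewrite (@cint_ae_eq _ (fun=> (M n `^ (- p^-1))%:C%C * a n)).
- rewrite cint_cst.
  have e : M n `^ (p^-1 - 1) * M n `^ (- p^-1) * M n = 1.
    rewrite -powRD; last by rewrite (gt_eqF (M_gt0 n)) implybT.
    rewrite (_ : _ + _ = - 1); last by ring.
    by rewrite powR_inv1 ?(ltW (M_gt0 n))// mulVf// gt_eqF.
  have eC (x y w : R) (c : R[i]) :
      x%:C%C * (y%:C%C * c * w%:C%C) = (x * y * w)%:C%C * c.
    by rewrite !rmorphM/=; ring.
  by rewrite eC e rmorph1 mul1r.
- exact: LfunC_measurable.
- exact: measurable_cst.
apply: filterS (wc_ae wdom_block_weight a) => x -> Enx.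
by rewrite (block_weightE Enx Zn) (idxE Enx).
Qed.

Variables (z : T -> R[i]) (t : nat -> R[i]) (eta : nat -> R).
Variables (A : Lp mu p1 -> Lp mu p1) (Bz Bt : R).
Hypothesis mz : measurable_fun setT (z : T -> borelC R).
Hypothesis AE : forall X, {ae mu, forall x, A X x = z x * X x}.
Hypothesis tB : forall n, normc (t n) <= Bt.
Hypothesis eta_gt0 : forall n, 0 < eta n.
Hypothesis eta_cvg : forall e, 0 < e -> exists N, forall n, (N <= n)%N -> eta n <= e.
Hypothesis ztE : forall n x, E n x -> normc (z x - t n) <= eta n.

Let wdom_eta : wdom (p := p) (cnt Z) (cnt Z) (fun n => (eta n)%:C%C) id.
Proof.
apply: (wdom_diag p1) => e /eta_cvg[N hN]; exists N => n /hN h _.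
by rewrite normc_real ger0_norm// ltW.
Qed.

Let compact_eta :
  compact_operator (wc p1 (cnt Z) (cnt Z) (fun n => (eta n)%:C%C) id).
Proof.
apply: compact_diag => e /eta_cvg[N hN]; exists N => n /hN h _.
by rewrite normc_real ger0_norm// ltW.
Qed.

Let wdom_t : wdom (p := p) (cnt Z) (cnt Z) t id.
Proof. by apply: (wdom_mul p1 (B := Bt)) => //; apply/cnt_ae => n _. Qed.

(** On the n-th block z = eta n * xi + t n with |xi| at most 1. Dividing by [eta] exhibits both
    defects below as products of a bounded operator with the compact diagonal operator diag(eta). *)
Let xi (x : T) : R[i] :=
  (\1_(\bigcup_n E n) x / eta (idx x))%:C%C * (z x - t (idx x)).

Let mxi : measurable_fun setT (xi : T -> borelC R).
Proof.
apply: measurable_mulC.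
  apply: measurable_real_complex; apply: measurable_funM.
    by apply: measurable_indic; exact: bigcup_measurable.
  exact: (measurable_comp_nat (fun n => (eta n)^-1)).
have mt : measurable_fun setT ((fun x => t (idx x)) : T -> borelC R).
  have mtn : measurable_fun setT (t : nat -> borelC R) by [].
  exact: (measurableT_comp mtn midx).
have := measurable_linC (-1) mt mz; congr (measurable_fun _ _).
by apply/funext => x; rewrite !fctE scaleN1r addrC.
Qed.

Let xi_le1 x : normc (xi x) <= 1.
Proof.
rewrite /xi normcM normc_real indicE; case: (boolP (x \in _)) => [/set_mem[n _ Enx]|_].
  rewrite (idxE Enx) mul1r ger0_norm ?invr_ge0 ?(ltW (eta_gt0 n))//.
  by rewrite ler_pdivrMl// mulr1; exact: ztE.
by rewrite mul0r normr0 mul0r.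
Qed.

Let wdom_xi : wdom (p := p) mu mu xi id.
Proof. by apply: (wdom_mul p1 (B := 1)) => //; apply: aeW. Qed.

Let xiE n x : E n x -> z x = (eta n)%:C%C * xi x + t n.
Proof.
move=> Enx; rewrite /xi indicE mem_set; last by exists n.
rewrite (idxE Enx) mul1r mulrA -rmorphM/= divff ?gt_eqF//.
by rewrite rmorph1 mul1r subrK.
Qed.

(** This defect is synthesis with the weight multiplied by [xi], applied after diag(eta). *)
Lemma compact_mul_bsyn : compact_operator
  (fun a => A (bsyn a) - bsyn (wc p1 (cnt Z) (cnt Z) t id a)).
Proof.
have wu : wdom (p := p) mu (cnt Z) (fun x => xi x * block_weight x) idx.
  apply: wdom_block.
    by apply: measurable_mulC => //; exact: measurable_block_weight.
  by move=> x; rewrite normcM ler_piMl// normc_ge0.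
have := compact_operator_compl (wc_oper p1 wu) compact_eta.
congr compact_operator; apply/funext => a; apply/Lp_eqP.
have h1 := wc_wc a wu wdom_eta.
have h2 := wc_wc a wdom_block_weight wdom_t.
have h3 := AE (bsyn a).
have h4 := wc_ae wdom_block_weight a.
have h5 := Lp_addE (A (bsyn a)) (- bsyn (wc p1 (cnt Z) (cnt Z) t id a)).
have h6 := Lp_scaleE (-1) (bsyn (wc p1 (cnt Z) (cnt Z) t id a)).
apply: filterS2 (filterI h1 h2) (filterI (filterI h3 h4) (filterI h5 h6)).
move=> x [e1 e2] [[e3 e4] [e5 e6]].
rewrite e1 e5 -scaleN1r e6 e2 e3 e4.
case: (pselect (exists n, E n x)) => [[n Enx]|h].
  by rewrite (xiE Enx) (idxE Enx) /=; ring.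
rewrite /block_weight indicE memNset ?mul0r ?rmorph0; first by ring.
by move=> [n _ Enx]; apply: h; exists n.
Qed.

(** This defect is diag(eta) applied to the averages of [xi] times the function. *)
Lemma compact_bana_mul : compact_operator
  (fun X => bana (A X) - wc p1 (cnt Z) (cnt Z) t id (bana X)).
Proof.
have := compact_operator_compr compact_eta (oper_comp bana_oper (wc_oper p1 wdom_xi)).
congr compact_operator; apply/funext => X; apply/lD_eqP => n Zn.
have /cnt_ae h1 := wc_ae wdom_eta (bana (wc p1 mu mu xi id X)).
have /cnt_ae h2 := wc_ae wdom_t (bana X).
rewrite h1// banaE// lD_addE// -scaleN1r lD_scaleE// h2// !banaE//.
pose Y := wc p1 mu mu xi id X.
(* Just t n times [X], written in the form a * f + g that [block_avg_lin] accepts. *)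
pose G : LfunC mu p1 := (t n - 1) *: Lp_fun X + Lp_fun X.
have GE x : G x = (t n - 1) * Lp_fun X x + Lp_fun X x by [].
have -> : block_avg (A X) n = block_avg (fun x => (eta n)%:C%C * Y x + G x) n.
  congr (_ * _); apply: cint_ae_eq.
  - exact: LfunC_measurable.
  - exact: (measurable_linC _ (LfunC_measurable Y) (LfunC_measurable G)).
  apply: filterS2 (AE X) (wc_ae wdom_xi X) => x -> e Enx.
  by rewrite /Y e GE (xiE Enx) /=; ring.
rewrite block_avg_lin ?LfunC_mem//.
have -> : block_avg G n = (t n - 1) * block_avg (Lp_fun X) n + block_avg (Lp_fun X) n.
  by rewrite -block_avg_lin ?LfunC_mem.
by rewrite /Y; ring.
Qed.

End block_operators.

Section hotel.

(* [hotel] takes each natural number infinitely often: hotel (2k) = k and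
   hotel (2n+1) = hotel n. *)
Fixpoint hotel_rec (f n : nat) : nat :=
  if f is f'.+1 then if odd n then hotel_rec f' n./2 else n./2 else 0.

Lemma hotel_recS f n :
  hotel_rec f.+1 n = if odd n then hotel_rec f n./2 else n./2.
Proof. by []. Qed.

Lemma hotel_rec_eq f g n : (n < f)%N -> (n < g)%N -> hotel_rec f n = hotel_rec g n.
Proof.
elim: f g n => // f IH [//|g] n nf ng /=; case: ifPn => // on.
by apply: IH; lia.
Qed.

Definition hotel n := hotel_rec n.+1 n.

Lemma hotel_double k : hotel k.*2 = k.
Proof. by rewrite /hotel /= odd_double doubleK. Qed.

Lemma hotel_doubleS n : hotel n.*2.+1 = hotel n.
Proof.
have e : n.*2.+1./2 = n by lia.
rewrite /hotel hotel_recS e oddS odd_double.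
by apply: hotel_rec_eq; lia.
Qed.

End hotel.

Section absorption.
Context {R : realType} {p : R} (p_gt1 : 1 < p).
Let p1 : 1 <= p := ltW p_gt1.

Lemma wc_wc_cntE d (T : measurableType d) d' (T' : measurableType d')
    (m : {measure set T -> \bar R}) (m' : {measure set T' -> \bar R})
    (D : set nat) (v : nat -> R[i]) (phi : nat -> T) (v' : T -> R[i])
    (phi' : T -> T') (X : Lp m' p1) n :
  wdom (p := p) (cnt D) m v phi -> wdom (p := p) m m' v' phi' -> D n ->
  wc p1 (cnt D) m v phi (wc p1 m m' v' phi' X) n =
  v n * (v' (phi n) * X (phi' (phi n))).
Proof. by move=> h h' Dn; have /cnt_ae -> := wc_wc X h h'. Qed.

Lemma limit_point_bounded (A : set R[i]) : compact A ->
  exists B, forall z, limit_point A z -> normc z <= B.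
Proof.
move=> cA; have [B _ hB] := compact_normc_bounded cA.
exists B => z /subset_limit_point.
have clA : closed A by apply: compact_closed cA; exact: norm_hausdorff.
by rewrite -(closure_id A).1// => /hB.
Qed.

(** The diagonal [t] takes each entry of [w] infinitely often. Since hotel (2n+1) = hotel n and
    hotel (2k) = k, the odd indices in [Z] carry a copy of all of [Z] and the even ones a copy of
    [D], with the same entries: this is the decomposition required by [csim_absorb]. *)
Lemma absorb (mu : {finite_measure set borelC R -> \bar R})
    (cmu : compact (supp mu)) (D : set nat) (w : nat -> R[i]) :
  (forall k, limit_point (supp mu) (w k)) ->
  csim (mult_op p1 cmu : Lp mu p1 -> Lp mu p1)
    (fun x : Lp mu p1 * Lp (cnt D) p1 =>
      (mult_op p1 cmu x.1, wc p1 (cnt D) (cnt D) w id x.2)).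
Proof.
move=> wL; pose t n := w (hotel n); pose Z : set nat := [set n | D (hotel n)].
pose eta (n : nat) : R := (2 ^+ n)^-1.
have eta_gt0 n : 0 < eta n by rewrite invr_gt0 exprn_gt0.
have [E [mE E0 tE Et]] := disjoint_pdiscs (fun n => wL (hotel n)) eta_gt0.
have [idx midx idxE] := disjoint_index mE tE.
have [Bt hBt] := limit_point_bounded cmu.
have tB n : normc (t n) <= Bt by apply: hBt; exact: wL.
have eta_cvg e : 0 < e -> exists N, forall n, (N <= n)%N -> eta n <= e.
  exact: inv_exp2_small.
have ztE n (x : borelC R) : E n x -> normc ((x : R[i]) - t n) <= eta n.
  by move=> /(Et n); rewrite /pdisc/= => /andP[_ /ltW].
have mz : measurable_fun setT ((fun x => x) : borelC R -> borelC R).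
  exact: measurable_id.
have AE := @mult_op_ae R p p1 mu cmu.
have k1 := compact_mul_bsyn Z mE E0 midx idxE mz AE tB eta_gt0 eta_cvg ztE.
have k2 := compact_bana_mul Z mE E0 midx idxE mz AE tB eta_gt0 eta_cvg ztE.
have wt : wdom (p := p) (cnt Z) (cnt Z) t id.
  by apply: (wdom_mul p1 (B := Bt)) => //; apply/cnt_ae => n _.
have ww : wdom (p := p) (cnt D) (cnt D) w id.
  by apply: (wdom_mul p1 (B := Bt)) => //; apply/cnt_ae => n _; exact: hBt.
have odd_half n : odd n -> n = n./2.*2.+1 by lia.
have half_doubleS n : n.*2.+1./2 = n by lia.
have even_half n : ~~ odd n -> n = n./2.*2 by lia.
have ws' : wdom (p := p) (cnt Z) (cnt Z) (fun=> 1) (fun n => n.*2.+1).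
  apply: (wdom_cnt p1 (B := 1)) => [m n _ _ _ _ []|n Zn _|n _]; first by lia.
    by rewrite /Z/= hotel_doubleS.
  by rewrite normc1.
have ws : wdom (p := p) (cnt Z) (cnt Z) (fun n => (odd n)%:R) half.
  apply: (wdom_cnt p1 (B := 1)) => [m n _ _|n|n _].
  - by rewrite !pnatr_eq0 !eqb0 !negbK => om on e; lia.
  - by rewrite /Z/= pnatr_eq0 eqb0 negbK => + on; rewrite {1}(odd_half n on) hotel_doubleS.
  - by case: odd; rewrite ?normc1 ?normc0.
have wi : wdom (p := p) (cnt Z) (cnt D) (fun n => (~~ odd n)%:R) half.
  apply: (wdom_cnt p1 (B := 1)) => [m n _ _|n|n _].
  - by rewrite !pnatr_eq0 !eqb0 !negbK => om on e; lia.
  - by rewrite /Z/= pnatr_eq0 eqb0 negbK => + on; rewrite {1}(even_half n on) hotel_double.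
  - by case: odd; rewrite ?normc1 ?normc0.
have wp : wdom (p := p) (cnt D) (cnt Z) (fun=> 1) double.
  apply: (wdom_cnt p1 (B := 1)) => [m n _ _ _ _|n Dn _|n _]; first by lia.
    by rewrite /Z/= hotel_double.
  by rewrite normc1.
have Zodd n : Z n -> odd n -> Z n./2.
  by rewrite /Z/= => + on; rewrite {1}(odd_half n on) hotel_doubleS.
apply: (@csim_absorb _ _ _ _ _ (wc p1 (cnt Z) (cnt Z) t id) _
  (@bsyn R p p_gt1 _ _ mu E idx Z) (@bana R p p_gt1 _ _ mu E Z)
  (wc p1 (cnt Z) (cnt Z) (fun n => (odd n)%:R) half)
  (wc p1 (cnt Z) (cnt Z) (fun=> 1) (fun n => n.*2.+1))
  (wc p1 (cnt Z) (cnt D) (fun n => (~~ odd n)%:R) half)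
  (wc p1 (cnt D) (cnt Z) (fun=> 1) double)).
- exact: (bsyn_oper p_gt1 Z mE E0 midx idxE).
- exact: (bana_oper p_gt1 Z mE E0 idxE).
- exact: (wc_oper p1 ws).
- exact: (wc_oper p1 ws').
- exact: (wc_oper p1 wi).
- exact: (wc_oper p1 wp).
- exact: (bana_bsyn mE E0 midx idxE).
- move=> X; apply/lD_eqP => n Zn; rewrite (wc_wc_cntE X ws' ws Zn).
  by rewrite half_doubleS oddS odd_double !mul1r.
- move=> X; apply/lD_eqP => n Dn; rewrite (wc_wc_cntE X wp wi Dn).
  by rewrite odd_double doubleK !mul1r.
- move=> X; apply/lD_eqP => n Zn.
  rewrite lD_addE// (wc_wc_cntE X ws ws' Zn) (wc_wc_cntE X wi wp Zn) !mul1r.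
  case: (boolP (odd n)) => on; rewrite ?mul1r ?mul0r ?addr0 ?add0r.
    by rewrite -odd_half.
  by rewrite -even_half.
- move=> X; apply/lD_eqP => n Dn; rewrite (wc_wc_cntE X wp ws Dn) lD_zeroE//.
  by rewrite odd_double mul0r mulr0.
- move=> X; apply/lD_eqP => n Zn; rewrite (wc_wc_cntE X ws' wi Zn) lD_zeroE//.
  by rewrite oddS odd_double mul0r mulr0.
- move=> X; apply/lD_eqP => n Zn.
  rewrite (wc_wc_cntE X wt ws' Zn) (wc_wc_cntE X ws' wt Zn) !mul1r.
  by rewrite /t hotel_doubleS.
- move=> X; apply/lD_eqP => n Dn.
  rewrite (wc_wc_cntE X ww wp Dn) (wc_wc_cntE X wp wt Dn) !mul1r.
  by rewrite /t hotel_double.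
- exact: k1.
- exact: k2.
- exact: mult_op_oper.
Qed.

End absorption.

(** * Sufficiency *)

Section cluster_points.
Context {R : realType}.

(** The filter consists of the sets containing all but finitely many points of [A]. Deleting one
    point stays within the filter, so each of its cluster points is a limit point. *)
Lemma compact_infinite_limit_point (T : topologicalType) (A K : set T) :
  ~ finite_set A -> A `<=` K -> compact K -> exists c, limit_point A c.
Proof.
move=> iA AK cK; pose F : set_system T := fun B => finite_set (A `\` B).
have FF : ProperFilter F.
  apply: Build_ProperFilter.
    by rewrite /F setD0.
  split.
  - by rewrite /F setDT.
  - by move=> P Q; rewrite /F setDIr => fP fQ; rewrite finite_setU.
  - by move=> P Q PQ; apply: sub_finite_set; exact: setDS.
have FK : F K by rewrite /F (_ : A `\` K = set0)//; apply/seteqP; split => // x [/AK].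
have [c [_ cF]] := cK F FF FK; exists c => U Uc.
have Fc : F (A `\ c).
  by apply: (@sub_finite_set _ _ [set c]) => // x [Ax /not_andP[|/contrapT]].
have [y [[Ay yc] Uy]] := cF _ _ Fc Uc.
by exists y; split => //; apply/eqP.
Qed.

Implicit Types mu : {finite_measure set borelC R -> \bar R}.

Lemma compact_limit_point (A : set R[i]) : compact A ->
  compact (limit_point A) /\ limit_point A `<=` A.
Proof.
move=> cA; have clA : closed A by apply: compact_closed cA; exact: norm_hausdorff.
have LA : limit_point A `<=` A.
  by move=> z /subset_limit_point; rewrite -(closure_id A).1.
split=> //; apply: (subclosed_compact _ cA LA).
apply: limit_point_closed; apply: hausdorff_accessible; exact: norm_hausdorff.
Qed.

(* [w n] is a limit point nearest to [a n]: only finitely many points of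
   an injective sequence in a compact set stay away from its limit points. *)
Lemma approx_limit_points (K : set R[i]) (D : set nat) (a : nat -> R[i]) :
  compact K -> ~ finite_set K -> {in D &, injective a} ->
  (forall n, D n -> K (a n)) ->
  exists2 w : nat -> R[i], (forall n, limit_point K (w n)) &
    forall e, 0 < e ->
    exists N, forall n, (N <= n)%N -> D n -> normc (a n - w n) <= e.
Proof.
move=> cK iK ia DK; have [cL LK] := compact_limit_point cK.
have L0 : limit_point K !=set0.
  exact: (compact_infinite_limit_point iK (@subset_refl _ _) cK).
have ex n : exists w, limit_point K w /\
    forall t, limit_point K t -> normc (a n - w) <= normc (a n - t).
  have cf : continuous (fun z => normc (a n - z)).
    apply: normc_lipschitz_continuous => z w.
    have h1 : normc (a n - z) <= normc (z - w) + normc (a n - w).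
      by rewrite -(normc_opp (z - w)) opprB [leRHS]addrC -[a n - z](subrKA w) ler_normcD.
    have h2 : normc (a n - w) <= normc (z - w) + normc (a n - z).
      by rewrite [leRHS]addrC -[a n - w](subrKA z) ler_normcD.
    by rewrite ler_norml; apply/andP; split; lra.
  have [c /set_mem cL' hc] := compact_EVT_min L0 cL (continuous_subspaceT cf).
  by exists c; split => // t Lt; apply: hc; rewrite inE.
have [w wP] := choice ex; exists w => [n|e e0]; first by have [] := wP n.
pose B := [set n | D n /\ e < normc (a n - w n)].
have fB : finite_set B.
  apply: contrapT => iB.
  have iaB : ~ finite_set (a @` B).
    rewrite (eq_finite_set (inj_card_eq (f := a) (A := B) _))//.
    by move=> i j /set_mem[Di _] /set_mem[Dj _]; apply: ia; rewrite inE.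
  have [|c ac] := compact_infinite_limit_point iaB _ cK.
    by move=> _ [n [Dn _] <-]; exact: DK.
  (* [c] is thus one of the competitors for the nearest limit point. But some [a n] with n in [B]
     lies within e of [c], closer than its supposedly nearest limit point. *)
  have cK' : limit_point K c.
    move=> U /ac[y [yc [n [Dn _] an] Uy]]; exists y; split => //; rewrite -an; exact: DK.
  have [|y [_ [n [Dn en] <-]]] := ac [set z | normc (z - c) < e].
    by apply/nbhs_normcP; exists e.
  move=> /=; have [_ /(_ _ cK')] := wP n.
  by move=> h1 h2; have := lt_trans (lt_le_trans en h1) h2; rewrite ltxx.
have [N hN] : exists N, forall n, B n -> (n < N)%N.
  have [X BX] := finite_fsetP.1 fB.
  exists (\max_(i <- finmap.enum_fset X) i).+1 => n; rewrite BX /= ltnS => nX.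
  exact: (@leq_bigmax_seq _ (finmap.enum_fset X) xpredT id n nX isT).
exists N => n Nn Dn; rewrite leNgt; apply/negP => h.
by have := hN n (conj Dn h); rewrite ltnNge Nn.
Qed.

(** An injection of the countable set of atoms into [nat] gives [D] as its image and [a] as its
    inverse. [e] extends it by 0 to the whole plane so as to serve as the index map of a weighted
    composition. *)
Lemma enum_point_masses mu : exists (D : set nat) (a : nat -> R[i])
    (e : borelC R -> nat), [/\ measurable_fun setT e,
    forall x, point_masses mu x -> D (e x) /\ a (e x) = x &
    forall n, D n -> point_masses mu (a n) /\ e (a n) = n].
Proof.
have mP := measurable_point_masses mu.
have /countable_injP[f fP] := countable_point_masses mu.
pose P := point_masses mu.
pose e (x : borelC R) := if x \in P then f x else 0%N.
have eP x : P x -> e x = f x by move=> Px; rewrite /e mem_set.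
have ex n : exists a : R[i], (f @` P) n -> P a /\ f a = n.
  have [[a Pa fa]|h] := pselect ((f @` P) n); last by exists 0.
  by exists a.
have [a aP] := choice ex; exists (f @` P), a, e; split.
- move=> _ B mB; rewrite setTI.
  have -> : e @^-1` B = (P `&` (f @^-1` B)) `|` (if 0%N \in B then ~` P else set0).
    apply/seteqP; split => x /=.
      rewrite /e; case: ifPn => [/set_mem Px|/negP Px] Bx; first by left.
      by right; rewrite mem_set// => Px'; apply: Px; rewrite inE.
    case=> [[Px Bx]|]; first by rewrite eP.
    case: ifPn => // /set_mem B0 Px; rewrite /e memNset//.
  apply: measurableU; last by case: ifP => // _; exact: measurableC.
  apply: countable_measurable; first exact: measurable_set1C.
  apply: sub_countable (countable_point_masses mu).
  by apply: subset_card_le => x [].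
- move=> x Px; rewrite eP//; split; first by exists x.
  have [|Pa fa] := aP (f x); first by exists x.
  by apply: fP => //; rewrite inE.
- move=> n Dn; have [Pa fa] := aP n Dn; split => //.
  by rewrite eP.
Qed.

End cluster_points.

(** * Radon-Nikodym weights away from the atoms *)

Section densities.
Context {R : realType} {p : R} (p1 : 1 <= p).
Let p_gt0 : 0 < p. Proof. exact: lt_le_trans p1. Qed.

Lemma rn_density d (T : measurableType d)
    (nu1 nu2 : {finite_measure set T -> \bar R}) : nu1 `<< nu2 ->
  exists h : T -> R, [/\ measurable_fun setT h, forall x, 0 <= h x &
    forall g : T -> \bar R, measurable_fun setT g -> (forall x, 0 <= g x)%E ->
    (\int[nu2]_x ((h x)%:E * g x) = \int[nu1]_x g x)%E].
Proof.
move=> nu12; pose f := Radon_Nikodym_SigmaFinite.f nu1 nu2.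
have ffin x : f x \is a fin_num := Radon_Nikodym_SigmaFinite.f_fin_num nu12 x.
have f0 x : (0 <= f x)%E := Radon_Nikodym_SigmaFinite.f_ge0 nu12 x.
have mf : measurable_fun setT f.
  exact: measurable_int (Radon_Nikodym_SigmaFinite.f_integrable nu12).
exists (fine \o f); split.
- exact: measurableT_comp mf.
- by move=> x; exact: fine_ge0.
move=> g mg g0.
rewrite -(Radon_Nikodym_SigmaFinite.change_of_variables nu12 g0 measurableT mg).
by apply: eq_integral => x _ /=; rewrite fineK// muleC.
Qed.

Implicit Types mu : {finite_measure set borelC R -> \bar R}.

(** With h the density of the first nonatomic part relative to the second, multiplication by h^(1/p)
    is isometric between their L^p spaces, and h^(-1/p) inverts it. Inside [N] each measure agrees
    with its nonatomic part; outside [N] both weights vanish, so as not to interfere with the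
    atoms. *)
Lemma density_pair mu1 mu2 :
  equivalent_measures (nonatomic_part mu1) (nonatomic_part mu2) ->
  exists rho rho' : borelC R -> R[i],
  let N := ~` (point_masses mu1 `|` point_masses mu2) in
  [/\ wdom (p := p) mu2 mu1 rho id, wdom (p := p) mu1 mu2 rho' id,
    forall x, ~ N x -> rho x = 0 /\ rho' x = 0,
    {ae mu1, forall x, N x -> rho' x * rho x = 1} &
    {ae mu2, forall x, N x -> rho x * rho' x = 1}].
Proof.
move=> [nu12 nu21]; have [h [mh h0 hint]] := rn_density nu12.
have mP1 := measurable_point_masses mu1; have mP2 := measurable_point_masses mu2.
pose N : set (borelC R) := ~` (point_masses mu1 `|` point_masses mu2).
have mN : measurable N by apply: measurableC; exact: measurableU.
have NP1 : N `<=` ~` point_masses mu1 by move=> x /= Nx Px; apply: Nx; left.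
have NP2 : N `<=` ~` point_masses mu2 by move=> x /= Nx Px; apply: Nx; right.
have nu1E (g : borelC R -> \bar R) : measurable_fun setT g -> (forall x, 0 <= g x)%E ->
    (forall x, ~ N x -> g x = 0%E) -> (\int[mu1]_x g x = \int[nonatomic_part mu1]_x g x)%E.
  move=> mg g0 gN; rewrite ge0_integral_mrestr// [RHS]integral_mkcond.
  apply: eq_integral => x _; rewrite patchE; case: ifPn => // /negP xP.
  by apply: gN => Nx; apply: xP; rewrite inE; exact: NP1.
have nu2E (g : borelC R -> \bar R) : measurable_fun setT g -> (forall x, 0 <= g x)%E ->
    (forall x, ~ N x -> g x = 0%E) -> (\int[mu2]_x g x = \int[nonatomic_part mu2]_x g x)%E.
  move=> mg g0 gN; rewrite ge0_integral_mrestr// [RHS]integral_mkcond.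
  apply: eq_integral => x _; rewrite patchE; case: ifPn => // /negP xP.
  by apply: gN => Nx; apply: xP; rewrite inE; exact: NP2.
pose rho s (x : borelC R) : R[i] := (\1_N x * h x `^ s)%:C%C.
have mrho s : measurable_fun setT (rho s : borelC R -> borelC R).
  apply: measurable_real_complex; apply: measurable_funM.
    exact: measurable_indic.
  by apply: (@measurableT_comp _ _ _ _ _ _ (@powR R ^~ s)).
have rhop s x : normc (rho s x) `^ p = \1_N x * h x `^ (s * p).
  rewrite normc_real ger0_norm ?mulr_ge0 ?powR_ge0// powRM ?powR_ge0// -powRrM.
  by rewrite indicE; case: (_ \in _); rewrite ?powR1 ?powR0 ?gt_eqF.
have e1 : p^-1 * p = 1 by rewrite mulVf ?gt_eqF.
have mint (u : borelC R -> R) (g : borelC R -> \bar R) :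
    measurable_fun setT u -> measurable_fun setT g ->
    measurable_fun setT (fun x => ((\1_N x * u x)%:E * g x)%E).
  move=> mu_ mg; apply: emeasurable_funM => //; apply/measurable_EFinP.
  by apply: measurable_funM => //; exact: measurable_indic.
have leN mu (g : borelC R -> \bar R) : measurable_fun setT g ->
    (forall x, 0 <= g x)%E ->
    (\int[mu]_x ((\1_N x)%:E * g x) <= \int[mu]_x g x)%E.
  move=> mg g0; apply: ge0_le_integral => //.
  - by move=> x _; rewrite mule_ge0// lee_fin.
  - by apply: emeasurable_funM => //; apply/measurable_EFinP; exact: measurable_indic.
  move=> x _; rewrite -[leRHS]mul1e lee_wpmul2r// lee_fin indicE.
  by case: (_ \in _).
have mN1g (g : borelC R -> \bar R) : measurable_fun setT g ->
    measurable_fun setT (fun x => (\1_N x)%:E * g x)%E.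
  by move=> mg; apply: emeasurable_funM => //; apply/measurable_EFinP; exact: measurable_indic.
have N1g0 (g : borelC R -> \bar R) x : (forall x, 0 <= g x)%E ->
    (0 <= (\1_N x)%:E * g x)%E.
  by move=> g0; rewrite mule_ge0// lee_fin.
have w1 : wdom (p := p) mu2 mu1 (rho p^-1) id.
  split=> //; exists 1 => // g mg g0; rewrite mul1e.
  under eq_integral do rewrite rhop e1 powRr1//.
  rewrite nu2E.
  - rewrite (_ : (fun x => _) = fun x => ((h x)%:E * ((\1_N x)%:E * g x))%E); last first.
      by apply/funext => x; rewrite muleA -EFinM mulrC.
    rewrite hint; [|exact: mN1g|by move=> ?; exact: N1g0].
    rewrite -nu1E; [exact: leN|exact: mN1g|by move=> ?; exact: N1g0|].
    by move=> x Nx; rewrite indicE memNset// mul0e.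
  - exact: mint.
  - by move=> x; rewrite mule_ge0// lee_fin mulr_ge0.
  - by move=> x Nx; rewrite indicE memNset// mul0r mul0e.
have w2 : wdom (p := p) mu1 mu2 (rho (- p^-1)) id.
  split=> //; exists 1 => // g mg g0; rewrite mul1e.
  under eq_integral do rewrite rhop mulNr e1 powR_inv1//.
  have mhV : measurable_fun setT (fun x => (h x)^-1).
    rewrite (_ : (fun x => _) = fun x => h x `^ (-1)).
      by apply: (@measurableT_comp _ _ _ _ _ _ (@powR R ^~ (-1))).
    by apply/funext => x; rewrite powR_inv1.
  have g10 x : (0 <= (\1_N x * (h x)^-1)%:E * g x)%E.
    by rewrite mule_ge0// lee_fin mulr_ge0// invr_ge0.
  rewrite nu1E//; last 2 first.
  - exact: mint.
  - by move=> x Nx; rewrite indicE memNset// mul0r mul0e.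
  rewrite -hint//; last exact: mint.
  apply: (@le_trans _ _ (\int[nonatomic_part mu2]_x ((\1_N x)%:E * g x))%E).
    apply: ge0_le_integral => //.
    - by move=> x _; rewrite mule_ge0// lee_fin.
    - by apply: emeasurable_funM; [exact/measurable_EFinP|exact: mint].
    - exact: mN1g.
    move=> x _; rewrite muleA -EFinM lee_wpmul2r// lee_fin mulrCA ler_piMr//.
    by have [->|hx] := eqVneq (h x) 0; rewrite ?mul0r// mulfV.
  rewrite -nu2E; [exact: leN|exact: mN1g|by move=> ?; exact: N1g0|].
  by move=> x Nx; rewrite indicE memNset// mul0e.
have rhoN s x : ~ N x -> rho s x = 0.
  by move=> Nx; rewrite /rho indicE memNset// mul0r rmorph0.
have rhoM x : N x -> h x != 0 -> rho p^-1 x * rho (- p^-1) x = 1.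
  move=> Nx hx; rewrite /rho indicE mem_set// !mul1r -rmorphM/= -powRD.
    by rewrite subrr powRr0.
  by rewrite hx implybT.
(* Where h vanishes the two weights are not inverse to each other. This set is null for the first
   nonatomic part since h is its density, hence null for the second by the other absolute
   continuity. *)
pose B := N `&` [set x | h x = 0].
have mB : measurable B.
  apply: measurableI => //; rewrite -[X in measurable X]setTI.
  exact: (mh measurableT [set 0]).
have nu1B : nonatomic_part mu1 B = 0%E.
  rewrite -[LHS]mule1 -[X in (_ * X)%E]/(1%:E) muleC -integral_cst//.
  rewrite integral_mkcond.
  rewrite -hint.
  - apply: integral0_eq => x _; rewrite patchE; case: ifPn; last by rewrite mule0.
    by move=> /set_mem[_ ->]; rewrite mul0e.
  - apply/(measurable_restrictT _ mB); exact: measurable_cst.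
  - by move=> x; rewrite patchE; case: ifP => //; rewrite lee_fin.
have nu2B : nonatomic_part mu2 B = 0%E.
  by have /null_content_dominatesP := nu21; apply.
have mu1B : mu1 B = 0%E.
  rewrite -nu1B /= /mrestr (setIidl _)// => x [/NP1].
  by [].
have mu2B : mu2 B = 0%E.
  by rewrite -nu2B /= /mrestr (setIidl _)// => x [/NP2].
exists (rho p^-1), (rho (- p^-1)); split => //.
- by move=> x Nx; rewrite !rhoN.
- exists B; split => // x /= h1; apply: contrapT => h2; apply: h1 => Nx.
  by rewrite mulrC rhoM//; apply/eqP => hx; apply: h2.
- exists B; split => // x /= h1; apply: contrapT => h2; apply: h1 => Nx.
  by rewrite rhoM//; apply/eqP => hx; apply: h2.
Qed.

End densities.

(** * The atomic part as a sequence space *)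

Section atomic_coordinates.
Context {R : realType} {p : R} (p1 : 1 <= p).
Let p_gt0 : 0 < p. Proof. exact: lt_le_trans p1. Qed.
Variables (mu : {finite_measure set borelC R -> \bar R}) (D : set nat).
Variables (a : nat -> R[i]) (e : borelC R -> nat).
Hypothesis me : measurable_fun setT e.
Hypothesis eP : forall x, point_masses mu x -> D (e x) /\ a (e x) = x.
Hypothesis aD : forall n, D n -> point_masses mu (a n) /\ e (a n) = n.

Let P := point_masses mu.
Let M n := fine (mu [set a n]).

Let mP : measurable P. Proof. exact: measurable_point_masses. Qed.

Let muE n : mu [set a n] = (M n)%:E.
Proof. by rewrite /M fineK// fin_num_measure//; exact: measurable_set1C. Qed.

Let M_gt0 n : D n -> 0 < M n.
Proof.
move=> /aD[Pa _]; rewrite fine_gt0// Pa/= ltey_eq fin_num_measure//.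
exact: measurable_set1C.
Qed.

Definition atom_syn_weight (x : borelC R) : R[i] :=
  (\1_P x * M (e x) `^ (- p^-1))%:C%C.

Definition atom_ana_weight (n : nat) : R[i] := (M n `^ p^-1)%:C%C.

Lemma wdom_atom_syn : wdom (p := p) mu (cnt D) atom_syn_weight e.
Proof.
apply: wdom_fibers => //.
  apply: measurable_real_complex; apply: measurable_funM.
    exact: measurable_indic.
  by apply: (@measurableT_comp _ _ _ _ _ _ (fun n => M n `^ (- p^-1))).
move=> n.
have mF : measurable (e @^-1` [set n]) by rewrite -[X in measurable X]setTI; exact: me.
have wE x : normc (atom_syn_weight x) `^ p = \1_P x / M (e x).
  rewrite normc_real ger0_norm ?mulr_ge0 ?powR_ge0// powRM ?powR_ge0// -powRrM.
  rewrite mulNr mulVf ?gt_eqF// powR_inv1; last first.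
    by rewrite fine_ge0.
  by rewrite indicE; case: (_ \in _); rewrite ?powR1 ?powR0 ?gt_eqF.
have [Dn|nDn] := pselect (D n); last first.
  rewrite integral0_eq ?lee_fin// => x /= xn.
  rewrite wE indicE memNset ?mul0r// => /eP[].
  by rewrite xn.
apply: (@le_trans _ _ (\int[mu]_(x in [set a n]) (M n)^-1%:E)%E); last first.
  rewrite integral_cst; last exact: measurable_set1C.
  rewrite [X in (_ * X)%E](_ : _ = (M n)%:E); last exact: muE.
  by rewrite -EFinM mulVf ?gt_eqF ?M_gt0// indicE mem_set.
rewrite integral_mkcond [leRHS]integral_mkcond.
have mw : measurable_fun setT (fun x => (normc (atom_syn_weight x) `^ p)%:E).
  apply: measurable_normc_powR.
  apply: measurable_real_complex; apply: measurable_funM.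
    exact: measurable_indic.
  by apply: (@measurableT_comp _ _ _ _ _ _ (fun n => M n `^ (- p^-1))).
apply: ge0_le_integral => //.
- by move=> x _; rewrite patchE; case: ifP => // _; rewrite lee_fin powR_ge0.
- by apply/(measurable_restrictT _ mF); exact: measurable_funTS.
- apply/(measurable_restrictT _ (measurable_set1C (a n))).
  exact: measurable_cst.
move=> x _; rewrite !patchE; case: ifPn => [/set_mem /= xn|_]; last first.
  by case: ifP => // _; rewrite lee_fin invr_ge0 ltW// M_gt0.
rewrite wE indicE; case: (boolP (x \in P)) => [/set_mem Px|_]; last first.
  by rewrite mul0r; case: ifP => // _; rewrite lee_fin invr_ge0 ltW// M_gt0.
by rewrite mul1r xn mem_set//= -xn; have [_ ->] := eP Px.
Qed.

Lemma wdom_atom_ana : wdom (p := p) (cnt D) mu atom_ana_weight a.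
Proof.
apply: (wdom_points (B := 1)) => //.
- by move=> n; exact: measurable_set1C.
- move=> i j /set_mem Di /set_mem Dj aij.
  by have [_ <-] := aD Di; have [_ <-] := aD Dj; rewrite aij.
move=> n Dn; rewrite mul1e normc_real ger0_norm ?powR_ge0// -powRrM mulVf ?gt_eqF//.
by rewrite powRr1; [rewrite -muE|exact/ltW/M_gt0].
Qed.

Lemma atom_syn_weightN x : ~ P x -> atom_syn_weight x = 0.
Proof. by move=> Px; rewrite /atom_syn_weight indicE memNset// mul0r rmorph0. Qed.

Lemma atom_weightK x : P x -> atom_syn_weight x * atom_ana_weight (e x) = 1.
Proof.
move=> Px; rewrite /atom_syn_weight /atom_ana_weight indicE mem_set// mul1r.
have [De _] := eP Px.
rewrite -rmorphM/= -powRD; first by rewrite addNr powRr0.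
by rewrite (gt_eqF (M_gt0 De)) implybT.
Qed.

Lemma point_masses_supp x : P x -> supp mu x.
Proof.
move=> Px U oU Ux; apply: lt_le_trans Px _; apply: le_measure; rewrite ?inE.
- exact: measurable_set1C.
- exact: open_measurableC.
- by move=> _ ->.
Qed.

Lemma wdom_atom_diag : compact (supp mu) -> wdom (p := p) (cnt D) (cnt D) a id.
Proof.
move=> cmu; have [B _ hB] := compact_normc_bounded cmu.
apply: (wdom_mul p1 (B := B)) => //; apply/cnt_ae => n /aD[Pa _].
by apply: hB; exact: point_masses_supp.
Qed.

End atomic_coordinates.

(** * Exchange of the atomic parts *)

Section transfer.
Context {R : realType} {p : R} (p_gt1 : 1 < p).
Let p1 : 1 <= p := ltW p_gt1.

(** An atom of mu' that is not one of mu is a mu-null point, and there are countably many of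
    them. *)
Lemma point_masses_ae (mu mu' : {finite_measure set borelC R -> \bar R}) :
  {ae mu, forall x, point_masses mu' x -> point_masses mu x}.
Proof.
have [D [a [e [me eP aD]]]] := enum_point_masses mu'.
pose F n : set (borelC R) :=
  if (n \in D) && (mu [set a n] == 0%E) then [set a n] else set0.
apply: (@negligibleS _ _ _ _ (\bigcup_n F n)).
  move=> x /= /not_implyP[P'x Px]; exists (e x) => //.
  have [De ae] := eP x P'x; rewrite /F mem_set//= ae.
  case: eqP => // h; exfalso; apply: Px; rewrite /point_masses/= lt0e measure_ge0 andbT.
  exact/eqP.
apply: negligible_bigcup => n; rewrite /F; case: ifPn => [/andP[_ /eqP h]|_].
  by exists [set a n]; split => //; exact: measurable_set1C.
exact: negligible_set0.
Qed.

Variables (mu1 mu2 : {finite_measure set borelC R -> \bar R}).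
Variables (D1 D2 : set nat) (a1 a2 : nat -> R[i]) (e1 e2 : borelC R -> nat).
Hypothesis me1 : measurable_fun setT e1.
Hypothesis eP1 : forall x, point_masses mu1 x -> D1 (e1 x) /\ a1 (e1 x) = x.
Hypothesis aD1 : forall n, D1 n -> point_masses mu1 (a1 n) /\ e1 (a1 n) = n.
Hypothesis me2 : measurable_fun setT e2.
Hypothesis eP2 : forall x, point_masses mu2 x -> D2 (e2 x) /\ a2 (e2 x) = x.
Hypothesis aD2 : forall n, D2 n -> point_masses mu2 (a2 n) /\ e2 (a2 n) = n.
Variables rho rho' : borelC R -> R[i].
Let N : set (borelC R) := ~` (point_masses mu1 `|` point_masses mu2).
Hypothesis wr : wdom (p := p) mu2 mu1 rho id.
Hypothesis wr' : wdom (p := p) mu1 mu2 rho' id.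
Hypothesis rN : forall x, ~ N x -> rho x = 0 /\ rho' x = 0.
Hypothesis rr' : {ae mu1, forall x, N x -> rho' x * rho x = 1}.

Let b1 := atom_syn_weight (p := p) mu1 a1 e1.
Let b2 := atom_syn_weight (p := p) mu2 a2 e2.
Let c1 := atom_ana_weight (p := p) mu1 a1.
Let c2 := atom_ana_weight (p := p) mu2 a2.
Let wb1 : wdom (p := p) mu1 (cnt D1) b1 e1. Proof. exact: wdom_atom_syn. Qed.
Let wb2 : wdom (p := p) mu2 (cnt D2) b2 e2. Proof. exact: wdom_atom_syn. Qed.
Let wc1 : wdom (p := p) (cnt D1) mu1 c1 a1. Proof. exact: (wdom_atom_ana p1 aD1). Qed.
Let wc2 : wdom (p := p) (cnt D2) mu2 c2 a2. Proof. exact: (wdom_atom_ana p1 aD2). Qed.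

(** Both spaces consist of a nonatomic part, the atoms of mu1 and the atoms of mu2. Here the
    nonatomic parts are matched by the density, the coordinates in [D2] become atoms of mu2, and the
    atoms of mu1 become coordinates in [D1]. *)
Definition transfer (x : Lp mu1 p1 * Lp (cnt D2) p1) : Lp mu2 p1 * Lp (cnt D1) p1 :=
  (wc p1 mu2 mu1 rho id x.1 + wc p1 mu2 (cnt D2) b2 e2 x.2,
   wc p1 (cnt D1) mu1 c1 a1 x.1).


(** This is [transfer] with the two measures exchanged, so that [transferK], used twice, yields both
    inverse laws. *)
Definition transfer_inv (y : Lp mu2 p1 * Lp (cnt D1) p1) : Lp mu1 p1 * Lp (cnt D2) p1 :=
  (wc p1 mu1 mu2 rho' id y.1 + wc p1 mu1 (cnt D1) b1 e1 y.2,
   wc p1 (cnt D2) mu2 c2 a2 y.1).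

Lemma transfer_oper : oper transfer.
Proof.
apply: oper_pair; last exact: oper_comp (wc_oper p1 wc1) (oper_fst _ _).
apply: oper_add; first exact: oper_comp (wc_oper p1 wr) (oper_fst _ _).
exact: oper_comp (wc_oper p1 wb2) (oper_snd _ _).
Qed.

Let rho_b2 x : rho' x * b2 x = 0.
Proof.
have [Px|Px] := pselect (point_masses mu2 x); last first.
  by rewrite /b2 atom_syn_weightN ?mulr0.
by have [_ ->] := rN (x := x) (fun Nx => Nx (or_intror Px)); rewrite mul0r.
Qed.

Lemma transferK : cancel transfer transfer_inv.
Proof.
case=> f g; rewrite /transfer /transfer_inv /=; congr pair.
  rewrite (operD (wc_oper p1 wr')); apply/Lp_eqP.
  have h1 := wc_wc f wr' wr.
  have h2 := wc_wc g wr' wb2.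
  have h3 := wc_wc f wb1 wc1.
  have h4 := Lp_addE (wc p1 mu1 mu2 rho' id (wc p1 mu2 mu1 rho id f))
    (wc p1 mu1 mu2 rho' id (wc p1 mu2 (cnt D2) b2 e2 g)).
  have h5 := Lp_addE (wc p1 mu1 mu2 rho' id (wc p1 mu2 mu1 rho id f) +
    wc p1 mu1 mu2 rho' id (wc p1 mu2 (cnt D2) b2 e2 g))
    (wc p1 mu1 (cnt D1) b1 e1 (wc p1 (cnt D1) mu1 c1 a1 f)).
  have h6 := point_masses_ae mu1 mu2.
  apply: filterS2 (filterI (filterI h1 h2) (filterI h3 h4))
    (filterI h5 (filterI h6 rr')) => x [[k1 k2] [k3 k4]] [k5 [k6 k7]].
  rewrite k5 k4 k1 k2 k3 [rho' x * (b2 x * _)]mulrA rho_b2 mul0r addr0.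
  have [Px|Px] := pselect (point_masses mu1 x).
    have [_ ->] := rN (x := x) (fun Nx => Nx (or_introl Px)).
    by rewrite mul0r add0r mulrA (atom_weightK eP1 aD1 Px) mul1r; have [_ ->] := eP1 Px.
  rewrite /b1 atom_syn_weightN// mul0r addr0 mulrA k7 ?mul1r//.
  by case=> // /k6.
apply/lD_eqP => n Dn; rewrite (operD (wc_oper p1 wc2)) lD_addE//.
have /cnt_ae -> // := wc_wc f wc2 wr.
have /cnt_ae -> // := wc_wc g wc2 wb2.
have [Pa ea] := aD2 Dn.
have [-> _] := rN (x := a2 n) (fun Nx => Nx (or_intror Pa)).
have bc : b2 (a2 n) * c2 n = 1 by have := atom_weightK (p := p) eP2 aD2 Pa; rewrite ea.
by rewrite mul0r mulr0 add0r mulrA [c2 n * _]mulrC bc mul1r ea.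
Qed.

Variables (cmu1 : compact (supp mu1)) (cmu2 : compact (supp mu2)).

Lemma transfer_intertwine x :
  let y := transfer x in
  (mult_op p1 cmu2 y.1, wc p1 (cnt D1) (cnt D1) a1 id y.2) =
  transfer (mult_op p1 cmu1 x.1, wc p1 (cnt D2) (cnt D2) a2 id x.2).
Proof.
case: x => f g /=; rewrite /transfer /=; congr pair.
  rewrite (operD (mult_op_oper p1 cmu2)); apply/Lp_eqP.
  have h1 := @mult_op_ae R p p1 mu2 cmu2 (wc p1 mu2 mu1 rho id f).
  have h2 := @mult_op_ae R p p1 mu2 cmu2 (wc p1 mu2 (cnt D2) b2 e2 g).
  have h3 := wc_ae wr f.
  have h4 := wc_ae wb2 g.
  have h5 := wc_ae wr (mult_op p1 cmu1 f).
  have h6 := wdom_ae wr (@mult_op_ae R p p1 mu1 cmu1 f).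
  have h7 := wc_wc g wb2 (wdom_atom_diag p1 aD2 cmu2).
  have h8 := Lp_addE (mult_op p1 cmu2 (wc p1 mu2 mu1 rho id f))
    (mult_op p1 cmu2 (wc p1 mu2 (cnt D2) b2 e2 g)).
  have h9 := Lp_addE (wc p1 mu2 mu1 rho id (mult_op p1 cmu1 f))
    (wc p1 mu2 (cnt D2) b2 e2 (wc p1 (cnt D2) (cnt D2) a2 id g)).
  apply: filterS3 (filterI (filterI h1 h2) (filterI h3 h4))
    (filterI (filterI h5 h6) h7) (filterI h8 h9).
  move=> x [[k1 k2] [k3 k4]] [[k5 k6] k7] [-> ->].
  rewrite k1 k2 k3 k4 k5 k7; congr (_ + _).
    by case: k6 => -> /=; [rewrite !mul0r mulr0|rewrite mulrCA].
  have [Px|Px] := pselect (point_masses mu2 x).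
    by have [_ ->] := eP2 Px; rewrite mulrCA.
  by rewrite /b2 atom_syn_weightN// !mul0r mulr0.
apply/lD_eqP => n Dn.
have /cnt_ae -> // := wc_wc f (wdom_atom_diag p1 aD1 cmu1) wc1.
have /cnt_ae -> // := wc_ae wc1 (mult_op p1 cmu1 f).
have /cnt_ae/(_ n Dn) := wdom_ae wc1 (@mult_op_ae R p p1 mu1 cmu1 f).
by case=> ->; [rewrite !mul0r mulr0|rewrite mulrCA].
Qed.

End transfer.

Lemma csim_of_equivalent (R : realType) (p : R) (p_gt1 : 1 < p)
    (mu1 mu2 : {finite_measure set borelC R -> \bar R})
    (cmu1 : compact (supp mu1)) (cmu2 : compact (supp mu2)) :
  ~ finite_set (supp mu1) -> ~ finite_set (supp mu2) ->
  equivalent_measures (nonatomic_part mu1) (nonatomic_part mu2) ->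
  limit_point (supp mu1) = limit_point (supp mu2) ->
  csim (mult_op (ltW p_gt1) cmu1 : Lp mu1 (ltW p_gt1) -> Lp mu1 (ltW p_gt1))
    (mult_op (ltW p_gt1) cmu2 : Lp mu2 (ltW p_gt1) -> Lp mu2 (ltW p_gt1)).
Proof.
move=> imu1 imu2 nu12 L12; set p1 := ltW p_gt1.
(* M_mu absorbs diag(w) for the limit points w nearest to the atoms a of mu', and diag(a - w) is
   compact. The resulting chain is M_1 ~ M_1 (+) diag(a2) ~ M_2 (+) diag(a1) ~ M_2. *)
have main mu (cmu : compact (supp mu)) mu' (cmu' : compact (supp mu'))
    (D : set nat) (a : nat -> R[i]) (e : borelC R -> nat) :
    limit_point (supp mu) = limit_point (supp mu') -> ~ finite_set (supp mu') ->
    (forall n, D n -> point_masses mu' (a n) /\ e (a n) = n) ->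
    csim (mult_op p1 cmu : Lp mu p1 -> Lp mu p1)
      (fun x : Lp mu p1 * Lp (cnt D) p1 =>
        (mult_op p1 cmu x.1, wc p1 (cnt D) (cnt D) a id x.2)).
  move=> LL imu' aD.
  have ia : {in D &, injective a}.
    move=> i j /set_mem Di /set_mem Dj aij.
    by have [_ <-] := aD _ Di; have [_ <-] := aD _ Dj; rewrite aij.
  have [|w wL aw] := approx_limit_points cmu' imu' ia.
    by move=> n /aD[Pa _]; exact: point_masses_supp.
  have wL' k : limit_point (supp mu) (w k) by rewrite LL.
  apply: (csim_trans (@absorb R p p_gt1 mu cmu D w wL')).
  apply: csim_prod; apply: csim_compact.
  have [Bt hBt] := limit_point_bounded cmu.
  have ww : wdom (p := p) (cnt D) (cnt D) w id.
    by apply: (wdom_mul p1 (B := Bt)) => //; apply/cnt_ae => n _; exact: hBt.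
  have wa := wdom_atom_diag p1 aD cmu'.
  have := compact_diag p1 (D := D) (eta := fun n => a n - w n) aw.
  congr compact_operator; apply/funext => X; apply/lD_eqP => n Dn.
  have /cnt_ae -> // := wc_ae (wdom_diag p1 aw) X.
  rewrite lD_subE//.
  have /cnt_ae -> // := wc_ae wa X.
  have /cnt_ae -> // := wc_ae ww X.
  by rewrite mulrBl.
have [D1 [a1 [e1 [me1 eP1 aD1]]]] := enum_point_masses mu1.
have [D2 [a2 [e2 [me2 eP2 aD2]]]] := enum_point_masses mu2.
have [rho [rho' [wr wr' rN rr' r'r]]] := density_pair p1 nu12.
apply: (csim_trans (main _ cmu1 _ cmu2 _ _ _ L12 imu2 aD2)).
apply: csim_sym.
apply: (csim_trans (main _ cmu2 _ cmu1 _ _ _ (esym L12) imu1 aD1)).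
apply: csim_sym.
have rN' x : ~ (~` (point_masses mu2 `|` point_masses mu1)) x ->
    rho' x = 0 /\ rho x = 0.
  by rewrite setUC => /rN[].
have r'r' : {ae mu2, forall x, (~` (point_masses mu2 `|` point_masses mu1)) x ->
    rho x * rho' x = 1}.
  by apply: filterS r'r => x; rewrite setUC.
exact: (csim_exact (transfer_oper p_gt1 aD1 me2 eP2 aD2 wr)
  (transfer_oper p_gt1 aD2 me1 eP1 aD1 wr')
  (transferK me1 eP1 aD1 me2 eP2 aD2 wr wr' rN rr')
  (transferK me2 eP2 aD2 me1 eP1 aD1 wr' wr rN' r'r')
  (transfer_intertwine aD1 me2 eP2 aD2 wr cmu1 cmu2)).
Qed.

(** * Compact operators and averages *)

Section Lp_norm_theory.
Context {R : realType} {p : R} (p1 : 1 <= p).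
Context d {T : measurableType d} {m : {measure set T -> \bar R}}.
Implicit Types F G : Lp m p1.

Lemma Lp_ler_normD F G : Lp_norm (F + G) <= Lp_norm F + Lp_norm G.
Proof. by have := ler_normD F G; rewrite !Lp_normE -rmorphD lecR. Qed.

Lemma Lp_normN F : Lp_norm (- F) = Lp_norm F.
Proof. by have := normrN F; rewrite !Lp_normE => -[]. Qed.

Lemma Lp_ler_normB F G : Lp_norm (F - G) <= Lp_norm F + Lp_norm G.
Proof. by rewrite -(Lp_normN G) Lp_ler_normD. Qed.

Lemma Lp_ler_distD F G : Lp_norm F <= Lp_norm (F - G) + Lp_norm G.
Proof. by rewrite -{1}(subrK G F) Lp_ler_normD. Qed.

Lemma Lp_norm_natmul F n : Lp_norm (F *+ n) = Lp_norm F *+ n.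
Proof.
have := normrMn F n; rewrite !Lp_normE -(raddfMn (real_complex R)) => -[].
by [].
Qed.

Lemma Lp_norm0 : Lp_norm (0 : Lp m p1) = 0.
Proof. by have := normr0 (Lp m p1); rewrite Lp_normE => -[]. Qed.

Lemma Lp_norm_sum (I : Type) (r : seq I) (F : I -> Lp m p1) :
  Lp_norm (\sum_(i <- r) F i) <= \sum_(i <- r) Lp_norm (F i).
Proof.
elim: r => [|i r IH]; first by rewrite !big_nil Lp_norm0.
by rewrite !big_cons (le_trans (Lp_ler_normD _ _))// lerD2l.
Qed.

Lemma Lp_norm_ae_le F G : {ae m, forall x, normc (F x) <= normc (G x)} ->
  Lp_norm F <= Lp_norm G.
Proof.
move=> FG; apply: Lp_norm_le; first exact: Lp_norm_ge0.
by rewrite Lp_norm_pint; apply: (le_pint p1) => //; exact: LfunC_measurable.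
Qed.

End Lp_norm_theory.

Section null_sequences.
Context {R : realType} {p : R} (p1 : 1 <= p).

Lemma oper_Lp_bounded d {T : measurableType d} {m : {measure set T -> \bar R}}
    d' {T' : measurableType d'} {m' : {measure set T' -> \bar R}}
    (A : Lp m p1 -> Lp m' p1) : oper A ->
  exists2 M : R, 0 < M & forall X, Lp_norm (A X) <= M * Lp_norm X.
Proof.
move=> /oper_bounded[M M0 AM].
have [r r0 Mr] : exists2 r : R, 0 < r & M = (r%:C)%C.
  move: M0; rewrite ltcE/= => /andP[/eqP eI eR].
  by exists (complex.Re M) => //; case: (M) eI => ? ? /= ->.
exists r => // X; have := AM X.
by rewrite Mr !Lp_normE -rmorphM lecR.
Qed.

Definition null_seq d {T : measurableType d} {m : {measure set T -> \bar R}}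
    (u : nat -> Lp m p1) :=
  forall e, 0 < e -> exists n0, forall n, (n0 <= n)%N -> Lp_norm (u n) <= e.

Lemma null_seq_ext d {T : measurableType d} {m : {measure set T -> \bar R}}
  (u v : nat -> Lp m p1) : (forall n, u n = v n) -> null_seq u -> null_seq v.
Proof. by move=> uv nu e /nu[n0 h]; exists n0 => n /h; rewrite uv. Qed.

Lemma null_seqD d {T : measurableType d} {m : {measure set T -> \bar R}}
    (u v : nat -> Lp m p1) : null_seq u -> null_seq v ->
  null_seq (fun n => u n + v n).
Proof.
move=> nu nv e e0; have e2 : 0 < e / 2 by rewrite divr_gt0.
have [n1 h1] := nu _ e2; have [n2 h2] := nv _ e2.
exists (maxn n1 n2) => n; rewrite geq_max => /andP[/h1 k1 /h2 k2].
by rewrite (le_trans (Lp_ler_normD _ _))// [leRHS]splitr lerD.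
Qed.

Lemma null_seq_oper d {T : measurableType d} {m : {measure set T -> \bar R}}
    d' {T' : measurableType d'} {m' : {measure set T' -> \bar R}}
    (A : Lp m p1 -> Lp m' p1) (u : nat -> Lp m p1) : oper A ->
  null_seq u -> null_seq (fun n => A (u n)).
Proof.
move=> /oper_Lp_bounded[M M0 AM] nu e e0.
have [|n0 h] := nu (e / M); first by rewrite divr_gt0.
exists n0 => n /h k; rewrite (le_trans (AM _))// mulrC -ler_pdivlMr//.
Qed.

Lemma null_seqN d {T : measurableType d} {m : {measure set T -> \bar R}}
    (u : nat -> Lp m p1) : null_seq u -> null_seq (fun n => - u n).
Proof. by move=> nu e /nu[n0 h]; exists n0 => n /h; rewrite Lp_normN. Qed.

Lemma null_seqB d {T : measurableType d} {m : {measure set T -> \bar R}}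
    (u v : nat -> Lp m p1) : null_seq u -> null_seq v ->
  null_seq (fun n => u n - v n).
Proof. by move=> nu /null_seqN; exact: null_seqD. Qed.

Lemma infinite_uniq_seq (S : set nat) N : ~ finite_set S ->
  exists s : seq nat, [/\ uniq s, size s = N & forall i, i \in s -> S i].
Proof.
move=> iS; have [B BS NB] := infinite_set_fset N iS.
exists (take N (finmap.enum_fset B)); split.
- by apply: take_uniq; exact: finmap.fset_uniq.
- by rewrite size_takel.
- by move=> i /mem_take; exact: BS.
Qed.

(* An analogue, without duality, of the fact that compact operators map weakly
   null sequences to null sequences: averages of [x] tend to zero uniformly. *)
Definition averages_null d {T : measurableType d}
    {m : {measure set T -> \bar R}} (x : nat -> Lp m p1) :=
  forall e, 0 < e -> exists2 N, (0 < N)%N & forall s : seq nat, uniq s ->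
    size s = N -> Lp_norm (\sum_(i <- s) x i) <= N%:R * e.

(** If infinitely many [C (x n)] stayed large, infinitely many of them would gather near one point
    y, again by compactness. Averages of these would stay near y, yet they are small, so y would be
    too small. *)
Lemma compact_averages_null d {T : measurableType d}
    {m : {measure set T -> \bar R}} d' {T' : measurableType d'}
    {m' : {measure set T' -> \bar R}} (C : Lp m p1 -> Lp m' p1)
    (x : nat -> Lp m p1) (B : R) : compact_operator C -> 0 < B ->
  (forall n, Lp_norm (x n) <= B) -> averages_null x ->
  null_seq (fun n => C (x n)).
Proof.
move=> cC B0 xB ax e e0; apply: contrapT => /forallNP h.
pose S := [set n | e < Lp_norm (C (x n))].
have iS : ~ finite_set S.
  move=> /finite_fsetP[X SX].
  apply: (h (\max_(i <- finmap.enum_fset X) i).+1) => n Xn.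
  rewrite leNgt; apply/negP => en.
  have : S n by []. rewrite SX /= => nX.
  have := @leq_bigmax_seq _ (finmap.enum_fset X) xpredT id n nX isT.
  by rewrite leqNgt Xn.
have [M M0 CM] := oper_Lp_bounded (compact_oper cC).
have [K cK KC] := compact_operator_image
  (compact_operator_compr cC (oper_scale (B%:C)%C (oper_id (Lp m p1)))).
have KCx n : K (C (x n)).
  have := KC ((B^-1)%:C%C *: x n); rewrite scalerA -rmorphM/= divff ?gt_eqF// scale1r.
  apply; rewrite normrZ Lp_normE normr_normc normc_real -rmorphM/=.
  rewrite -[1]/((1%:C)%C : R[i]) lecR ger0_norm ?invr_ge0 ?(ltW B0)//.
  by rewrite ler_pdivrMl// mulr1.
(* Sets containing all but finitely many elements of [S]: a cluster point along this filter has
   infinitely many [C (x n)] with n in [S] in each neighbourhood. *)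
pose F : set_system nat := fun A => finite_set (S `\` A).
have FF : ProperFilter F.
  apply: Build_ProperFilter; first by rewrite /F setD0.
  split.
  - by rewrite /F setDT.
  - by move=> P Q; rewrite /F setDIr => fP fQ; rewrite finite_setU.
  - by move=> P Q PQ; apply: sub_finite_set; exact: setDS.
have FK : ((C \o x) @ F) K.
  by apply: (@sub_finite_set _ _ set0) => // n [_]; apply; exact: KCx.
have [y [_ yF]] := cK _ _ FK.
have e4 : 0 < e / 4 by rewrite divr_gt0.
pose U := [set z : Lp m' p1 | Lp_norm (z - y) < e / 4].
have Uy : nbhs y U.
  apply/nbhs_ballP; exists ((e / 4)%:C)%C => /=; first by rewrite ltcR.
  move=> z; rewrite -ball_normE /ball_/= Lp_normE ltcR /U/= => h'.
  by rewrite -Lp_normN opprB.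
pose S' := S `&` [set n | U (C (x n))].
have iS' : ~ finite_set S'.
  move=> fS'; have FA : F (S `\` S').
    by rewrite /F setDD; apply: sub_finite_set fS' => n [].
  have [z [[n [Sn nS'] <-] Uz]] : ((C \o x) @` (S `\` S')) `&` U !=set0.
    apply: yF => //; rewrite /fmap /=; apply: filterS FA.
    by move=> n Sn; exists n.
  by apply: nS'; split.
(* With this tolerance the average of N images has norm at most e / 4 and lies within e / 4 of y. So
   y has norm at most e / 2, although it is within e / 4 of a vector of norm above e. *)
have [|N N0 hN] := ax (e / (4 * M)); first by rewrite divr_gt0// mulr_gt0.
have [s [us sN sS']] := infinite_uniq_seq N iS'.
have h1 := hN s us sN.
have Nr : 0 < N%:R :> R by rewrite ltr0n.
have h2 : Lp_norm (\sum_(i <- s) C (x i)) <= N%:R * (e / 4).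
  rewrite -(oper_sum (compact_oper cC)); apply: (le_trans (CM _)).
  apply: (@le_trans _ _ (M * (N%:R * (e / (4 * M))))); first by rewrite ler_wpM2l// ltW.
  by rewrite le_eqVlt; apply/orP; left; apply/eqP; field; rewrite gt_eqF.
have h3 : Lp_norm (\sum_(i <- s) (C (x i) - y)) <= N%:R * (e / 4).
  apply: (le_trans (Lp_norm_sum _ _)).
  apply: (@le_trans _ _ (\sum_(i <- s) e / 4)).
    rewrite big_seq [leRHS]big_seq; apply: ler_sum => i /sS'[_]; exact: ltW.
  by rewrite big_const_seq count_predT sN iter_addr_0 mulr_natl.
have h4 : Lp_norm (y *+ N) <= N%:R * (e / 2).
  have -> : y *+ N = \sum_(i <- s) C (x i) - \sum_(i <- s) (C (x i) - y).
    by rewrite sumrB opprB addrC subrK big_const_seq count_predT sN iter_addr_0.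
  by rewrite (le_trans (Lp_ler_normB _ _))//; lra.
have h5 : Lp_norm y <= e / 2.
  by move: h4; rewrite Lp_norm_natmul -[Lp_norm y *+ N]mulr_natl ler_pM2l.
have [n [Sn Un]] : S' !=set0.
  apply: contrapT => /set0P/negP; rewrite negbK => /eqP S0.
  by apply: iS'; rewrite S0.
have := Lp_ler_distD (C (x n)) y.
move: Sn Un; rewrite /S /U /= => k1 k2 k3; lra.
Qed.

End null_sequences.

(** * Cluster points of the supports *)

Section limit_points_similarity.
Context {R : realType} {p : R} (p_gt1 : 1 < p).
Let p1 : 1 <= p := ltW p_gt1.
Let p_gt0 : 0 < p. Proof. exact: lt_le_trans p1. Qed.
Implicit Types mu : {finite_measure set borelC R -> \bar R}.

Lemma natr_powR_small (b e : R) : b < 0 -> 0 < e ->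
  exists2 N, (0 < N)%N & N%:R `^ b <= e.
Proof.
move=> b0 e0; pose x := e `^ b^-1.
have x0 : 0 < x by rewrite powR_gt0.
exists (Num.bound x).+1 => //.
have xN : x <= (Num.bound x).+1%:R.
  by rewrite ltW// (lt_trans (archi_boundP (ltW x0)))// ltr_nat.
have -> : e = x `^ b.
  by rewrite /x -powRrM mulVf ?lt_eqF// powRr1// ltW.
have eb (y : R) : y `^ b = (y `^ (- b))^-1 by rewrite -powRN opprK.
rewrite !eb lef_pV2 ?posrE ?powR_gt0//.
by apply: ge0_ler_powR; rewrite ?nnegrE ?oppr_ge0 ?(ltW b0)// ltW.
Qed.

Lemma sum_unit_vecE (s : seq nat) k : uniq s ->
  (\sum_(i <- s) unit_vec p1 (@setT nat) i : Lp (cnt setT) p1) k =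
  ((k \in s)%:R : R[i]).
Proof.
elim: s => [_|i s IH /= /andP[iN us]]; first by rewrite big_nil lD_zeroE.
rewrite big_cons lD_addE// unit_vecE// IH// inE.
by case: eqVneq => [->|_]; rewrite ?(negbTE iN) ?addr0 ?add0r.
Qed.

Lemma Lp_norm_sum_unit_vec (s : seq nat) : uniq s ->
  Lp_norm (\sum_(i <- s) unit_vec p1 (@setT nat) i : Lp (cnt (R := R) setT) p1) =
  (size s)%:R `^ p^-1.
Proof.
move=> us; set F := \sum_(i <- s) _.
have : ((Lp_norm F `^ p)%:E = ((size s)%:R)%:E)%E.
  rewrite Lp_norm_pint /pint integral_cnt; last by move=> n; rewrite lee_fin powR_ge0.
  rewrite (_ : (\esum_(n in _) _)%E = (\esum_(n in [set` s]) (1%:E : \bar R))%E).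
    rewrite esum_fset//; last exact: finite_seq.
    by rewrite -fsbig_seq// sumEFin big_const_seq count_predT iter_addr_0.
  rewrite [RHS]esum_mkcond; apply: eq_esum => n _; rewrite sum_unit_vecE//.
  case: (boolP (n \in s)) => ns; first by rewrite (@mem_set _ [set` s] n ns) normc1 powR1.
  by rewrite (@memNset _ [set` s] n (negP ns)) normc0 powR0 ?gt_eqF.
by case=> <-; rewrite -powRrM mulfV ?gt_eqF// powRr1// Lp_norm_ge0.
Qed.

Lemma averages_null_unit_vec :
  averages_null (unit_vec p1 (@setT nat) : nat -> Lp (cnt (R := R) setT) p1).
Proof.
move=> e e0; have [|N N0 hN] := @natr_powR_small (p^-1 - 1) e _ e0.
  by rewrite subr_lt0 invf_lt1.
exists N => // s us sN; rewrite Lp_norm_sum_unit_vec// sN.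
have Nr : (N%:R : R) != 0 by rewrite pnatr_eq0 -lt0n.
rewrite -[p^-1](subrK 1) powRD; last by rewrite Nr implybT.
by rewrite powRr1// mulrC ler_wpM2l.
Qed.

Lemma wdom_point mu (l : R[i]) : wdom (p := p) mu mu
  (fun z : borelC R => (\1_[set l] z)%:C%C : R[i]) id.
Proof.
apply: (wdom_mul p1 (B := 1)).
  apply: measurable_real_complex; apply: measurable_indic.
  exact: measurable_set1C.
apply: aeW => z.
by rewrite normc_real indicE; case: (_ \in _); rewrite ?normr1 ?normr0.
Qed.

Lemma null_seq_le d {T : measurableType d} {m : {measure set T -> \bar R}}
    d' {T' : measurableType d'} {m' : {measure set T' -> \bar R}}
    (u : nat -> Lp m p1) (v : nat -> Lp m' p1) :
  (forall n, Lp_norm (v n) <= Lp_norm (u n)) -> null_seq u -> null_seq v.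
Proof. by move=> uv nu e /nu[n0 h]; exists n0 => n /h; exact: le_trans. Qed.

(** Up to null sets a function carried by one point is determined by its value there, so the rank is
    at most one. *)
Lemma compact_point_mult mu (l : R[i]) :
  compact_operator (wc p1 mu mu (fun z : borelC R => (\1_[set l] z)%:C%C : R[i]) id).
Proof.
have mz1 : measurable ([set l] : set (borelC R)) by exact: measurable_set1C.
have mv : measurable_fun setT ((fun z : borelC R => (\1_[set l] z)%:C%C) : borelC R -> borelC R).
  by apply: measurable_real_complex; exact: measurable_indic.
have wv := wdom_point mu l.
have vL : (fun z : borelC R => (\1_[set l] z)%:C%C : R[i]) \in LfunC_pred mu p1.
  apply/LfunCP; split => //.
  apply: (@le_lt_trans _ _ (\int[mu]_x (cst 1%:E) x)%E).
    apply: ge0_le_integral => //.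
    - by move=> x _; rewrite lee_fin powR_ge0.
    - exact: measurable_normc_powR.
    move=> x _; rewrite lee_fin normc_real indicE.
    by case: (_ \in _); rewrite ?normr1 ?powR1 ?normr0 ?powR0 ?gt_eqF.
  rewrite integral_cst// mul1e ltey_eq fin_num_measure//.
pose chi : Lp mu p1 := Lp_class (mkL p1 mu (fun z => (\1_[set l] z)%:C%C)).
have chiE : {ae mu, forall z, chi z = (\1_[set l] z)%:C%C}.
  apply: filterS (Lp_classK (mkL p1 mu (fun z : borelC R => (\1_[set l] z)%:C%C))) => z ->.
  by rewrite mkLE.
(* For [X] in the unit ball |X(l)|^p times the mass of l is at most 1. If that mass is 0, then so is
   [B], and the coefficient 0 is taken. *)
pose B := (fine (mu [set l])) `^ (- p^-1).
apply: (@compact_operatorS _ _ _ _ ((fun c : R[i] => c *: chi) @` [set c | normc c <= B])).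
- exact: (wc_oper p1 wv).
- apply: continuous_compact; last exact: compact_disc.
  by apply: continuous_subspaceT => c; exact: scalel_continuous.
move=> X X1.
have [l0|l0] := eqVneq (mu [set l]) 0%E.
  exists 0; first by change (normc (0 : R[i]) <= B); rewrite normc0 powR_ge0.
  rewrite scale0r; apply/Lp_eqP.
  have h1 : {ae mu, forall z, z <> l}.
    by exists [set l]; split => // z /= /contrapT.
  apply: filterS3 (Lp_zeroE p1 mu) (wc_ae wv X) h1 => z -> -> zl.
  by rewrite indicE memNset// mul0r.
have l1 : 0 < fine (mu [set l]).
  by rewrite fine_gt0// lt0e l0 measure_ge0/= ltey_eq fin_num_measure.
exists (Lp_fun X l); last first.
  apply/Lp_eqP.
  apply: filterS3 (Lp_scaleE (Lp_fun X l) chi) chiE (wc_ae wv X) => z -> -> ->.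
  rewrite indicE mulrC; case: (boolP (z \in _)) => [/set_mem -> //|_].
  by rewrite !mul0r.
have nX : Lp_norm X <= 1 by move: X1; rewrite Lp_normE lecR.
have h : normc (Lp_fun X l) `^ p * fine (mu [set l]) <= 1.
  rewrite -lee_fin EFinM fineK ?fin_num_measure//.
  have <- := integral_setE1 mu (fun z : borelC R => (normc (Lp_fun X z) `^ p)%:E) mz1.
  apply: (@le_trans _ _ (pint (p := p) mu (Lp_fun X))).
    apply: ge0_subset_integral => //.
      by apply: measurable_normc_powR; exact: LfunC_measurable.
    by move=> z _; rewrite lee_fin powR_ge0.
  have pow1 : 1 `^ p = 1 by rewrite powR1.
  rewrite -Lp_norm_pint lee_fin -pow1.
  by apply: ge0_ler_powR; rewrite ?nnegrE ?Lp_norm_ge0 ?(ltW p_gt0).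
have h' : normc (Lp_fun X l) `^ p <= (fine (mu [set l])) `^ (- 1).
  by rewrite powR_inv1 ?(ltW l1)// -[leRHS]mul1r ler_pdivlMr.
have := @ge0_ler_powR _ p^-1 _ _ _ _ _ h'.
rewrite !nnegrE !powR_ge0 invr_ge0 (ltW p_gt0) => /(_ isT isT isT).
by rewrite -!powRrM mulfV ?gt_eqF// powRr1 ?normc_ge0// mulN1r.
Qed.

(** If l is not a limit point of the second support, M_2 - l is bounded below away from the point l,
    and restriction to that point is compact. Both parts of the images [y n] therefore tend to 0,
    while [V] followed by [bana] recovers unit vectors from them. *)
Lemma limit_points_sub mu1 mu2 (cmu1 : compact (supp mu1))
    (cmu2 : compact (supp mu2)) (W : Lp mu1 p1 -> Lp mu2 p1)
    (V : Lp mu2 p1 -> Lp mu1 p1) :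
  oper W -> oper V -> cancel W V ->
  compact_operator (fun X => W (mult_op p1 cmu1 X) - mult_op p1 cmu2 (W X)) ->
  limit_point (supp mu1) `<=` limit_point (supp mu2).
Proof.
move=> oW oV WV cC l l1; apply: contrapT => l2.
have [r r0 rl] : exists2 r : R, 0 < r & forall z, supp mu2 z -> z <> l -> r <= normc (z - l).
  apply: contrapT => h; apply: l2 => U /nbhs_normcP[r r0 rU].
  apply: contrapT => h'; apply: h; exists r => // z sz zl; rewrite leNgt.
  apply/negP => zr; apply: h'; exists z; split => //; [exact/eqP|exact: rU].
pose eta (n : nat) : R := (2 ^+ n)^-1.
have eta_gt0 n : 0 < eta n by rewrite invr_gt0 exprn_gt0.
have eta_cvg e : 0 < e -> exists N, forall n, (N <= n)%N -> eta n <= e.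
  exact: inv_exp2_small.
have [E [mE E0 tE Et]] := disjoint_pdiscs (mu := mu1) (w := fun=> l) (fun=> l1) eta_gt0.
have [idx midx idxE] := disjoint_index mE tE.
have ztE n (x : borelC R) : E n x -> normc ((x : R[i]) - l) <= eta n.
  by move=> /(Et n); rewrite /pdisc/= => /andP[_ /ltW].
have mz : measurable_fun setT ((fun x => x) : borelC R -> borelC R).
  exact: measurable_id.
have AE := @mult_op_ae R p p1 mu1 cmu1.
have k1 := compact_mul_bsyn setT mE E0 midx idxE mz AE
  (t := fun=> l) (fun=> lexx (normc l)) eta_gt0 eta_cvg ztE.
have oS := bsyn_oper p_gt1 setT mE E0 midx idxE.
have oQ := bana_oper p_gt1 setT mE E0 idxE.
have QS := bana_bsyn mE E0 midx idxE (Z := setT) (p_gt1 := p_gt1).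
pose S := @bsyn R p p_gt1 _ _ mu1 E idx setT.
pose e_ := unit_vec p1 (@setT nat) : nat -> Lp (cnt (R := R) setT) p1.
have e1 n : Lp_norm (e_ n) <= 1.
  have := @Lp_norm_sum_unit_vec [:: n] isT.
  by rewrite big_seq1 powR1 => ->.
have small d' (T' : measurableType d') (m : {measure set T' -> \bar R})
    (K : Lp (cnt setT) p1 -> Lp m p1) :
    compact_operator K -> null_seq (fun n => K (e_ n)).
  by move=> cK; apply: (compact_averages_null cK ltr01 e1 averages_null_unit_vec).
pose y n := W (S (e_ n)).
pose g n := mult_op p1 cmu2 (y n) - l *: y n.
have wl : wdom (p := p) (cnt setT) (cnt setT) (fun=> l) id.
  by apply: (wdom_mul p1 (B := normc l)) => //; apply/cnt_ae.
have g0 : null_seq g.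
  have n1 := small _ _ _ _ (compact_operator_compl oW k1).
  have n2 := small _ _ _ _ (compact_operator_compr cC oS).
  apply: null_seq_ext (null_seqB n1 n2) => n.
  have -> : wc p1 (cnt setT) (cnt setT) (fun=> l) id (e_ n) = l *: e_ n.
    apply/lD_eqP => k _; rewrite lD_scaleE//.
    by have /cnt_ae -> := wc_ae wl (e_ n).
  rewrite (operB oW) (operZ oS) (operZ oW) /g /y.
  by rewrite opprB addrC addrA subrK.
pose P := wc p1 mu2 mu2 (fun z : borelC R => (\1_[set l] z)%:C%C : R[i]) id.
have cP : compact_operator P by exact: compact_point_mult.
have wP : wdom (p := p) mu2 mu2 (fun z : borelC R => (\1_[set l] z)%:C%C : R[i]) id.
  exact: wdom_point.
have Py0 : null_seq (fun n => P (y n)).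
  exact: (small _ _ _ _ (compact_operator_compr cP (oper_comp oW oS))).
have yP0 : null_seq (fun n => y n - P (y n)).
  have n1 := null_seq_oper (oper_scale (r^-1)%:C%C (oper_id (Lp mu2 p1))) g0.
  apply: null_seq_le n1 => n; apply: Lp_norm_ae_le.
  have gE : g n = mult_op p1 cmu2 (y n) + -1 *: (l *: y n) by rewrite scaleN1r.
  have yE : y n - P (y n) = y n + -1 *: P (y n) by rewrite scaleN1r.
  have h1 := Lp_addE (y n) (-1 *: P (y n)).
  have h2 := Lp_scaleE (-1) (P (y n)).
  have h3 := wc_ae wP (y n).
  have h4 := Lp_scaleE (r^-1)%:C%C (g n).
  have h5 := Lp_addE (mult_op p1 cmu2 (y n)) (-1 *: (l *: y n)).
  have h6 := Lp_scaleE (-1) (l *: y n).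
  have h7 := Lp_scaleE l (y n).
  have h8 := @mult_op_ae R p p1 mu2 cmu2 (y n).
  apply: filterS3 (filterI (filterI h1 h2) (filterI h3 h4))
    (filterI (filterI h5 h6) (filterI h7 h8)) (supp_ae mu2).
  move=> z [[k1' k2'] [k3' k4']] [[k5' k6'] [k7' k8']] sz.
  rewrite k4' yE gE k1' k2' k3' k5' k6' k7' k8' indicE.
  have [->|zl] := eqVneq (z : R[i]) l.
    by rewrite mem_set// mul1r !mulN1r !subrr mulr0.
  rewrite memNset; last exact/eqP.
  rewrite mul0r mulr0 addr0 mulN1r -mulrBl !normcM normc_real.
  rewrite ger0_norm ?invr_ge0 ?(ltW r0)// mulrA ler_peMl ?normc_ge0//.
  by rewrite ler_pdivlMl// mulr1; apply: rl => //; exact/eqP.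
have y0 : null_seq y.
  by apply: null_seq_ext (null_seqD yP0 Py0) => n; rewrite subrK.
have e0 := null_seq_oper oQ (null_seq_oper oV y0).
have [|n0 /(_ n0 (leqnn _))] := e0 (1 / 2); first by rewrite divr_gt0.
rewrite /y WV QS.
have := @Lp_norm_sum_unit_vec [:: n0] isT.
rewrite big_seq1 powR1 => ->.
by apply/negP; rewrite -ltNge; lra.
Qed.

End limit_points_similarity.

(** * Rademacher functions on sets without atoms *)

Section inner_regularity.
Context {R : realType}.
Variable mu : {finite_measure set borelC R -> \bar R}.
Local Notation mm A := (fine (mu A)).

Lemma fine_measureE (A : set (borelC R)) : measurable A -> mu A = (mm A)%:E.
Proof. by move=> mA; rewrite fineK// fin_num_measure. Qed.

Lemma le_fine_measure (A B : set (borelC R)) : measurable A -> measurable B ->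
  A `<=` B -> mm A <= mm B.
Proof.
move=> mA mB AB; rewrite -lee_fin -!fine_measureE//.
by apply: le_measure; rewrite ?inE.
Qed.

Lemma closed_measurableC (A : set (borelC R)) : closed (A : set R[i]) -> measurable A.
Proof.
move=> cA; rewrite -[A]setCK; apply: measurableC; apply: open_measurableC.
exact: closed_openC.
Qed.

Lemma decreasing_small (S : nat -> set (borelC R)) e :
  (forall n, measurable (S n)) -> (forall m n, (m <= n)%N -> S n `<=` S m) ->
  mm (\bigcap_n S n) < e -> exists N, mm (S N) < e.
Proof.
move=> mS dS h.
have cF : (mu \o S) x @[x --> \oo] --> (mm (\bigcap_n S n))%:E.
  rewrite -fine_measureE; last exact: bigcapT_measurable.
  apply: nonincreasing_cvg_mu => //.
  - by rewrite ltey_eq fin_num_measure.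
  - exact: bigcapT_measurable.
  - by move=> m n mn; apply/subsetPset; exact: dS.
have /fine_cvg/cvgrPdist_lt/(_ (e - mm (\bigcap_n S n))) := cF.
rewrite subr_gt0 => /(_ h)[N _ /(_ N (leqnn N)) /= hN].
exists N; move: hN; rewrite ltr_distl => /andP[]; lra.
Qed.

(** Inner approximation of [A] and of its complement at once. The symmetry gives stability under
    complements, so that these sets form a sigma-algebra. *)
Definition tight_set (A : set (borelC R)) := forall e, 0 < e ->
  exists F G : set (borelC R), [/\ closed (F : set R[i]), closed (G : set R[i]),
    F `<=` A, G `<=` ~` A & mm (~` (F `|` G)) < e].

Lemma tight_setC A : tight_set A -> tight_set (~` A).
Proof.
move=> tA e /tA[F [G [cF cG FA GA h]]]; exists G, F; split => //.
- by rewrite setCK.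
- by rewrite setUC.
Qed.

(** The closed sets of points at distance at least 1 / (n + 1) from the complement exhaust [U], so
    what they miss decreases to the empty set. *)
Lemma tight_open (U : set (borelC R)) : open (U : set R[i]) -> tight_set U.
Proof.
move=> oU e e0.
pose F n : set (borelC R) :=
  [set z | forall w, ~ U w -> n.+1%:R^-1 <= normc ((z : R[i]) - w)].
have cF n : closed (F n : set R[i]).
  rewrite (_ : (F n : set R[i]) =
      \bigcap_(w in ~` U) ((fun z => normc (z - w)) @^-1` [set x | n.+1%:R^-1 <= x])).
    apply: closed_bigI => w _; apply: closed_comp => [z _|]; last exact: closed_ge.
    apply: normc_lipschitz_continuous => x y.
    have h1 : normc (x - w) <= normc (x - y) + normc (y - w).
      by apply: le_trans (ler_normcD _ _); rewrite addrA subrK.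
    have h2 : normc (y - w) <= normc (x - y) + normc (x - w).
      rewrite -[normc (x - y)]normc_opp opprB.
      by apply: le_trans (ler_normcD _ _); rewrite addrA subrK.
    by rewrite ler_norml; apply/andP; split; lra.
  by apply/seteqP; split => z h w; exact: h.
pose S n := ~` (F n `|` ~` U).
have mS n : measurable (S n).
  apply: measurableC; apply: measurableU; first exact: closed_measurableC.
  by apply: measurableC; exact: open_measurableC.
have [||N hN] := @decreasing_small S e mS.
- move=> m n mn; apply: subsetC; apply: setSU => z h w Uw.
  apply: le_trans (h w Uw); rewrite lef_pV2 ?posrE// ler_nat.
  by rewrite ltnS.
- rewrite (_ : \bigcap_n S n = set0) ?measure0//.
  apply/seteqP; split => z // h.
  have Uz : U z by apply: contrapT => nU; apply: (h 0%N I); right.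
  have [d d0 dU] := (open_normcP U).1 oU _ Uz.
  have [n hn] := ltr_add_invr (y := 0) d0.
  apply: (h n I); left => w nUw; rewrite leNgt; apply/negP => hw.
  by apply: nUw; apply: dU; apply: lt_trans hw _; rewrite add0r in hn.
exists (F N), (~` U); split => //.
- exact: open_closedC.
- move=> z h; apply: contrapT => /h; rewrite subrr normc0.
  by apply/negP; rewrite -ltNge invr_gt0 ltr0n.
Qed.

Lemma tight_set_measurable A : tight_set A -> measurable A ->
  (0 < mu A)%E -> exists F : set (borelC R),
    [/\ closed (F : set R[i]), F `<=` A & (0 < mu F)%E].
Proof.
move=> tA mA A0.
have A1 : 0 < mm A by rewrite -lte_fin -fine_measureE.
have [F [G [cF cG FA GA h]]] := tA _ A1.
have mF := closed_measurableC cF; have mG := closed_measurableC cG.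
exists F; split => //; rewrite lt0e measure_ge0 andbT; apply/negP => /eqP F0.
have : mm A <= mm (~` (F `|` G)).
  rewrite -lee_fin -!fine_measureE//; last exact/measurableC/measurableU.
  rewrite (measureDI mu mA mF) [X in (_ + X)%E](_ : _ = 0%E); last first.
    by apply/eqP; rewrite eq_le measure_ge0 andbT -F0 le_measure ?inE//; exact: measurableI.
  rewrite adde0; apply: le_measure; rewrite ?inE.
  - exact: measurableD.
  - exact/measurableC/measurableU.
  by move=> z [Az Fz] [/Fz //|/GA].
by rewrite leNgt h.
Qed.

(** Closedness permits every intersection of the [G n] but only finite unions of the [F n]. The
    errors [d n] sum to e / 2, and the other half of e absorbs the loss from stopping the union at a
    large N. *)
Lemma tight_bigcup (A : nat -> set (borelC R)) : (forall n, tight_set (A n)) ->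
  tight_set (\bigcup_n A n).
Proof.
move=> tA e e0.
pose d n : R := e / 2 / (2 ^ n.+1)%:R.
have d0 n : 0 < d n by rewrite !divr_gt0// ltr0n expn_gt0.
have /choice[FG hFG] n : exists FG : set (borelC R) * set (borelC R),
    [/\ closed (FG.1 : set R[i]), closed (FG.2 : set R[i]),
    FG.1 `<=` A n, FG.2 `<=` ~` A n & mm (~` (FG.1 `|` FG.2)) < d n].
  by have [F [G h]] := tA n _ (d0 n); exists (F, G).
pose F n := (FG n).1; pose G n := (FG n).2.
have cF n : closed (F n : set R[i]) by have [] := hFG n.
have cG n : closed (G n : set R[i]) by have [] := hFG n.
have mF n := closed_measurableC (cF n); have mG n := closed_measurableC (cG n).
pose FN N := \big[setU/set0]_(n < N.+1) F n.
pose GG := \bigcap_n G n.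
have cFN N : closed (FN N : set R[i]).
  rewrite /FN; elim: N.+1 => [|k IH]; first by rewrite big_ord0; exact: closed0.
  by rewrite big_ord_recr; exact: closedU.
have cGG : closed (GG : set R[i]) by apply: closed_bigI => n _; exact: cG.
have mFN N := closed_measurableC (cFN N); have mGG := closed_measurableC cGG.
pose D n := ~` (F n `|` G n).
have mD n : measurable (D n) by exact/measurableC/measurableU.
have mDD : measurable (\bigcup_n D n) by exact: bigcupT_measurable.
have hD : mm (\bigcup_n D n) <= e / 2.
  rewrite -lee_fin -fine_measureE//.
  apply: (le_trans (measure_sigma_subadditive mu mD mDD (@subset_refl _ _))).
  have e2 : 0 <= e / 2 by rewrite divr_ge0// ltW.
  apply: le_trans (epsilon_trick0 xpredT e2).
  apply: lee_nneseries => n _; first by move=> _; exact: measure_ge0.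
  have [_ _ _ _ /ltW] := hFG n.
  by rewrite -lee_fin; apply: le_trans; rewrite -fine_measureE//; exact: mD.
pose S N := ~` (FN N `|` GG).
have mS N : measurable (S N) by exact/measurableC/measurableU.
have [||N hN] := @decreasing_small S e mS.
- move=> m n mn; apply: subsetC; apply: setSU.
  by apply: subset_bigsetU; rewrite ltnS.
- apply: (@le_lt_trans _ _ (e / 2)); last by rewrite gtr_pMr// invf_lt1 ?ltr1n.
  apply: le_trans hD; apply: le_fine_measure => //; first exact: bigcapT_measurable.
  move=> z hz.
  have [n nG] : exists n, ~ G n z.
    apply: contrapT => /forallNP h; apply: (hz 0%N I); right => n _.
    exact: contrapT (h n).
  exists n => // -[Fz|//]; apply: (hz n I); left.
  by rewrite /FN -bigcup_mkord; exists n => //=.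
exists (FN N), GG; split => //.
- rewrite /FN -bigcup_mkord => z [n _ Fz]; exists n => //.
  by have [_ _ FA _ _] := hFG n; exact: FA.
- move=> z Gz [n _ Az]; have [_ _ _ GA _] := hFG n; exact: (GA z (Gz n I)).
Qed.

Lemma closed_inner (A : set (borelC R)) : measurable A -> (0 < mu A)%E ->
  exists F : set (borelC R), [/\ closed (F : set R[i]), F `<=` A & (0 < mu F)%E].
Proof.
move=> mA; apply: tight_set_measurable => //.
suff : <<s @open R[i] >> `<=` (tight_set : set (set R[i])) by exact.
apply: smallest_sub => [|U oU]; last exact: tight_open.
split.
- by apply: tight_open; exact: open0.
- by move=> B tB; rewrite setTD; exact: tight_setC.
- by move=> B tB; exact: tight_bigcup.
Qed.

End inner_regularity.

(** * Halving sets without atoms *)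

Section bisection.
Context {R : realType}.
Variable mu : {finite_measure set borelC R -> \bar R}.
Local Notation mm A := (fine (mu A)).
Local Notation Re := (@complex.Re R).
Local Notation Im := (@complex.Im R).

Lemma fine_measureU (A B : set (borelC R)) : measurable A -> measurable B ->
  A `&` B = set0 -> mm (A `|` B) = mm A + mm B.
Proof.
move=> mA mB AB; rewrite measureU// fineD//; exact: fin_num_measure.
Qed.

(** A quantile of f; the level set f = t may carry mass, so equality cannot be expected. *)
Lemma cut_measure (f : borelC R -> R) (A : set (borelC R)) (B c : R) :
  measurable_fun setT f -> measurable A ->
  (forall z, A z -> `|f z| <= B) -> 0 <= B -> 0 <= c <= mm A ->
  exists t, mm (A `&` [set z | f z < t]) <= c <= mm (A `&` [set z | f z <= t]).
Proof.
move=> mf mA fB B0 /andP[c0 cA].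
have mlt t : measurable (A `&` [set z | f z < t]).
  rewrite (_ : [set z | f z < t] = f @^-1` `]-oo, t[).
    by apply: measurableI => //; rewrite -[X in measurable X]setTI; exact: mf.
  by apply/seteqP; split => z /=; rewrite in_itv.
have mle t : measurable (A `&` [set z | f z <= t]).
  rewrite (_ : [set z | f z <= t] = f @^-1` `]-oo, t]).
    by apply: measurableI => //; rewrite -[X in measurable X]setTI; exact: mf.
  by apply/seteqP; split => z /=; rewrite in_itv.
(* The cap [t <= B] makes the supremum finite; above [B] the sublevel set is all of [A]. *)
pose X : set R := [set t | t <= B /\ mm (A `&` [set z | f z < t]) <= c].
have X0 : X (- B).
  split; first by rewrite (le_trans _ B0)// oppr_le0.
  rewrite (_ : _ `&` _ = set0) ?measure0//.
  apply/seteqP; split => z // -[/fB]/=.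
  by rewrite ler_norml => /andP[+ _] h; rewrite leNgt h.
have hX : has_sup X by split; [exists (- B)|exists B => t []].
pose t := sup X; exists t.
have tB : t <= B by apply: ge_sup; [exists (- B)|move=> s []].
have invn_gt0 n : 0 < n.+1%:R^-1 :> R by rewrite invr_gt0 ltr0n.
apply/andP; split.
  apply/ler_addgt0Pr => e e0.
  pose D n := A `&` [set z | f z < t] `\` (A `&` [set z | f z < t - n.+1%:R^-1]).
  have mD n : measurable (D n) by exact: measurableD.
  have [||n hn] := @decreasing_small R mu D e mD.
  - move=> m n mn z [[Az zt] h]; split => // -[_ zm]; apply: h; split => //=.
    by apply: lt_le_trans zm _; rewrite lerD2l lerN2 lef_pV2 ?posrE ?ltr0n// ler_nat ltnS.
  - rewrite (_ : \bigcap_n D n = set0) ?measure0//.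
    apply/seteqP; split => z // h.
    have [[Az /= zt] _] := h 0%N I.
    have [n hn] := ltr_add_invr zt.
    have [_] := h n I; apply; split => //; rewrite /= ltrBrDr hn //.
  have [s [sB sc] ts] := sup_adherent (invn_gt0 n) hX.
  have := @fine_measureU (A `&` [set z | f z < t - n.+1%:R^-1]) (D n) (mlt _) (mD _).
  rewrite [X in _ -> fine (mu X) = _](_ : _ = A `&` [set z | f z < t]); last first.
    rewrite /D setDE; apply/seteqP; split => z /=.
      move=> [[Az h]|[//]]; split=> //; apply: lt_trans h _.
      by rewrite ltrBlDr ltrDl.
    move=> [Az zt]; have [h|h] := pselect (A z /\ f z < t - n.+1%:R^-1); [by left|by right].
  move=> ->; last by rewrite /D setIDA setDE; apply/seteqP; split => z // [[]].
  apply: lerD; last exact: ltW.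
  apply: le_trans sc; apply: le_fine_measure => // z [Az zt]; split => //.
  exact: lt_trans zt ts.
rewrite leNgt; apply/negP => h.
have [|||n hn] := @decreasing_small R mu (fun n => A `&` [set z | f z < t + n.+1%:R^-1]) c.
- by move=> n; exact: mlt.
- move=> m n mn z [Az zt]; split => //=; apply: lt_le_trans zt _.
  by rewrite lerD2l lef_pV2 ?posrE ?ltr0n// ler_nat ltnS.
- rewrite (_ : \bigcap_n _ = A `&` [set z | f z <= t])//.
  apply/seteqP; split => z.
    move=> hz; split; first by have [] := hz 0%N I.
    rewrite /= leNgt; apply/negP => tz.
    have [n hn] := ltr_add_invr tz.
    by have [_ /=] := hz n I; rewrite ltNge (ltW hn).
  by move=> [Az /= zt] n _; split=> //=; rewrite (le_lt_trans zt)// ltrDl.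
have [tn|tn] := leP (t + n.+1%:R^-1) B.
  have : t + n.+1%:R^-1 <= t by apply: ub_le_sup; [exists B => s []|split => //; exact: ltW].
  by rewrite gerDl leNgt invn_gt0.
have : mm A < c.
  rewrite (_ : A = A `&` [set z | f z < t + n.+1%:R^-1])//.
  apply/seteqP; split => z => [Az|[]//]; split => //=.
  by apply: le_lt_trans tn; rewrite (le_trans (ler_norm _))// fB.
by rewrite ltNge cA.
Qed.

Definition diffuse_on (A : set (borelC R)) := forall z, A z -> mu [set z] = 0%E.

(** First cut by the real part. The mass left over sits on a vertical line, where it is cut by the
    imaginary part; what then remains undecided is at most one point, which has measure 0. *)
Lemma half_measure (A : set (borelC R)) (B : R) : measurable A ->
  (forall z, A z -> normc (z : R[i]) <= B) -> diffuse_on A ->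
  exists S, [/\ measurable S, S `<=` A & mm S = mm A / 2].
Proof.
move=> mA AB dA.
have mlt (f : borelC R -> R) C t : measurable_fun setT f -> measurable C ->
    measurable (C `&` [set z | f z < t]).
  move=> mf mC; rewrite (_ : [set z | f z < t] = f @^-1` `]-oo, t[).
    by apply: measurableI => //; rewrite -[X in measurable X]setTI; exact: mf.
  by apply/seteqP; split => z /=; rewrite in_itv.
have meq (f : borelC R -> R) C t : measurable_fun setT f -> measurable C ->
    measurable (C `&` [set z | f z = t]).
  move=> mf mC; rewrite (_ : [set z | f z = t] = f @^-1` [set t]) //.
  by apply: measurableI => //; rewrite -[X in measurable X]setTI; exact: mf.
have leE (f : borelC R -> R) C t : measurable_fun setT f -> measurable C ->
    mm (C `&` [set z | f z <= t]) =
    mm (C `&` [set z | f z < t]) + mm (C `&` [set z | f z = t]).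
  move=> mf mC; rewrite -fine_measureU; [|exact: mlt|exact: meq|].
    congr (fine (mu _)); apply/seteqP; split => z /=.
      by move=> [Cz]; rewrite le_eqVlt => /orP[/eqP|]; [right|left].
    by move=> [[Cz /ltW]|[Cz ->]].
  by apply/seteqP; split => z // [[_ /= +] [_ /= h]]; rewrite h ltxx.
have mRe : measurable_fun setT (Re : borelC R -> R) by exact: measurable_Re.
have mIm : measurable_fun setT (Im : borelC R -> R) by exact: measurable_Im.
have A0 : 0 <= mm A by apply: fine_ge0; exact: measure_ge0.
have [|||t /andP[t1 t2]] := @cut_measure (Re : borelC R -> R) A `|B| (mm A / 2) mRe mA.
- by move=> z /AB h; rewrite (le_trans (ler_norm_Re z))// (le_trans h)// ler_norm.
- exact: normr_ge0.
- by apply/andP; split; lra.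
rewrite leE// in t2.
pose D := A `&` [set z : borelC R | Re z = t].
have mD : measurable D by exact: meq.
pose c := mm A / 2 - mm (A `&` [set z : borelC R | Re z < t]).
have [|||u /andP[u1 u2]] := @cut_measure (Im : borelC R -> R) D `|B| c mIm mD.
- by move=> z [/AB h _]; rewrite (le_trans (ler_norm_Im z))// (le_trans h)// ler_norm.
- exact: normr_ge0.
- by rewrite /c; apply/andP; split; lra.
have D0 : mm (D `&` [set z : borelC R | Im z = u]) = 0.
  have [[z [[Az zt] zu]]|h] := pselect (D `&` [set z : borelC R | Im z = u] !=set0).
    have -> : D `&` [set z : borelC R | Im z = u] = [set z].
      apply/seteqP; split => w /=.
        move=> [[_ /= wt] wu]; move: zt zu wt wu => /=.
        by case: (z) => ? ?; case: (w) => ? ? /= -> -> -> ->.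
      by move=> ->; split.
    by rewrite dA.
  rewrite (_ : _ `&` _ = set0) ?measure0//.
  by apply/seteqP; split => z // hz; apply: h; exists z.
rewrite leE// D0 addr0 in u2.
have uE : mm (D `&` [set z : borelC R | Im z < u]) = c by apply/eqP; rewrite eq_le u1.
exists ((A `&` [set z : borelC R | Re z < t]) `|` (D `&` [set z : borelC R | Im z < u])).
split.
- by apply: measurableU; exact: mlt.
- by move=> z [[]//|[[]]].
rewrite fine_measureU; [|exact: mlt|exact: mlt|].
  by rewrite uE /c; lra.
by apply/seteqP; split => z // [[_ /= +] [[_ /= h] _]]; rewrite h ltxx.
Qed.

(** To halve along one more set [X], apply the induction hypothesis separately to the parts of [A]
    inside and outside [X], and take the union. *)
Lemma half_measures (s : seq (set (borelC R))) (A : set (borelC R)) (B : R) :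
  (forall S, S \in s -> measurable S) -> measurable A ->
  (forall z, A z -> normc (z : R[i]) <= B) -> diffuse_on A ->
  exists S, [/\ measurable S, S `<=` A, mm S = mm A / 2 &
    forall X, X \in s -> mm (S `&` X) = mm (A `&` X) / 2].
Proof.
elim: s A => [|X s IH] A ms mA AB dA.
  by have [S [mS SA SE]] := half_measure mA AB dA; exists S; split.
have mX : measurable X by apply: ms; rewrite mem_head.
have {}ms S : S \in s -> measurable S by move=> h; apply: ms; rewrite inE h orbT.
have [|||S1 [mS1 S1A S1E S1s]] := IH (A `&` X) ms.
- exact: measurableI.
- by move=> z [/AB].
- by move=> z [/dA].
have [|||S2 [mS2 S2A S2E S2s]] := IH (A `\` X) ms.
- exact: measurableD.
- by move=> z [/AB].
- by move=> z [/dA].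
have E12 (Y : set (borelC R)) : (S1 `&` Y) `&` (S2 `&` Y) = set0.
  by apply/seteqP; split => z // [[/S1A[_ ?] _] [/S2A[]]].
have EA (Y : set (borelC R)) : measurable Y ->
    mm (A `&` Y) = mm ((A `&` X) `&` Y) + mm ((A `\` X) `&` Y).
  move=> mY; rewrite -fine_measureU.
  - congr (fine (mu _)); apply/seteqP; split => z /=.
      by move=> [Az Yz]; have [?|?] := pselect (X z); [left|right].
    by move=> [[[]]|[[]]].
  - by apply: measurableI => //; exact: measurableI.
  - by apply: measurableI => //; exact: measurableD.
  - by apply/seteqP; split => z // [[[_ ?] _] [[_ ?]]].
exists (S1 `|` S2); split.
- exact: measurableU.
- by move=> z [/S1A[]|/S2A[]].
- rewrite fine_measureU//; last by have := E12 setT; rewrite !setIT.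
  have := EA setT measurableT; rewrite !setIT => ->; rewrite S1E S2E.
  by rewrite mulrDl.
move=> Y; rewrite inE => /orP[/eqP ->|Ys].
  rewrite -S1E (_ : (S1 `|` S2) `&` X = S1)//.
  apply/seteqP; split => z; first by move=> [[//|/S2A[]]].
  by move=> Sz; split; [left|have [] := S1A z Sz].
rewrite setIUl fine_measureU//; [|by apply: measurableI => //; exact: ms..].
by rewrite S1s// S2s// -mulrDl -EA//; exact: ms.
Qed.

End bisection.

Section bounded_functions.
Context {R : realType} d {T : measurableType d}.
Variable mu : {finite_measure set T -> \bar R}.

Definition bounded_measurable (f : T -> R) :=
  measurable_fun setT f /\ exists B, forall z, `|f z| <= B.

Lemma bounded_measurable_integrable f : bounded_measurable f ->
  mu.-integrable setT (EFin \o f).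
Proof.
move=> [mf [B fB]]; apply: measurable_bounded_integrable => //.
  by rewrite ltey_eq fin_num_measure.
exists B; split; first exact: num_real.
by move=> M BM z _ /=; apply: (le_trans (fB z)); exact: ltW.
Qed.

Lemma bounded_measurable_indic A : measurable A -> bounded_measurable \1_A.
Proof.
move=> mA; split; first exact: measurable_indic.
by exists 1 => z; rewrite indicE; case: (_ \in _); rewrite ?normr1 ?normr0.
Qed.

Lemma bounded_measurableD f g : bounded_measurable f -> bounded_measurable g ->
  bounded_measurable (fun z => f z + g z).
Proof.
move=> [mf [B fB]] [mg [C gC]]; split; first exact: measurable_funD.
by exists (B + C) => z; rewrite (le_trans (ler_normD _ _))// lerD.
Qed.

Lemma bounded_measurableM f g : bounded_measurable f -> bounded_measurable g ->
  bounded_measurable (fun z => f z * g z).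
Proof.
move=> [mf [B fB]] [mg [C gC]]; split; first exact: measurable_funM.
by exists (B * C) => z; rewrite normrM ler_pM.
Qed.

Lemma bounded_measurable_cst c : bounded_measurable (fun=> c).
Proof. by split; [exact: measurable_cst|exists `|c|]. Qed.

Lemma bounded_measurable_sum (r : nat -> T -> R) s :
  (forall n, bounded_measurable (r n)) ->
  bounded_measurable (fun z => \sum_(i <- s) r i z).
Proof.
move=> br; elim: s => [|i s IH].
  rewrite (_ : (fun z => _) = fun=> 0); first exact: bounded_measurable_cst.
  by apply/funext => z; rewrite big_nil.
rewrite (_ : (fun z => _) = fun z => r i z + \sum_(j <- s) r j z).
  exact: bounded_measurableD.
by apply/funext => z; rewrite big_cons.
Qed.

Lemma Rintegral_lin a b f g : bounded_measurable f -> bounded_measurable g ->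
  \int[mu]_x (a * f x + b * g x) = a * \int[mu]_x f x + b * \int[mu]_x g x.
Proof.
move=> bf bg.
by have [_ ->] := integrable_lin a b measurableT
  (bounded_measurable_integrable bf) (bounded_measurable_integrable bg).
Qed.

Lemma Rintegral_indic A : measurable A -> \int[mu]_x \1_A x = fine (mu A).
Proof. by move=> mA; rewrite /Rintegral integral_indic// setIT. Qed.

Lemma orthogonal_sum_sqr (r : nat -> T -> R) c :
  (forall n, bounded_measurable (r n)) ->
  (forall n, \int[mu]_x (r n x) ^+ 2 = c) ->
  (forall m n, m != n -> \int[mu]_x (r m x * r n x) = 0) ->
  forall s, uniq s ->
  \int[mu]_x (\sum_(i <- s) r i x) ^+ 2 = (size s)%:R * c.
Proof.
move=> br r2 r0; have bs s := bounded_measurable_sum s br.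
have cross i s : i \notin s -> \int[mu]_x (r i x * \sum_(j <- s) r j x) = 0.
  elim: s => [|j s IH].
    rewrite (_ : (fun x => _) = fun=> 0); first by rewrite Rintegral_cst// mul0r.
    by apply/funext => x; rewrite big_nil mulr0.
  rewrite inE negb_or => /andP[ij /IH h].
  rewrite (_ : (fun x => _) = fun x => 1 * (r i x * r j x) +
      1 * (r i x * \sum_(k <- s) r k x)); last first.
    by apply/funext => x; rewrite big_cons mulrDr !mul1r.
  rewrite Rintegral_lin; [|exact: bounded_measurableM|exact: bounded_measurableM].
  by rewrite h r0// !mul1r addr0.
elim => [_|i s IH /= /andP[iN us]].
  rewrite (_ : (fun x => _) = fun=> 0); first by rewrite Rintegral_cst// !mul0r.
  by apply/funext => x; rewrite big_nil expr0n.
rewrite (_ : (fun x => _) = fun x => 1 * (1 * (r i x * r i x) +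
    2 * (r i x * \sum_(k <- s) r k x)) +
    1 * ((\sum_(k <- s) r k x) * \sum_(k <- s) r k x)); last first.
  by apply/funext => x; rewrite big_cons; ring.
have b1 : bounded_measurable (fun x => r i x * r i x) by exact: bounded_measurableM.
have b2 : bounded_measurable (fun x => r i x * \sum_(k <- s) r k x).
  exact: bounded_measurableM.
have b3 : bounded_measurable (fun x => (\sum_(k <- s) r k x) * \sum_(k <- s) r k x).
  exact: bounded_measurableM.
rewrite Rintegral_lin//; last first.
  apply: bounded_measurableD; apply: bounded_measurableM => //; exact: bounded_measurable_cst.
rewrite Rintegral_lin// cross// mulr0 addr0 !mul1r.
have := r2 i; have := IH us.
under eq_Rintegral do rewrite expr2.
move=> ->; under eq_Rintegral do rewrite expr2.
by move=> ->; rewrite -[in RHS]natr1 mulrDl mul1r addrC.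
Qed.

End bounded_functions.

Section rademacher.
Context {R : realType}.
Variable mu : {finite_measure set borelC R -> \bar R}.
Local Notation mm A := (fine (mu A)).

(** Signs with value 1 on [S n] and -1 on the rest of [A], where [S n] halves [A] and every earlier
    set. Pairwise orthogonality replaces independence, since only second moments of the sums are
    used. *)
Lemma rademacher (A : set (borelC R)) (B : R) : measurable A ->
  (forall z, A z -> normc (z : R[i]) <= B) -> diffuse_on mu A ->
  exists r : nat -> borelC R -> R, [/\ forall n, bounded_measurable (r n),
    forall n z, (r n z) ^+ 2 = \1_A z &
    forall s, uniq s ->
      \int[mu]_z (\sum_(i <- s) r i z) ^+ 2 = (size s)%:R * mm A].
Proof.
move=> mA AB dA.
have /choice[F hF] (s : seq (set (borelC R))) : exists S,
    (forall X, X \in s -> measurable X) ->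
    [/\ measurable S, S `<=` A, mm S = mm A / 2 &
    forall X, X \in s -> mm (S `&` X) = mm (A `&` X) / 2].
  have [ms|nms] := pselect (forall X, X \in s -> measurable X); last by exists set0.
  by have [S hS] := half_measures ms mA AB dA; exists S.
(* The list of the first n sets, each obtained from the list of its predecessors. *)
pose L n := iter n (fun s => F s :: s) [::].
have mL n X : X \in L n -> measurable X.
  elim: n X => [//|n IH] X; rewrite /L iterS inE => /orP[/eqP ->|]; last exact: IH.
  by have [] := hF _ IH.
pose S n := F (L n).
have mS n : measurable (S n) by have [] := hF _ (@mL n).
have SA n : S n `<=` A by have [] := hF _ (@mL n).
have SE n : mm (S n) = mm A / 2 by have [] := hF _ (@mL n).
have SL m n : (m < n)%N -> S m \in L n.
  elim: n => [//|n IH]; rewrite ltnS leq_eqVlt /L iterS inE => /orP[/eqP ->|/IH ->].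
    by rewrite eqxx.
  by rewrite orbT.
have SS m n : (m < n)%N -> mm (S n `&` S m) = mm A / 4.
  move=> mn; have [_ _ _ ->] := hF _ (@mL n); last exact: SL.
  by rewrite (_ : A `&` S m = S m) ?SE; [lra|apply/setIidPr; exact: SA].
pose r n (z : borelC R) : R := 2 * \1_(S n) z + -1 * \1_A z.
have bS n := bounded_measurable_indic (R := R) (mS n).
have bA := bounded_measurable_indic (R := R) mA.
have br n : bounded_measurable (r n).
  by apply: bounded_measurableD; apply: bounded_measurableM => //; exact: bounded_measurable_cst.
have r2 n z : (r n z) ^+ 2 = \1_A z.
  rewrite /r !indicE; have [Az|Az] := boolP (z \in A).
    by case: (_ \in _) => /=; ring.
  rewrite (_ : z \in S n = false) /=; first ring.
  by apply/negbTE; apply: contra Az => /set_mem/SA/mem_set.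
have rr m n : m != n -> \int[mu]_x (r m x * r n x) = 0.
  wlog mn : m n / (m < n)%N => [h|_].
    rewrite neq_ltn => /orP[mn|nm]; first by apply: h; rewrite ?(ltn_eqF mn).
    under eq_Rintegral do rewrite mulrC.
    by apply: h; rewrite ?(ltn_eqF nm).
  rewrite (_ : (fun x => _) = fun x => 1 * (4 * \1_(S n `&` S m) x + -2 * \1_(S n) x) +
     1 * (-2 * \1_(S m) x + 1 * \1_A x)); last first.
    apply/funext => z; rewrite /r !indicE in_setI.
    have [Az|Az] := boolP (z \in A).
      by case: (_ \in _); case: (_ \in _) => /=; ring.
    have h k : z \in S k = false.
      by apply/negbTE; apply: contra Az => /set_mem/SA/mem_set.
    by rewrite !h /=; ring.
  have bSS : bounded_measurable (\1_(S n `&` S m) : borelC R -> R).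
    by apply: bounded_measurable_indic; exact: measurableI.
  rewrite !Rintegral_lin//; try (apply: bounded_measurableD; apply: bounded_measurableM => //;
    exact: bounded_measurable_cst).
  rewrite !Rintegral_indic//; last exact: measurableI.
  by rewrite SS// !SE; lra.
exists r; split => // s us; apply: (orthogonal_sum_sqr br _ rr us) => n.
under eq_Rintegral do rewrite r2.
exact: Rintegral_indic.
Qed.

End rademacher.

Section real_classes.
Context {R : realType} {p : R} (p1 : 1 <= p).
Let p_gt0 : 0 < p. Proof. exact: lt_le_trans p1. Qed.
Context d {T : measurableType d}.
Variable mu : {finite_measure set T -> \bar R}.
Local Notation mm A := (fine (mu A)).

Lemma bounded_measurable_powR (f : T -> R) : bounded_measurable f ->
  bounded_measurable (fun z => `|f z| `^ p).
Proof.
move=> [mf [B fB]]; split.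
  apply: (@measurableT_comp _ _ _ _ _ _ (@powR R ^~ p)) => //.
  exact: measurableT_comp.
exists (B `^ p) => z; rewrite ger0_norm ?powR_ge0//.
apply: ge0_ler_powR; rewrite ?nnegrE ?(ltW p_gt0)//.
by rewrite (le_trans _ (fB z)).
Qed.

Definition real_class (f : T -> R) : Lp mu p1 :=
  Lp_class (mkL p1 mu (fun z => (f z)%:C%C)).

Lemma pint_real (f : T -> R) : bounded_measurable f ->
  pint (p := p) mu (fun z => (f z)%:C%C : R[i]) = (\int[mu]_z (`|f z| `^ p))%:E.
Proof.
move=> bf; rewrite /pint /Rintegral fineK.
  by apply: eq_integral => z _; rewrite normc_real.
apply: (@integrable_fin_num _ _ _ mu setT) => //.
exact: (bounded_measurable_integrable mu (bounded_measurable_powR bf)).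
Qed.

Lemma real_classE (f : T -> R) : bounded_measurable f ->
  {ae mu, forall z, Lp_fun (real_class f) z = (f z)%:C%C}.
Proof.
move=> bf; apply: filterS (Lp_classK (mkL p1 mu (fun z => (f z)%:C%C))) => z ->.
rewrite mkLE//; apply/LfunCP; split; last by rewrite pint_real// ltry.
by apply: measurable_real_complex; have [] := bf.
Qed.

Lemma Lp_norm_real_class (f : T -> R) : bounded_measurable f ->
  Lp_norm (real_class f) `^ p = \int[mu]_z (`|f z| `^ p).
Proof.
move=> bf; apply: EFin_inj; rewrite Lp_norm_pint -(pint_real bf).
apply: (pint_ae_eq p1) => //; first exact: LfunC_measurable.
  by apply: measurable_real_complex; have [] := bf.
exact: real_classE.
Qed.

Lemma real_class_sum (r : nat -> T -> R) (s : seq nat) :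
  (forall n, bounded_measurable (r n)) ->
  \sum_(i <- s) real_class (r i) = real_class (fun z => \sum_(i <- s) r i z).
Proof.
move=> br; elim: s => [|i s IH].
  rewrite big_nil; apply/Lp_eqP; have h := Lp_zeroE p1 mu.
  have b0 : bounded_measurable (fun z => \sum_(i <- [::]) r i z).
    exact: bounded_measurable_sum.
  by apply: filterS2 h (real_classE b0) => z -> ->; rewrite big_nil.
rewrite big_cons IH; apply/Lp_eqP.
have bs t := bounded_measurable_sum t br.
apply: filterS3 (Lp_addE (real_class (r i)) (real_class (fun z => \sum_(i <- s) r i z)))
  (real_classE (bs (i :: s))) (filterI (real_classE (br i)) (real_classE (bs s))).
by move=> z -> -> [-> ->]; rewrite big_cons rmorphD.
Qed.

End real_classes.

(** * Growth of Rademacher sums *)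

Section rademacher_sums.
Context {R : realType} {p : R} (p_gt1 : 1 < p).
Let p1 : 1 <= p := ltW p_gt1.
Let p_gt0 : 0 < p. Proof. exact: lt_le_trans p1. Qed.
Variable mu : {finite_measure set borelC R -> \bar R}.
Local Notation mm A := (fine (mu A)).
Variables (A : set (borelC R)) (r : nat -> borelC R -> R).
Hypotheses (mA : measurable A) (A0 : (0 < mu A)%E).
Hypothesis br : forall n, bounded_measurable (r n).
Hypothesis r2 : forall n z, (r n z) ^+ 2 = \1_A z.
Hypothesis rs : forall s, uniq s ->
  \int[mu]_z (\sum_(i <- s) r i z) ^+ 2 = (size s)%:R * mm A.
Local Notation x := (fun n => real_class p1 mu (r n)).

Let mA_gt0 : 0 < mm A. Proof. by rewrite -lte_fin -fine_measureE. Qed.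
Let mT_gt0 : 0 < mm setT.
Proof. by apply: lt_le_trans mA_gt0 _; exact: le_fine_measure. Qed.

(** Only second moments are known, so p-th powers are expressed through squares. *)
Lemma norm_powRE (u : R) : `|u| `^ p = (u ^+ 2) `^ (p / 2).
Proof.
rewrite -[u ^+ 2]real_normK ?num_real// -powR_mulrn// -powRrM.
by rewrite mulrCA divff ?mulr1// pnatr_eq0.
Qed.

Lemma Lp_norm_sum_rademacher s : uniq s ->
  Lp_norm (\sum_(i <- s) x i) `^ p =
  \int[mu]_z (((\sum_(i <- s) r i z) ^+ 2) `^ (p / 2)).
Proof.
move=> us; rewrite real_class_sum// Lp_norm_real_class.
  by apply: eq_Rintegral => z _; rewrite norm_powRE.
exact: bounded_measurable_sum.
Qed.

Lemma bounded_measurable_sumX2 s :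
  bounded_measurable (fun z => (\sum_(i <- s) r i z) ^+ 2).
Proof.
have bs := bounded_measurable_sum s br.
rewrite (_ : (fun z => _) = (fun z => (\sum_(i <- s) r i z) * (\sum_(i <- s) r i z))).
  exact: bounded_measurableM.
by apply/funext => z; rewrite expr2.
Qed.

Lemma bounded_measurable_sum_powR s :
  bounded_measurable (fun z => ((\sum_(i <- s) r i z) ^+ 2) `^ (p / 2)).
Proof.
rewrite (_ : (fun z => _) = (fun z => `|\sum_(i <- s) r i z| `^ p)).
  apply: (bounded_measurable_powR p1); exact: bounded_measurable_sum.
by apply/funext => z; rewrite norm_powRE.
Qed.

Lemma le_Rintegral_bounded (f g : borelC R -> R) : bounded_measurable f ->
  bounded_measurable g -> (forall z, f z <= g z) ->
  \int[mu]_z f z <= \int[mu]_z g z.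
Proof.
by move=> bf bg fg; apply: le_Rintegral => //; exact: bounded_measurable_integrable.
Qed.

Lemma bounded_measurable_lin a b (f g : borelC R -> R) : bounded_measurable f ->
  bounded_measurable g -> bounded_measurable (fun z => a * f z + b * g z).
Proof.
by move=> bf bg; apply: bounded_measurableD; apply: bounded_measurableM => //;
  exact: bounded_measurable_cst.
Qed.

(** With u the squared sum divided by N, integrate u^(p/2) <= 1 + u; the integral of u is the
    measure of [A]. *)
Lemma rademacher_sum_le s : p < 2 -> uniq s -> (0 < size s)%N ->
  Lp_norm (\sum_(i <- s) x i) `^ p <=
  (mm setT + mm A) * (size s)%:R `^ (p / 2).
Proof.
move=> p2 us s0; rewrite Lp_norm_sum_rademacher//.
set N : R := (size s)%:R; have N0 : 0 < N by rewrite ltr0n.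
have q1 : p / 2 <= 1 by rewrite ler_pdivrMr// mul1r ltW.
have q0 : 0 <= p / 2 by rewrite divr_ge0// ltW.
have h (y : R) : 0 <= y -> y `^ (p / 2) <= 1 + y.
  move=> y0; have [y1|/ltW y1] := leP y 1.
    apply: (@le_trans _ _ (1 `^ (p / 2))); last by rewrite powR1 lerDl.
    by apply: ge0_ler_powR; rewrite ?nnegrE.
  by rewrite (le_trans (ler1_powR y1 q1))// lerDr.
pose g z := (N `^ (p / 2)) * 1 + (N `^ (p / 2) / N) * (\sum_(i <- s) r i z) ^+ 2.
apply: (@le_trans _ _ (\int[mu]_z g z)).
  apply: le_Rintegral_bounded.
  - exact: bounded_measurable_sum_powR.
  - apply: (@bounded_measurable_lin _ _ (fun=> 1)); first exact: bounded_measurable_cst.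
    exact: bounded_measurable_sumX2.
  move=> z; set y := (\sum_(i <- s) r i z) ^+ 2; rewrite /g -/y.
  have y0 : 0 <= y by exact: sqr_ge0.
  have -> : N `^ (p / 2) * 1 + N `^ (p / 2) / N * y = N `^ (p / 2) * (1 + y / N).
    by field; rewrite gt_eqF.
  rewrite -{1}[y](mulfVK (lt0r_neq0 N0)) powRM ?divr_ge0// ?(ltW N0)// mulrC.
  by rewrite ler_wpM2l ?powR_ge0// h// divr_ge0// ltW.
rewrite Rintegral_lin; [|exact: bounded_measurable_cst|exact: bounded_measurable_sumX2].
rewrite rs// Rintegral_cst// -/N le_eqVlt; apply/orP; left; apply/eqP.
by field; rewrite gt_eqF.
Qed.

(** With u as for p < 2, integrate u <= e + c u^(p/2), where c = e^(1 - p/2): either u <= e, or u /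
    e is at least 1 and is bounded by its power. *)
Lemma rademacher_sum_ge : 2 < p -> exists2 K, 0 < K & forall s, uniq s -> (0 < size s)%N ->
  (size s)%:R `^ (p / 2) <= K * Lp_norm (\sum_(i <- s) x i) `^ p.
Proof.
(* With this e the constant term accounts for only half of the integral of u, so the other half
   bounds the p-th moment from below. *)
move=> p2; pose e := mm A / (2 * mm setT).
have e0 : 0 < e by rewrite divr_gt0// mulr_gt0.
have q1 : 1 <= p / 2 by rewrite ler_pdivlMr// mul1r ltW.
have q0 : 0 <= p / 2 by exact: le_trans q1.
pose c := e / e `^ (p / 2); have c0 : 0 < c by rewrite divr_gt0// powR_gt0.
exists (2 * c / mm A) => [|s us s0]; first by rewrite divr_gt0// mulr_gt0.
rewrite Lp_norm_sum_rademacher//.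
set N : R := (size s)%:R; have N0 : 0 < N by rewrite ltr0n.
have Nq : 0 < N `^ (p / 2) by rewrite powR_gt0.
pose g z := e * 1 + (c / N `^ (p / 2)) * (((\sum_(i <- s) r i z) ^+ 2) `^ (p / 2)).
have : \int[mu]_z (0 * 1 + N^-1 * (\sum_(i <- s) r i z) ^+ 2) <= \int[mu]_z g z.
  apply: le_Rintegral_bounded.
  - apply: (@bounded_measurable_lin _ _ (fun=> 1)); first exact: bounded_measurable_cst.
    exact: bounded_measurable_sumX2.
  - apply: (@bounded_measurable_lin _ _ (fun=> 1)); first exact: bounded_measurable_cst.
    exact: bounded_measurable_sum_powR.
  move=> z; set y := (\sum_(i <- s) r i z) ^+ 2; rewrite /g -/y mul0r add0r mulr1.
  have y0 : 0 <= y by exact: sqr_ge0.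
  have [h|/ltW h] := leP (N^-1 * y) e.
    by rewrite (le_trans h)// lerDl mulr_ge0 ?powR_ge0// ltW// divr_gt0.
  apply: (@le_trans _ _ (c / N `^ (p / 2) * y `^ (p / 2))); last by rewrite lerDr ltW.
  have h1 : 1 <= N^-1 * y / e by rewrite ler_pdivlMr// mul1r.
  have := le1r_powR h1 q1.
  rewrite ler_pdivrMr// => h2; apply: (le_trans h2).
  have Nv : (N^-1) `^ (p / 2) = (N `^ (p / 2))^-1.
    by rewrite -[N^-1]powR_inv1 ?(ltW N0)// -powRrM mulN1r powRN.
  have ev : (e^-1) `^ (p / 2) = (e `^ (p / 2))^-1.
    by rewrite -[e^-1]powR_inv1 ?(ltW e0)// -powRrM mulN1r powRN.
  have N1 : 0 <= N^-1 by rewrite invr_ge0 ltW.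
  have e1 : 0 <= e^-1 by rewrite invr_ge0 ltW.
  rewrite (powRM _ (mulr_ge0 N1 y0) e1) (powRM _ N1 y0) Nv ev /c.
  rewrite le_eqVlt; apply/orP; left; apply/eqP; field.
  by rewrite !gt_eqF// powR_gt0.
have bc : bounded_measurable (fun _ : borelC R => 1 : R) by exact: bounded_measurable_cst.
rewrite Rintegral_lin//; last exact: bounded_measurable_sumX2.
rewrite Rintegral_lin//; last exact: bounded_measurable_sum_powR.
rewrite rs// Rintegral_cst// -/N mul0r add0r mulKf ?gt_eqF// mul1r.
set I := Rintegral _ _ _ => h.
have eT : e * mm setT = mm A / 2 by rewrite /e; field; rewrite gt_eqF.
rewrite eT in h.
have h' : mm A / 2 <= c / N `^ (p / 2) * I by lra.
rewrite mulrAC ler_pdivlMr// -mulrA.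
move: h'; rewrite mulrAC ler_pdivlMr//; lra.
Qed.

(** The average t of N signs has modulus at most 1, whence |t|^p <= |t| <= dl + t^2 / dl, and t^2
    has integral mu(A) / N. [dl] makes the first term contribute e^p / 2, and [M] is the size of N
    from which the second does not exceed that. *)
Lemma averages_null_rademacher : averages_null x.
Proof.
move=> e e0; have ep : 0 < e `^ p by rewrite powR_gt0.
pose dl := e `^ p / (2 * mm setT).
have dl0 : 0 < dl by rewrite divr_gt0// mulr_gt0.
have h1 : dl * mm setT = e `^ p / 2 by rewrite /dl; field; rewrite gt_eqF.
clearbody dl.
pose M := 2 * mm A / (dl * e `^ p).
have M0 : 0 < M by rewrite divr_gt0// mulr_gt0.
exists (Num.bound M).+1 => // s us sN; rewrite -sN.
have MN : M <= (size s)%:R.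
  by rewrite sN ltW// (lt_trans (archi_boundP (ltW M0)))// ltr_nat.
set N : R := (size s)%:R; have N0 : 0 < N by rewrite /N sN.
have rb n z : `|r n z| <= 1.
  rewrite -(@ler_pXn2r _ 2) ?nnegrE// real_normK ?num_real// r2 expr1n indicE.
  by case: (_ \in _).
have Sb z : `|\sum_(i <- s) r i z| <= N.
  apply: (le_trans (ler_norm_sum _ _ _)).
  apply: (@le_trans _ _ (\sum_(i <- s) 1)); first exact: ler_sum.
  by rewrite big_const_seq count_predT iter_addr_0.
rewrite leNgt; apply/negP => hlt.
have := gt0_ltr_powR p_gt0 _ _ hlt.
rewrite !nnegrE Lp_norm_ge0 mulr_ge0 ?(ltW e0) ?(ltW N0)// => /(_ isT isT).
apply/negP; rewrite -leNgt Lp_norm_sum_rademacher//.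
have Np : 0 < N `^ p by rewrite powR_gt0.
pose g z := (N `^ p * dl) * 1 + (N `^ p / (N ^+ 2 * dl)) * (\sum_(i <- s) r i z) ^+ 2.
have bc : bounded_measurable (fun _ : borelC R => 1 : R) by exact: bounded_measurable_cst.
apply: (@le_trans _ _ (\int[mu]_z g z)).
  apply: le_Rintegral_bounded.
  - exact: bounded_measurable_sum_powR.
  - by apply: (@bounded_measurable_lin _ _ (fun=> 1)) => //; exact: bounded_measurable_sumX2.
  move=> z; rewrite -norm_powRE /g; set S := \sum_(i <- s) r i z.
  pose t := `|S| / N.
  have t0 : 0 <= t by rewrite divr_ge0// ltW.
  have t1 : t <= 1 by rewrite ler_pdivrMr// mul1r; exact: Sb.
  have tS : `|S| = t * N by rewrite /t mulfVK// gt_eqF.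
  have S2 : S ^+ 2 = (t * N) ^+ 2 by rewrite -tS real_normK// num_real.
  have tp : t `^ p <= t.
    have [->|tn0] := eqVneq t 0; first by rewrite powR0// gt_eqF.
    by apply: ge1r_powR => //; rewrite lt_neqAle eq_sym tn0 t0 t1.
  have td : t <= dl + t ^+ 2 / dl.
    have [td|/ltW td] := leP t dl; first by rewrite (le_trans td)// lerDl divr_ge0 ?sqr_ge0// ltW.
    rewrite (@le_trans _ _ (t ^+ 2 / dl))//; last by rewrite lerDr ltW.
    by rewrite ler_pdivlMr// expr2 ler_wpM2l.
  rewrite tS powRM ?(ltW N0)// S2.
  apply: (@le_trans _ _ ((dl + t ^+ 2 / dl) * N `^ p)).
    by rewrite ler_wpM2r ?(ltW Np)// (le_trans tp).
  rewrite le_eqVlt; apply/orP; left; apply/eqP; field.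
  by rewrite !gt_eqF.
rewrite Rintegral_lin//; last exact: bounded_measurable_sumX2.
rewrite rs// Rintegral_cst// -/N powRM ?(ltW N0) ?(ltW e0)//.
have h2 : mm A / (N * dl) <= e `^ p / 2.
  move: MN; rewrite /M ler_pdivrMr ?mulr_gt0// => MN.
  rewrite ler_pdivrMr ?mulr_gt0// -/N; move: MN; rewrite -/N; lra.
rewrite (_ : _ + _ = N `^ p * (dl * mm setT + mm A / (N * dl))).
  by rewrite ler_wpM2l ?(ltW Np)// h1; lra.
by field; rewrite !gt_eqF.
Qed.

Lemma Lp_norm_rademacher n : Lp_norm (x n) `^ p = mm A.
Proof.
rewrite Lp_norm_real_class// -(Rintegral_indic mu mA).
apply: eq_Rintegral => z _; rewrite norm_powRE r2 indicE.
by case: (_ \in _); rewrite ?powR1// powR0// gt_eqF// divr_gt0.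
Qed.

End rademacher_sums.

(** * Localization and singular parts *)

Section restriction.
Context {R : realType} {p : R} (p1 : 1 <= p).
Variable mu : {finite_measure set borelC R -> \bar R}.
Implicit Types (S : set (borelC R)) (X : Lp mu p1).

Definition restr S : Lp mu p1 -> Lp mu p1 :=
  wc p1 mu mu (fun z : borelC R => (\1_S z)%:C%C : R[i]) id.

Lemma wdom_indic S : measurable S -> wdom (p := p) mu mu
  (fun z : borelC R => (\1_S z)%:C%C : R[i]) id.
Proof.
move=> mS; apply: (wdom_mul p1 (B := 1)).
  by apply: measurable_real_complex; exact: measurable_indic.
apply: aeW => z.
by rewrite normc_real indicE; case: (_ \in _); rewrite ?normr1 ?normr0.
Qed.

Lemma restr_oper S : measurable S -> oper (restr S).
Proof. by move=> /wdom_indic/wc_oper. Qed.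

Lemma restr_ae S X : measurable S ->
  {ae mu, forall z, Lp_fun (restr S X) z = (\1_S z)%:C%C * Lp_fun X z}.
Proof. by move=> /wdom_indic/wc_ae; exact. Qed.

Lemma restr_le S X : measurable S -> Lp_norm (restr S X) <= Lp_norm X.
Proof.
move=> mS; rewrite -[leRHS]mul1r; apply: pint_wc_mul => //; first exact: wdom_indic.
apply: aeW => z.
by rewrite normc_real indicE; case: (_ \in _); rewrite ?normr1 ?normr0.
Qed.

Lemma restr_id S X : measurable S -> restr S (restr S X) = restr S X.
Proof.
move=> mS; apply/Lp_eqP.
apply: filterS2 (restr_ae X mS) (restr_ae (restr S X) mS) => z h ->; rewrite h mulrA.
by rewrite indicE; case: (_ \in _); rewrite ?mul1r// !mul0r.
Qed.

Lemma restrU S1 S2 X : measurable S1 -> measurable S2 -> S1 `&` S2 = set0 ->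
  restr (S1 `|` S2) X = restr S1 X + restr S2 X.
Proof.
move=> m1 m2 S12; apply/Lp_eqP.
apply: filterS3 (restr_ae X (measurableU _ _ m1 m2)) (Lp_addE (restr S1 X) (restr S2 X))
  (filterI (restr_ae X m1) (restr_ae X m2)) => z -> -> [-> ->].
rewrite -mulrDl -rmorphD/= !indicE in_setU.
have [z1|] := boolP (z \in S1); have [z2|] := boolP (z \in S2) => //=;
  rewrite ?addr0 ?add0r//.
by have := in_set0 z; rewrite -S12 in_setI z1 z2.
Qed.

Lemma restr0 X : restr set0 X = 0.
Proof.
apply/Lp_eqP; apply: filterS2 (restr_ae X measurable0) (Lp_zeroE p1 mu) => z -> ->.
by rewrite indicE in_set0 mul0r.
Qed.

Lemma restrT X : restr setT X = X.
Proof.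
apply/Lp_eqP; apply: filterS (restr_ae X measurableT) => z ->.
by rewrite indicE in_setT mul1r.
Qed.

Variable cmu : compact (supp mu).

Definition shifted (a : R[i]) X : Lp mu p1 := mult_op p1 cmu X - a *: X.

Lemma shifted_oper a : oper (shifted a).
Proof.
apply: oper_sub; first exact: mult_op_oper.
by apply: oper_scale; exact: oper_id.
Qed.

Lemma shifted_ae a X :
  {ae mu, forall z, Lp_fun (shifted a X) z = ((z : R[i]) - a) * Lp_fun X z}.
Proof.
have e : shifted a X = mult_op p1 cmu X + (- a) *: X by rewrite scaleNr.
rewrite e; apply: filterS3 (Lp_addE (mult_op p1 cmu X) (- a *: X)) (Lp_scaleE (- a) X)
  (@mult_op_ae R p p1 mu cmu X) => z -> -> ->.
by rewrite mulrDl mulNr.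
Qed.

Lemma shifted_le a (rho : R) S X : measurable S -> 0 <= rho ->
  S `<=` [set z : borelC R | normc ((z : R[i]) - a) <= rho] -> restr S X = X ->
  Lp_norm (shifted a X) <= rho * Lp_norm X /\ restr S (shifted a X) = shifted a X.
Proof.
move=> mS r0 Sa SX.
have hX : {ae mu, forall z, Lp_fun X z = (\1_S z)%:C%C * Lp_fun X z}.
  by apply: filterS (restr_ae X mS) => z <-; rewrite SX.
split.
  have wr : Lp_norm ((rho%:C)%C *: X) = rho * Lp_norm X.
    have := normrZ (rho%:C)%C X; rewrite normr_normc normc_real ger0_norm//.
    by rewrite !Lp_normE -rmorphM => -[].
  rewrite -wr; apply: Lp_norm_ae_le.
  apply: filterS3 (shifted_ae a X) (Lp_scaleE (rho%:C)%C X) hX => z -> -> ->.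
  rewrite indicE; have [/set_mem zS|zS] := boolP (z \in S).
    by rewrite mul1r !normcM normc_real ger0_norm// ler_wpM2r ?normc_ge0//; exact: Sa.
  by rewrite !mul0r !mulr0.
apply/Lp_eqP; apply: filterS3 (restr_ae (shifted a X) mS) (shifted_ae a X) hX.
by move=> z -> -> h; rewrite mulrCA -h.
Qed.

Lemma shifted_ge a (rho : R) S X : measurable S -> 0 < rho ->
  S `<=` [set z : borelC R | rho <= normc ((z : R[i]) - a)] ->
  rho * Lp_norm (restr S X) <= Lp_norm (restr S (shifted a X)).
Proof.
move=> mS r0 Sa.
have wr : Lp_norm ((rho%:C)%C *: restr S X) = rho * Lp_norm (restr S X).
  have := normrZ (rho%:C)%C (restr S X); rewrite normr_normc normc_real gtr0_norm//.
  by rewrite !Lp_normE -rmorphM => -[].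
rewrite -wr; apply: Lp_norm_ae_le.
apply: filterS3 (filterI (restr_ae (shifted a X) mS) (shifted_ae a X))
  (Lp_scaleE (rho%:C)%C (restr S X)) (restr_ae X mS) => z [-> ->] -> ->.
rewrite indicE; have [/set_mem zS|zS] := boolP (z \in S).
  by rewrite !mul1r !normcM normc_real gtr0_norm// ler_wpM2r ?normc_ge0//; exact: Sa.
by rewrite !mul0r !mulr0.
Qed.

End restriction.

(** * Concentration of the images near a compact set *)

Section localization.
Context {R : realType} {p : R} (p_gt1 : 1 < p).
Let p1 : 1 <= p := ltW p_gt1.
Variables (mu1 mu2 : {finite_measure set borelC R -> \bar R}).
Variables (cmu1 : compact (supp mu1)) (cmu2 : compact (supp mu2)).
Variable W : Lp mu1 p1 -> Lp mu2 p1.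
Hypothesis oW : oper W.
Hypothesis cC : compact_operator
  (fun X => W (mult_op p1 cmu1 X) - mult_op p1 cmu2 (W X)).
Variables (x : nat -> Lp mu1 p1) (B : R).
Hypotheses (B0 : 0 < B) (xB : forall n, Lp_norm (x n) <= B) (ax : averages_null x).
Local Notation T1 := (shifted (p1 := p1) cmu1).
Local Notation T2 := (shifted (p1 := p1) cmu2).

Lemma commutator_null a (D : Lp mu1 p1 -> Lp mu1 p1) : oper D ->
  null_seq (fun n => W (T1 a (D (x n))) - T2 a (W (D (x n)))).
Proof.
move=> oD; have := compact_averages_null (compact_operator_compr cC oD) B0 xB ax.
apply: null_seq_ext => n; rewrite /shifted (operB oW) (operZ oW).
by rewrite opprB addrA subrK.
Qed.

Lemma localize_disc a (rho : R) S Q : 0 < rho -> measurable S -> measurable Q ->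
  S `<=` [set z : borelC R | normc ((z : R[i]) - a) <= rho] ->
  Q `<=` [set z : borelC R | 2 * rho <= normc ((z : R[i]) - a)] ->
  null_seq (fun n => restr Q (W (restr S (x n)))).
Proof.
move=> r0 mS mQ Sa Qa.
have r20 : 0 < 2 * rho by rewrite mulr_gt0.
have oTk k : oper (fun X => iter k (T1 a) (restr S X)).
  elim: k => [|k IH]; first exact: restr_oper.
  exact: (oper_comp (shifted_oper p1 cmu1 a) IH).
(* One more factor M - a is moved across [W] at each step. Its commutator error tends to 0 since
   [iter k] only precomposes the compact commutator; the tolerance carries (2 rho)^(k+1) to make up
   for the later division. *)
have key k e : 0 < e -> exists n0, forall n, (n0 <= n)%N ->
    Lp_norm (restr Q (W (restr S (x n)))) <=
    (2 * rho) ^- k * Lp_norm (restr Q (W (iter k (T1 a) (restr S (x n))))) + e.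
  elim: k e => [|k IH] e e0.
    by exists 0%N => n _; rewrite expr0 invr1 mul1r lerDl ltW.
  have [|n1 h1] := IH (e / 2); first by rewrite divr_gt0.
  have [|n2 h2] := commutator_null a (oTk k) (e := (2 * rho) ^+ k.+1 * (e / 2)).
    by rewrite mulr_gt0 ?divr_gt0// exprn_gt0.
  exists (maxn n1 n2) => n; rewrite geq_max => /andP[/h1 k1 /h2].
  set Y := iter k (T1 a) (restr S (x n)) in k1 * => k2.
  rewrite iterS -/Y; apply: (le_trans k1).
  have h3 := shifted_ge cmu2 (W Y) mQ r20 Qa.
  have h4 : Lp_norm (restr Q (T2 a (W Y))) <=
      Lp_norm (restr Q (W (T1 a Y))) + (2 * rho) ^+ k.+1 * (e / 2).
    have -> : T2 a (W Y) = W (T1 a Y) - (W (T1 a Y) - T2 a (W Y)) by rewrite subKr.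
    rewrite (operB (restr_oper p1 mu2 mQ)) (le_trans (Lp_ler_normB _ _))// lerD2l.
    by apply: le_trans k2; exact: restr_le.
  have -> : (2 * rho) ^- k.+1 * Lp_norm (restr Q (W (T1 a Y))) + e =
      (2 * rho) ^- k.+1 * (Lp_norm (restr Q (W (T1 a Y))) +
      (2 * rho) ^+ k.+1 * (e / 2)) + e / 2.
    by field; rewrite expf_neq0// gt_eqF.
  rewrite lerD2r; apply: (@le_trans _ _ ((2 * rho) ^- k * ((2 * rho)^-1 *
      Lp_norm (restr Q (T2 a (W Y)))))).
    by rewrite ler_wpM2l ?invr_ge0 ?exprn_ge0 ?(ltW r20)// ler_pdivlMl.
  by rewrite mulrA -invfM -exprSr ler_wpM2l// invr_ge0 exprn_ge0// ltW.
move=> e e0; have [M M0 WM] := oper_Lp_bounded oW.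
have iterb k X : Lp_norm (iter k (T1 a) (restr S X)) <= rho ^+ k * Lp_norm X /\
    restr S (iter k (T1 a) (restr S X)) = iter k (T1 a) (restr S X).
  elim: k => [|k [IH IH']]; first by rewrite expr0 mul1r restr_le// restr_id.
  have [h1 h2] := shifted_le cmu1 mS (ltW r0) Sa IH'.
  by rewrite iterS h2; split=> //; rewrite (le_trans h1)// exprS -mulrA ler_wpM2l// ltW.
(* After k factors the main term is at most (2 rho)^-k * M * rho^k * B, in which rho cancels. *)
have [k hk] : exists k, (2 ^+ k)^-1 * (M * B) <= e / 2.
  have [N hN] := inv_exp2_small (divr_gt0 (divr_gt0 e0 (ltr0n _ 2)) (mulr_gt0 M0 B0)).
  by exists N; rewrite -ler_pdivlMr ?mulr_gt0// hN.
have [|n0 h] := key k (e / 2); first by rewrite divr_gt0.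
exists n0 => n /h h'; rewrite (le_trans h')// [leRHS]splitr lerD2r.
apply: le_trans hk.
have h1 : Lp_norm (restr Q (W (iter k (T1 a) (restr S (x n))))) <= M * (rho ^+ k * B).
  apply: (le_trans (restr_le _ _)) => //; apply: (le_trans (WM _)).
  rewrite ler_wpM2l ?(ltW M0)//; have [h1 _] := iterb k (x n).
  by rewrite (le_trans h1)// ler_wpM2l// exprn_ge0// ltW.
apply: (@le_trans _ _ ((2 * rho) ^- k * (M * (rho ^+ k * B)))).
  by rewrite ler_wpM2l// invr_ge0 exprn_ge0// ltW.
rewrite le_eqVlt; apply/orP; left; apply/eqP; rewrite exprMn; field.
by rewrite !expf_neq0// ?gt_eqF// pnatr_eq0.
Qed.

(** The part of [S] in the first disc is handled by [localize_disc], since the doubled disc lies in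
    [U]; the rest is covered by the remaining discs. *)
Lemma localize_cover (l : seq (R[i] * R)) S (U : set (borelC R)) :
  measurable S -> measurable U ->
  (forall q, q \in l -> 0 < q.2 /\
    [set z : borelC R | normc ((z : R[i]) - q.1) < 2 * q.2] `<=` U) ->
  (forall z : borelC R, S z -> exists2 q, q \in l & normc ((z : R[i]) - q.1) < q.2) ->
  null_seq (fun n => restr (~` U) (W (restr S (x n)))).
Proof.
move=> + mU; have mU' := measurableC mU.
elim: l S => [|q l IH] S mS lU Sl.
  have S0 : S = set0 by apply/seteqP; split => z // /Sl[].
  move=> e e0; exists 0%N => n _.
  by rewrite S0 restr0 (oper0 oW) (oper0 (restr_oper p1 mu2 mU')) Lp_norm0 ltW.
have [q0 qU] := lU q (mem_head _ _).
pose D : set (borelC R) := [set z : borelC R | normc ((z : R[i]) - q.1) < q.2].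
have mD : measurable D.
  by apply: open_measurableC; exact: open_disc.
have m1 : measurable (S `&` D) by exact: measurableI.
have m2 : measurable (S `\` D) by exact: measurableD.
have n1 := @localize_disc q.1 q.2 (S `&` D) (~` U) q0 m1 mU'.
have n2 : null_seq (fun n => restr (~` U) (W (restr (S `\` D) (x n)))).
  apply: IH => // [r rl|z [Sz Dz]]; first by apply: lU; rewrite inE rl orbT.
  have [r] := Sl z Sz; rewrite inE => /orP[/eqP -> //|rl] zr.
  by exists r.
have {}n1 : null_seq (fun n => restr (~` U) (W (restr (S `&` D) (x n)))).
  apply: n1 => z; first by move=> [_ /ltW].
  by move=> Uz; rewrite /= leNgt; apply/negP => h; apply: Uz; exact: qU.
apply: null_seq_ext (null_seqD n1 n2) => n.
rewrite -(operD (restr_oper p1 mu2 mU')) -(operD oW) -restrU//.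
  by rewrite setUIDK.
by apply/seteqP; split => z // [[_ ?] []].
Qed.

Lemma localize (A U : set (borelC R)) : measurable A -> compact (A : set R[i]) ->
  open (U : set R[i]) -> A `<=` U ->
  null_seq (fun n => restr (~` U) (W (restr A (x n)))).
Proof.
move=> mA; rewrite compact_cover => cA oU AU.
have /choice[f hf] (a : R[i]) : exists r : R, A a -> 0 < r /\
    [set z : borelC R | normc ((z : R[i]) - a) < 2 * r] `<=` U.
  have [/AU Ua|nA] := pselect (A a); last by exists 0.
  have [e e0 eU] := (open_normcP U).1 oU a Ua.
  exists (e / 2) => _; split; first by rewrite divr_gt0.
  move=> z /= h; apply: eU; rewrite -normc_opp opprB; move: h; lra.
have [||D DA AD] := cA R[i] A (fun a => [set z | normc (z - a) < f a]).
- by move=> a _; exact: open_disc.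
- by move=> a Aa; exists a => //=; rewrite subrr normc0; have [] := hf a Aa.
apply: (@localize_cover [seq (a, f a) | a <- finmap.enum_fset D]) => //.
- exact: open_measurableC.
- by move=> q /mapP[a /DA/set_mem/hf[a0 aU] ->].
- by move=> z /AD[a Da h]; exists (a, f a) => //; exact: map_f.
Qed.

End localization.

Section restriction_norm.
Context {R : realType} {p : R} (p1 : 1 <= p).
Let p_gt0 : 0 < p. Proof. exact: lt_le_trans p1. Qed.
Variable mu : {finite_measure set borelC R -> \bar R}.
Implicit Types (S : set (borelC R)) (X : Lp mu p1).

Let powX X (z : borelC R) : R := normc (Lp_fun X z) `^ p.

Let mpowX X : measurable_fun setT (EFin \o powX X).
Proof. by apply: measurable_normc_powR; exact: LfunC_measurable. Qed.

Lemma Lp_norm_restr S X : measurable S ->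
  (Lp_norm (restr S X) `^ p)%:E =
  (\int[mu]_z (\1_S z * normc (Lp_fun X z) `^ p)%:E)%E.
Proof.
move=> mS; rewrite Lp_norm_pint.
have h := @pint_ae_eq R p p1 _ _ mu (Lp_fun (restr S X))
  (fun z => (\1_S z)%:C%C * Lp_fun X z).
rewrite h; [|exact: LfunC_measurable| |exact: restr_ae].
  apply: eq_integral => z _; rewrite normcM normc_real indicE.
  case: (z \in S); first by rewrite normr1 !mul1r.
  by rewrite normr0 !mul0r (powR0 (lt0r_neq0 p_gt0)).
apply: measurable_mulC; last exact: LfunC_measurable.
by apply: measurable_real_complex; exact: measurable_indic.
Qed.

Lemma Lp_norm_restrC S X : measurable S ->
  Lp_norm X `^ p = Lp_norm (restr S X) `^ p + Lp_norm (restr (~` S) X) `^ p.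
Proof.
move=> mS; have mS' := measurableC mS; apply: EFin_inj.
rewrite EFinD [X in _ = (X + _)%E](Lp_norm_restr X mS).
rewrite [X in _ = (_ + X)%E](Lp_norm_restr X mS') (Lp_norm_pint X) /pint.
rewrite -ge0_integralD//.
- apply: eq_integral => z _; rewrite -EFinD -mulrDl !indicE in_setC.
  by case: (z \in S); rewrite /= ?addr0 ?add0r mul1r.
- by move=> z _; rewrite lee_fin mulr_ge0// powR_ge0.
- apply/measurable_EFinP; apply: measurable_funM; first exact: measurable_indic.
  by apply/measurable_EFinP; exact: mpowX.
- by move=> z _; rewrite lee_fin mulr_ge0// powR_ge0.
- apply/measurable_EFinP; apply: measurable_funM; first exact: measurable_indic.
  by apply/measurable_EFinP; exact: mpowX.
Qed.

Lemma restr_decreasing (U : nat -> set (borelC R)) X e :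
  (forall n, measurable (U n)) ->
  {ae mu, forall z, exists n0, forall n, (n0 <= n)%N -> ~ U n z} ->
  0 < e -> exists n, Lp_norm (restr (U n) X) <= e.
Proof.
move=> mU U0 e0.
pose f n (z : borelC R) := (\1_(U n) z * normc (Lp_fun X z) `^ p)%:E.
have [|||||_ _] := @dominated_convergence _ _ R mu setT measurableT f (cst 0%E)
  (EFin \o powX X).
- move=> n; apply/measurable_EFinP; apply: measurable_funM; first exact: measurable_indic.
  by apply/measurable_EFinP; exact: mpowX.
- exact: measurable_cst.
- apply: filterS U0 => z [n0 h] _; apply: cvg_near_cst; exists n0 => // n /= /h Uz.
  by rewrite /f indicE memNset// mul0r.
- apply/integrableP; split; first exact: mpowX.
  have := LfunC_pint (Lp_fun X); congr (_ < _)%E; apply: eq_integral => z _ /=.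
  by rewrite ger0_norm// powR_ge0.
- apply: aeW => z n _; rewrite /f /= lee_fin ger0_norm ?mulr_ge0 ?powR_ge0//.
  by rewrite ler_piMl ?powR_ge0// indicE; case: (_ \in _).
rewrite integral0 => /fine_cvg/cvgrPdist_le/(_ (e `^ p)).
rewrite powR_gt0// => /(_ isT)[n _ /(_ n (leqnn n))] /=.
rewrite sub0r normrN -(Lp_norm_restr X (mU n)) /= ger0_norm ?powR_ge0// => h.
exists n; rewrite leNgt; apply/negP => h'.
have := gt0_ltr_powR p_gt0 _ _ h'; rewrite !nnegrE Lp_norm_ge0 ltW// => /(_ isT isT).
by rewrite ltNge h.
Qed.

(** The 1 / (n + 1)-neighbourhoods of a closed set decrease to it, so by dominated convergence the
    mass of |X|^p on them tends to its mass on a null set. *)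
Lemma small_neighborhood (A : set (borelC R)) X e : compact (A : set R[i]) ->
  mu A = 0%E -> 0 < e ->
  exists U : set (borelC R), [/\ open (U : set R[i]), A `<=` U & Lp_norm (restr U X) <= e].
Proof.
move=> cA A0 e0.
have clA : closed (A : set R[i]).
  by apply: compact_closed => //; exact: norm_hausdorff.
pose U n : set (borelC R) :=
  \bigcup_(a in (A : set R[i])) [set z : R[i] | normc (z - a) < n.+1%:R^-1].
have oU n : open (U n : set R[i]) by apply: bigcup_open => a _; exact: open_disc.
have mU n : measurable (U n) by exact: open_measurableC.
have [|n hn] := @restr_decreasing U X e mU _ e0.
  exists A; split => //; first exact: closed_measurableC.
  move=> z /= h; apply: contrapT => nAz; apply: h.
  have /open_normcP/(_ z nAz)[d d0 dA] := closed_openC clA.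
  have [n hn] := ltr_add_invr (y := 0) d0.
  exists n => m nm [a Aa h]; apply: (dA a _ Aa); apply: (lt_trans h).
  apply: le_lt_trans hn; rewrite add0r lef_pV2 ?posrE ?ltr0n// ler_nat ltnS.
  exact: nm.
exists (U n); split => // z Az; exists z => //=.
by rewrite subrr normc0 invr_gt0 ltr0n.
Qed.

Lemma powR_continuous_at (a e : R) : 0 <= a -> 0 < e -> exists2 d, 0 < d &
  forall b, 0 <= b -> `|b - a| <= d -> `|b `^ p - a `^ p| <= e.
Proof.
(* At 0 the explicit choice d = e^(1/p) is used; elsewhere continuity comes from
   differentiability. *)
rewrite le_eqVlt => /orP[/eqP <-|a0] e0.
  exists (e `^ p^-1); first by rewrite powR_gt0.
  move=> b b0; rewrite !subr0 powR0 ?gt_eqF// subr0 !ger0_norm ?powR_ge0// => h.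
  have -> : e = (e `^ p^-1) `^ p by rewrite -powRrM mulVf ?gt_eqF// powRr1// ltW.
  by apply: ge0_ler_powR; rewrite ?nnegrE ?powR_ge0// ltW.
have /derivable1_diffP/differentiable_continuous : derivable (fun x : R => x `^ p) a 1.
  exact: (@ex_derive _ _ _ _ _ _ _ (is_derive1_powR p a0)).
move=> /cvgrPdist_le/(_ e e0)/nbhs_ballP[d /= d0 h].
exists (d / 2); first by rewrite divr_gt0.
move=> b b0 bd; rewrite distrC; apply: h; rewrite /ball/= distrC.
by rewrite (le_lt_trans bd)// gtr_pMr// invf_lt1 ?ltr1n.
Qed.

End restriction_norm.

(** * Almost disjoint sequences against Rademacher sums *)

Section singular_parts.
Context {R : realType} {p : R} (p_gt1 : 1 < p).
Let p1 : 1 <= p := ltW p_gt1.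
Let p_gt0 : 0 < p. Proof. exact: lt_le_trans p1. Qed.
Variables (mu1 mu2 : {finite_measure set borelC R -> \bar R}).
Variables (cmu1 : compact (supp mu1)) (cmu2 : compact (supp mu2)).
Variables (W : Lp mu1 p1 -> Lp mu2 p1) (V : Lp mu2 p1 -> Lp mu1 p1).
Hypotheses (oW : oper W) (oV : oper V) (WV : cancel W V).
Hypothesis cC : compact_operator
  (fun X => W (mult_op p1 cmu1 X) - mult_op p1 cmu2 (W X)).
Variable A : set (borelC R).
Hypotheses (mA : measurable A) (cA : compact (A : set R[i])) (A2 : mu2 A = 0%E).

(* Off a small neighbourhood of the [mu2]-null set [A] the vector [W (x n)] is
   small, while [g] is small on that neighbourhood: the two are almost disjoint. *)
Lemma almost_disjoint_step (x : nat -> Lp mu1 p1) (B c0 B1 : R) :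
  0 < B -> (forall n, Lp_norm (x n) <= B) -> averages_null x ->
  (forall n, restr A (x n) = x n) -> 0 < c0 ->
  (forall n, c0 <= Lp_norm (W (x n)) <= B1) ->
  forall (g : Lp mu2 p1) N0, exists2 n, (N0 <= n)%N &
    Lp_norm g `^ p + c0 `^ p / 4 <= Lp_norm (g + W (x n)) `^ p <=
    Lp_norm g `^ p + ((B1 + 1) `^ p + c0 `^ p / 4).
Proof.
move=> B0 xB ax xA c00 Wx g N0; have c1 : 0 < c0 `^ p by rewrite powR_gt0.
have [|d1 d10 h1] := powR_continuous_at p1 (Lp_norm_ge0 g) (e := c0 `^ p / 4).
  by rewrite divr_gt0.
have [|d2 d20 h2] := powR_continuous_at p1 (ltW c00) (e := c0 `^ p / 2).
  by rewrite divr_gt0.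
(* On [U] the sum is essentially [W (x n)], off [U] essentially [g]. Each part suffers two errors of
   size e, from the mass its main term has elsewhere and from the other term; hence the bounds on 2
   * e. *)
have [e e0 [ed1 ed2 e1 ec]] : exists2 e : R, 0 < e &
    [/\ 2 * e <= d1, 2 * e <= d2, 2 * e <= 1 & 2 * e <= c0].
  exists (Num.min (Num.min d1 d2) (Num.min 1 c0) / 2).
    by rewrite divr_gt0// !lt_min d10 d20 ltr01.
  by rewrite mulrCA divff ?mulr1 ?pnatr_eq0// !ge_min !lexx !orbT.
have [U [oU AU Ug]] := small_neighborhood g cA A2 e0.
have mU : measurable U by exact: open_measurableC.
have mU' := measurableC mU.
have [n0 hn] := localize oW cC B0 xB ax mA cA oU AU e0.
pose n := maxn N0 n0; exists n; first exact: leq_maxl.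
have := hn n (leq_maxr _ _); rewrite xA => Uy.
have /andP[y0 yB] := Wx n.
set y := W (x n) in Uy y0 yB *.
have oU1 := restr_oper p1 mu2 mU; have oU2 := restr_oper p1 mu2 mU'.
have split_ (X : Lp mu2 p1) : Lp_norm X <= Lp_norm (restr U X) + Lp_norm (restr (~` U) X).
  have h := restrU X mU mU' (setICr U).
  rewrite setUv restrT in h; rewrite {1}h; exact: Lp_ler_normD.
rewrite (Lp_norm_restrC (g + y) mU) (operD oU1) (operD oU2).
set u := Lp_norm (_ + _); set v := Lp_norm (_ + _).
have u1 : Lp_norm y - 2 * e <= u.
  have := Lp_ler_distD (restr U y) (- restr U g).
  by rewrite opprK Lp_normN addrC [restr U y + _]addrC -/u; have := split_ y; lra.
have u2 : u <= B1 + 1.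
  have := Lp_ler_normD (restr U g) (restr U y); rewrite -/u.
  by have := restr_le y mU; lra.
have v1 : `|v - Lp_norm g| <= 2 * e.
  rewrite ler_distl; apply/andP; split.
    have := Lp_ler_distD (restr (~` U) g) (- restr (~` U) y).
    by rewrite opprK Lp_normN -/v; have := split_ g; lra.
  have := Lp_ler_normD (restr (~` U) g) (restr (~` U) y); rewrite -/v.
  by have := restr_le g mU'; lra.
have := h1 v (Lp_norm_ge0 _) (le_trans v1 ed1).
rewrite ler_distl => /andP[v2 v3].
have u3 : (c0 - 2 * e) `^ p <= u `^ p.
  have h : 0 <= c0 - 2 * e by rewrite subr_ge0.
  apply: ge0_ler_powR => //; [exact: ltW|by rewrite nnegrE Lp_norm_ge0|lra].
have u4 : u `^ p <= (B1 + 1) `^ p.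
  have u0 : 0 <= u by exact: Lp_norm_ge0.
  apply: ge0_ler_powR => //; [exact: ltW|by rewrite nnegrE (le_trans u0)].
have := h2 (c0 - 2 * e); rewrite subr_ge0 => /(_ ec).
rewrite addrAC subrr add0r normrN ger0_norm ?mulr_ge0 ?(ltW e0)// => /(_ ed2).
rewrite ler_distl => /andP[+ _].
move: v2 v3 u3 u4; move: (u `^ p) (v `^ p) (Lp_norm g `^ p) (c0 `^ p)
  ((c0 - 2 * e) `^ p) ((B1 + 1) `^ p) => *.
by apply/andP; split; lra.
Qed.

(** A greedy choice: each new index exceeds all earlier ones and adds to the p-th power of the norm
    an amount between two fixed positive constants. *)
Lemma almost_disjoint_sums (x : nat -> Lp mu1 p1) (B c0 B1 : R) :
  0 < B -> (forall n, Lp_norm (x n) <= B) -> averages_null x ->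
  (forall n, restr A (x n) = x n) -> 0 < c0 ->
  (forall n, c0 <= Lp_norm (W (x n)) <= B1) ->
  forall N, exists s : seq nat, [/\ uniq s, size s = N &
    N%:R * (c0 `^ p / 4) <= Lp_norm (W (\sum_(i <- s) x i)) `^ p <=
    N%:R * ((B1 + 1) `^ p + c0 `^ p / 4)].
Proof.
move=> B0 xB ax xA c00 Wx; elim => [|N [s [us sN /andP[h1 h2]]]].
  by exists [::]; rewrite big_nil (oper0 oW) Lp_norm0 powR0 ?gt_eqF// !mul0r lexx.
have [n nN /andP[k1 k2]] := almost_disjoint_step B0 xB ax xA c00 Wx
  (W (\sum_(i <- s) x i)) (\max_(i <- s) i).+1.
exists (n :: s); split.
- rewrite /= us andbT; apply/negP => ns; move: nN.
  by rewrite ltnNge (@leq_bigmax_seq _ s xpredT id n ns isT).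
- by rewrite /= sN.
rewrite big_cons addrC (operD oW) -natr1 !mulrDl !mul1r.
apply/andP; split; lra.
Qed.

Hypothesis p_neq2 : p != 2.

(** One-sided bounds suffice. For p < 2 the upper bound on Rademacher sums, carried over by [W],
    contradicts the linear lower bound; for p > 2 their lower bound, carried over through [V],
    contradicts the linear upper bound. *)
Lemma singular_diffuse_null : diffuse_on mu1 A -> ~ (0 < mu1 A)%E.
Proof.
move=> dA A1.
have [B _ AB] := compact_normc_bounded cA.
have [r [br r2 rs]] := rademacher mA AB dA.
pose x n := real_class p1 mu1 (r n).
pose b0 := fine (mu1 A) `^ p^-1.
have m0 : 0 < fine (mu1 A) by rewrite -lte_fin -fine_measureE.
have b00 : 0 < b0 by rewrite powR_gt0.
have xE n : Lp_norm (x n) = b0.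
  have := Lp_norm_rademacher p_gt1 mu1 mA br r2 n; rewrite -/(x n) /b0 => <-.
  by rewrite -powRrM mulfV ?gt_eqF// powRr1// Lp_norm_ge0.
have xA n : restr A (x n) = x n.
  apply/Lp_eqP; apply: filterS2 (restr_ae (x n) mA) (real_classE p1 mu1 (br n)) => z -> ->.
  rewrite indicE; have [_|zA] := boolP (z \in A); first by rewrite mul1r.
  have := r2 n z; rewrite indicE (negbTE zA) => /eqP.
  by rewrite sqrf_eq0 => /eqP ->; rewrite mul0r.
have ax : averages_null x.
  exact: (averages_null_rademacher p_gt1 mA A1 br r2 rs).
have [M M0 WM] := oper_Lp_bounded oW.
have [M' M'0 VM] := oper_Lp_bounded oV.
have WM' X : Lp_norm X <= M' * Lp_norm (W X) by rewrite -{1}(WV X).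
pose c0 := b0 / M'; have c00 : 0 < c0 by rewrite divr_gt0.
have Wx n : c0 <= Lp_norm (W (x n)) <= M * b0.
  apply/andP; split; last by rewrite -(xE n).
  by rewrite ler_pdivrMr// mulrC -(xE n).
have xB n : Lp_norm (x n) <= b0 by rewrite xE.
have sums := almost_disjoint_sums b00 xB ax xA c00 Wx.
have c1 : 0 < c0 `^ p / 4 by rewrite divr_gt0// powR_gt0.
have C1 : 0 < (M * b0 + 1) `^ p + c0 `^ p / 4.
  by rewrite addr_gt0// powR_gt0// addr_gt0// mulr_gt0.
set c := c0 `^ p / 4 in c1 sums; set C := _ + c in C1 sums.
have Mp : 0 < M `^ p by rewrite powR_gt0.
have Mp' : 0 < M' `^ p by rewrite powR_gt0.
have powM (K a b : R) : 0 < K -> 0 <= a -> 0 <= b -> a <= K * b -> a `^ p <= K `^ p * b `^ p.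
  move=> K0 a0 b0' ab; rewrite -powRM ?(ltW K0)//.
  by apply: ge0_ler_powR => //; [exact: ltW|rewrite nnegrE mulr_ge0// ltW].
have [p2|p2|p2] := ltgtP p 2; last by move: p_neq2; rewrite p2 eqxx.
  pose K := fine (mu1 setT) + fine (mu1 A).
  have K0 : 0 < K by rewrite ltr_wpDl// fine_ge0// measure_ge0.
  (* N is so large that the two bounds combine to N c <= N c / 2. *)
  have [||N N0 hN] := @natr_powR_small R (p / 2 - 1) (c / (2 * (M `^ p * K))).
  - by rewrite subr_lt0 ltr_pdivrMr// mul1r.
  - by rewrite divr_gt0// !mulr_gt0.
  have [s [us sN /andP[h1 _]]] := sums N.
  have s0 : (0 < size s)%N by rewrite sN.
  have h2 := rademacher_sum_le p_gt1 br rs p2 us s0.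
  have h3 := powM _ _ _ M0 (Lp_norm_ge0 _) (Lp_norm_ge0 _) (WM (\sum_(i <- s) x i)).
  have Nr : 0 < N%:R :> R by rewrite ltr0n.
  have NE : N%:R `^ (p / 2) = N%:R * N%:R `^ (p / 2 - 1) :> R.
    rewrite -{1}(subrK 1 (p / 2)) powRD; last by apply/implyP => _; rewrite gt_eqF.
    by rewrite powRr1 ?(ltW Nr)// mulrC.
  have : N%:R * c <= N%:R * (c / 2).
    apply: (le_trans h1); apply: (le_trans h3).
    apply: (@le_trans _ _ (M `^ p * (K * (N%:R * (c / (2 * (M `^ p * K))))))).
      rewrite ler_wpM2l ?(ltW Mp)//; apply: (le_trans h2).
      by rewrite sN NE ler_wpM2l ?(ltW K0)// ler_wpM2l// ltW.
    rewrite le_eqVlt; apply/orP; left; apply/eqP; field.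
    by rewrite !gt_eqF.
  by rewrite ler_pM2l// ler_pMr// leNgt invf_lt1 ?ltr1n.
have [K K0 hK] := rademacher_sum_ge p_gt1 mA A1 br rs p2.
have [||N N0 hN] := @natr_powR_small R (1 - p / 2) (1 / (2 * (K * M' `^ p * C))).
- by rewrite subr_lt0 ltr_pdivlMr// mul1r.
- by rewrite divr_gt0// !mulr_gt0.
have [s [us sN /andP[_ h1]]] := sums N.
have s0 : (0 < size s)%N by rewrite sN.
have h2 := hK s us s0.
have h3 := powM _ _ _ M'0 (Lp_norm_ge0 _) (Lp_norm_ge0 _) (WM' (\sum_(i <- s) x i)).
have Nr : 0 < N%:R :> R by rewrite ltr0n.
have NE : N%:R = N%:R `^ (1 - p / 2) * N%:R `^ (p / 2) :> R.
  rewrite -powRD; last by apply/implyP => _; rewrite gt_eqF.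
  by rewrite subrK powRr1// ltW.
have : N%:R <= N%:R * (1 / 2) :> R.
  rewrite {1}NE.
  apply: (@le_trans _ _ (1 / (2 * (K * M' `^ p * C)) * (K * (M' `^ p * (N%:R * C))))).
    apply: ler_pM; rewrite ?powR_ge0//.
    rewrite -sN (le_trans h2)// ler_wpM2l ?(ltW K0)// (le_trans h3)//.
    by rewrite sN ler_wpM2l// ltW.
  rewrite le_eqVlt; apply/orP; left; apply/eqP; field.
  by rewrite !gt_eqF.
by rewrite ler_pMr// div1r leNgt invf_lt1 ?ltr1n.
Qed.

End singular_parts.

(** * Absolute continuity of the nonatomic parts *)

Section necessity.
Context {R : realType} {p : R} (p_gt1 : 1 < p) (p_neq2 : p != 2).
Let p1 : 1 <= p := ltW p_gt1.
Implicit Types mu : {finite_measure set borelC R -> \bar R}.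

Lemma negligible_point_masses mu1 mu2 :
  mu1.-negligible (point_masses mu2 `\` point_masses mu1).
Proof.
have [D [a [e [_ aP _]]]] := enum_point_masses mu2.
apply: (@negligibleS _ _ _ mu1
  (\bigcup_n ([set a n : borelC R] `\` point_masses mu1))).
  by move=> z [/aP[_ az] Pz]; exists (e z) => //; rewrite az.
apply: negligible_bigcup => n.
exists ([set a n] `\` point_masses mu1); split => //.
  by apply: measurableD; [exact: measurable_set1C|exact: measurable_point_masses].
have [h|h] := pselect (point_masses mu1 (a n)).
  rewrite (_ : _ `\` _ = set0) ?measure0//.
  by apply/seteqP; split => z // [/= ->].
apply/eqP; rewrite eq_le measure_ge0 andbT.
apply: (@le_trans _ _ (mu1 [set a n])); last by rewrite leNgt; apply/negP.
apply: le_measure; rewrite ?inE; [|exact: measurable_set1C|by move=> z []].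
by apply: measurableD; [exact: measurable_set1C|exact: measurable_point_masses].
Qed.

Lemma nonatomic_part_dominates mu1 mu2 (cmu1 : compact (supp mu1))
    (cmu2 : compact (supp mu2)) (W : Lp mu1 p1 -> Lp mu2 p1)
    (V : Lp mu2 p1 -> Lp mu1 p1) : oper W -> oper V -> cancel W V ->
  compact_operator (fun X => W (mult_op p1 cmu1 X) - mult_op p1 cmu2 (W X)) ->
  nonatomic_part mu1 `<< nonatomic_part mu2.
Proof.
move=> oW oV WV cC; apply/null_content_dominatesP => E mE E2.
have mP1 := measurable_point_masses mu1; have mP2 := measurable_point_masses mu2.
apply: contrapT => E1.
(* Besides the atoms of mu1, the atoms of mu2 are removed: this costs a further mu1-null set only,
   and makes mu2 itself, not just its nonatomic part, vanish on the set. *)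
pose E' := (E `&` ~` point_masses mu1) `\` point_masses mu2.
have mE' : measurable E'.
  by apply: measurableD => //; apply: measurableI => //; exact: measurableC.
have E'1 : (0 < mu1 E')%E.
  rewrite lt0e measure_ge0 andbT; apply/negP => /eqP E'0; apply: E1.
  apply: (@measure_negligible _ _ _ mu1).
    by apply: measurableI => //; exact: measurableC.
  apply: (@negligibleS _ _ _ _ (E' `|` (point_masses mu2 `\` point_masses mu1))).
    move=> z [Ez Pz]; have [Qz|Qz] := pselect (point_masses mu2 z); [by right|by left].
  apply: negligibleU; last exact: negligible_point_masses.
  by exists E'; split.
have [F [cF FE F1]] := closed_inner mE' E'1.
have mF := closed_measurableC cF.
(* Intersecting with the support makes the closed set compact and loses only a mu1-null set. *)
pose A : set (borelC R) := supp mu1 `&` F.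
have cA : compact (A : set R[i]) by exact: compact_closedI.
have mA : measurable A.
  by apply: closed_measurableC; apply: compact_closed => //; exact: norm_hausdorff.
apply: (singular_diffuse_null oW oV WV cC mA cA _ p_neq2).
- apply/eqP; rewrite eq_le measure_ge0 andbT -E2.
  apply: (@le_measure _ _ _ mu2); rewrite ?inE//.
    by apply: measurableI => //; exact: measurableC.
  by move=> z [_ /FE[[]]].
- move=> z [_ /FE[[_ Pz] _]]; apply/eqP; rewrite eq_le measure_ge0 andbT.
  by rewrite leNgt; apply/negP.
rewrite lt0e measure_ge0 andbT; apply/negP => /eqP A0.
have : mu1 F = 0%E.
  apply: (@measure_negligible _ _ _ mu1) => //.
  apply: (@negligibleS _ _ _ _ (A `|` ~` supp mu1)).
    by move=> z Fz; have [?|?] := pselect (supp mu1 z); [left|right].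
  by apply: negligibleU; [exists A; split|exact: (supp_ae mu1)].
by move=> F0; rewrite F0 ltxx in F1.
Qed.

End necessity.

Theorem theorem1p2 (R : realType) (p : R) (p_gt1 : 1 < p) (p_neq2 : p != 2)
    (mu1 mu2 : {finite_measure set borelC R -> \bar R})
    (cmu1 : compact (supp mu1)) (cmu2 : compact (supp mu2))
    (imu1 : ~ finite_set (supp mu1)) (imu2 : ~ finite_set (supp mu2)) :
  (exists K : Lp mu2 (ltW p_gt1) -> Lp mu2 (ltW p_gt1),
      compact_operator K /\
      similar_operators (mult_op (ltW p_gt1) cmu1)
        (fun f => mult_op (ltW p_gt1) cmu2 f + K f)) <->
  (equivalent_measures (nonatomic_part mu1) (nonatomic_part mu2) /\
   limit_point (supp mu1) = limit_point (supp mu2)).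
Proof.
split=> [[K [cK [W [V [cW cV WV VW E]]]]]|[nu12 L12]].
  have oW : oper W by split=> // a x y; exact: linearP.
  have oV : oper V by split=> // a x y; exact: linearP.
  have EY Y : mult_op (ltW p_gt1) cmu2 Y + K Y = W (mult_op (ltW p_gt1) cmu1 (V Y)).
    by have := congr1 (fun f => f Y) E.
  have c1 : compact_operator (fun X => W (mult_op (ltW p_gt1) cmu1 X) -
      mult_op (ltW p_gt1) cmu2 (W X)).
    rewrite (_ : (fun X => _) = fun X => K (W X)); first exact: compact_operator_compr.
    by apply/funext => X; rewrite -{1}(WV X) -EY addrAC subrr add0r.
  have c2 : compact_operator (fun Y => V (mult_op (ltW p_gt1) cmu2 Y) -
      mult_op (ltW p_gt1) cmu1 (V Y)).
    rewrite (_ : (fun Y => _) = fun Y => - V (K Y)).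
      by apply: compact_operator_opp; exact: compact_operator_compl.
    apply/funext => Y; rewrite -[mult_op _ cmu1 _]WV -EY (operD oV).
    by rewrite opprD addrA subrr add0r.
  split; first by split; [exact: (nonatomic_part_dominates p_neq2 oW oV WV c1)|
    exact: (nonatomic_part_dominates p_neq2 oV oW VW c2)].
  apply/seteqP; split; first exact: (limit_points_sub oW oV WV c1).
  exact: (limit_points_sub oV oW VW c2).
have [W [V [oW oV WV VW c]]] := csim_of_equivalent p_gt1 cmu1 cmu2 imu1 imu2 nu12 L12.
(* The perturbation is W M_1 V - M_2, the negative of the defect that [csim] declares compact. *)
exists (fun Y => - (mult_op (ltW p_gt1) cmu2 Y - W (mult_op (ltW p_gt1) cmu1 (V Y)))).
split; first exact: compact_operator_opp.
exists (operL oW), (operL oV); split => //; [exact: oW.2|exact: oV.2|].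
by apply/funext => Y /=; rewrite opprB addrC subrK.
Qed.
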